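(* Let $E \subset \mathbb{R}^2$ be a bounded rectifiable set with $\mathcal{H}^1(E)<\infty$, with a tangent field and corresponding normal lines $\nu_x$. Let $\varepsilon > 0$, and let $\rho\in\mathrm{Isom}^+(\mathbb{R}^2)$, $\rho\neq\mathrm{id}$, be arbitrary. Let $\ell\subset\mathbb{P}^2$ be a projective line through the projective center of $\rho$. Then there are finitely many points $x_1,\dots,x_n\in\mathbb{R}^3\setminus\{0\}$, giving intrinsic rotations $\rho_i=\rho(x_i)$ with projective centers $z_i \in B(\ell, \varepsilon) \subset \mathbb{P}^2$, such that the corresponding polygonal path $P=\bigcup_{i=1}^n L_i\subset\mathrm{Isom}^+(\mathbb{R}^2)$ connects the identity and $\rho$, and for each $i$ there exists a $u_i \in \ell$ such that $$\Big|\bigcup_{i=1}^n\ \bigcup_{p\in L_i} p\big(\{x\in E:\ \nu_x \cap \ell \cap B(u_i, \varepsilon) = \emptyset\}\big)\Big|< \varepsilon .$$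
   Context: Identify $\mathbb{R}^2$ with $\mathbb{C}$ and $\mathbb{R}^3$ with $\mathbb{R}^2\times\mathbb{R}$. $\mathcal{H}^1$ is 1-dimensional Hausdorff measure, $|\cdot|$ is Lebesgue measure on $\mathbb{R}^2$, and $\mathrm{Isom}^+(\mathbb{R}^2)$ is the group of orientation-preserving isometries of the plane. Projective plane. $\mathbb{P}^1\simeq\mathbb{R}/\pi\mathbb{Z}$ is the set of directions in $\mathbb{R}^2$, and $\mathbb{P}^2=\mathbb{R}^2\cup\mathbb{P}^1$ is the quotient of $\mathbb{R}^3\setminus\{0\}$ by nonzero scalars; $z\in\mathbb{R}^2$ corresponds to the class of $(z,1)$ and $\theta\in\mathbb{P}^1$ to the class of $(e^{i\theta},0)$. $\mathbb{P}^2$ carries the metric induced from the arc-length metric of the unit sphere $S^2$ via $S^2\to\mathbb{P}^2$. $B(u,r)$ is the open ball and $B(S,r)$ the open $r$-neighborhood of a set $S$ in this metric. Rectifiability. $E$ is rectifiable if $\mathcal{H}^1$-a.e. point of $E$ can be covered by countably many $C^1$ curves. A tangent field is a map $x\mapsto\theta_x\in\mathbb{P}^1$ on $E$ such that for any $C^1$ curve $\Gamma$ the tangent direction of $\Gamma$ at $x$ equals $\theta_x$ for $\mathcal{H}^1$-a.e. $x\in\Gamma\cap E$ (it exists and is unique up to $\mathcal{H}^1$-null sets; the statement holds for any pointwise choice). $\nu_x\subset\mathbb{P}^2$ is the normal line of $E$ at $x$: the (projective) line through $x$ whose direction is orthogonal to $\theta_x$. Rotations. For $y=(w,\phi)\in\mathbb{R}^2\times\mathbb{R}$,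 $y\ne0$, $\rho(y)\in\mathrm{Isom}^+(\mathbb{R}^2)$ is the map $u\mapsto e^{i\phi}(u-z)+z$ with $z=w/\phi$ if $\phi\neq0$, and the translation $u\mapsto u-iw$ if $\phi=0$; put $\rho(0)=\mathrm{id}$. Every element of $\mathrm{Isom}^+(\mathbb{R}^2)$ other than the identity is of the form $\rho(y)$, and its projective center is the image of $y$ in $\mathbb{P}^2$ (so it is the center of rotation, or, for a translation, the point at infinity orthogonal to the direction of translation). Translations are also called rotations. Intrinsic rotations and polygonal paths. For a finite sequence $\rho_i=\rho(x_i)$, $i=1,\dots,n$, regarded as intrinsic rotations (i.e. performed one after another, each specified in the moving coordinate system), the corresponding polygonal path is $P=\bigcup_{i=1}^nL_i$ with ''line segments'' $L_i=\{\rho_1\circ\cdots\circ\rho_{i-1}\circ\rho(tx_i):\ t\in[0,1]\}$. It connects the identity to $\rho_1\circ\cdots\circ\rho_n$. *)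

(* Defs.v *)
From mathcomp Require Import all_boot all_order all_algebra generic_quotient.
From mathcomp Require Import all_classical all_reals all_analysis.
Import Order.TTheory GRing.Theory Num.Theory.
Import numFieldNormedType.Exports.

Set Implicit Arguments.
Unset Strict Implicit.
Unset Printing Implicit Defensive.

Local Open Scope classical_set_scope.
Local Open Scope ring_scope.

(* The plane R^2 = C is [R * R] and R^3 = R^2 x R is [R * R * R].  The library
   norm on a product is the sup norm, so the Euclidean structure is explicit. *)

Section Plane.
Context {R : realType}.
Implicit Types (u v w : R * R) (a : R).

Definition cmul u v : R * R := (u.1 * v.1 - u.2 * v.2, u.1 * v.2 + u.2 * v.1).

(* e^{ia} *)
Definition cis a : R * R := (cos a, sin a).

Definition dist2 u v : R :=
  Num.sqrt ((u.1 - v.1) ^+ 2 + (u.2 - v.2) ^+ 2).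

Definition cross u v : R := u.1 * v.2 - u.2 * v.1.

(* Isom^+(R^2): distance-preserving maps sending positively oriented
   triangles to positively oriented triangles. *)
Definition isom_plus (f : R * R -> R * R) : Prop :=
  (forall u v, dist2 (f u) (f v) = dist2 u v) /\
  (forall u v w, 0 < cross (v - u) (w - u) ->
     0 < cross (f v - f u) (f w - f u)).

(* rho(w, phi); the case phi = 0 includes rho(0) = id. *)
Definition rotation (y : R * R * R) : R * R -> R * R :=
  let: (w, phi) := y in
  if phi == 0 then fun u => u - cmul (0, 1) w
  else let z := phi^-1 *: w in fun u => cmul (cis phi) (u - z) + z.

(* Outer Lebesgue measure on R^2, so that no measurability is needed. *)
Definition lebesgue2 : set (R * R) -> \bar R :=
  mu_ext ((@lebesgue_measure R) \x (@lebesgue_measure R))%E.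

End Plane.

Section Rectifiability.
Context {R : realType}.
Implicit Types (A E : set (R * R)) (g : R -> R * R).

(* The maximum with 0 makes the diameter of the empty set equal to 0. *)
Definition diam A : \bar R :=
  maxe 0%E
    (ereal_sup [set d | exists u v, [/\ A u, A v & d = (dist2 u v)%:E]]).

Definition hausdorff1_pre (delta : R) A : \bar R :=
  ereal_inf [set (\sum_(0 <= k <oo) diam (U k))%E | U in
    [set U : nat -> set (R * R) |
      A `<=` \bigcup_k U k /\ forall k, (diam (U k) <= delta%:E)%E]].

Definition hausdorff1 A : \bar R :=
  ereal_sup [set hausdorff1_pre delta A | delta in [set delta | 0 < delta]].

(* Curves are given by regular parametrisations on R; an open arc is
   reparametrised by R, and a closed arc is contained in an open one. *)
Definition C1_curve g : Prop :=
  [/\ forall t, derivable g t 1, continuous (derive1 g) & forall t, derive1 g t != 0].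

Definition rectifiable E : Prop :=
  exists2 g : nat -> R -> R * R, forall k, C1_curve (g k) &
    hausdorff1 (E `\` \bigcup_k range (g k)) = 0%E.

(* The direction theta_x in P^1 = R/(pi Z) is represented by any real angle
   [theta x] in its class; every use of it is pi-periodic.  A regular curve has
   more than one tangent direction at only countably many points, hence the
   quantification over all parameters t with g t = x is harmless. *)
Definition tangent_field E (theta : R * R -> R) : Prop :=
  forall g, C1_curve g ->
    hausdorff1 [set x | E x /\
      exists2 t, g t = x & cross (derive1 g t) (cis (theta x)) != 0] = 0%E.

End Rectifiability.

Definition nonzero3 (R : realType) := {y : R * R * R | y != 0}.

Definition proportional (R : realType) (v w : nonzero3 R) : bool :=
  `[< exists2 c : R, c != 0 & val w = c *: val v >].

Lemma proportional_equiv (R : realType) :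
  equiv_class_of (@proportional R).
Proof.
split.
- by move=> v; apply/asboolP; exists 1; rewrite ?oner_neq0 // scale1r.
- suff h v w : proportional v w -> @proportional R w v.
    by move=> v w; apply/idP/idP; apply: h.
  move=> /asboolP[c c0 e]; apply/asboolP; exists c^-1; first by rewrite invr_eq0.
  by rewrite e scalerA mulVf // scale1r.
- move=> w v x /asboolP[c c0 e] /asboolP[d d0 e']; apply/asboolP.
  by exists (d * c); rewrite ?mulf_neq0 // e' e scalerA.
Qed.

Canonical proportional_equiv_rel (R : realType) :=
  EquivRelPack (proportional_equiv R).

Definition P2 (R : realType) := {eq_quot (@proportional R)}%qT.

Section ProjectivePlane.
Context {R : realType}.
Implicit Types (v w : R * R * R) (p q : P2 R) (S l : set (P2 R)).

Definition pclass (y : nonzero3 R) : P2 R := \pi_(P2 R)%qT y.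

Definition dot3 v w : R := v.1.1 * w.1.1 + v.1.2 * w.1.2 + v.2 * w.2.

(* The quotient of the arc-length metric of the unit sphere. *)
Definition pdist p q : R :=
  inf [set d | exists v w : nonzero3 R,
    [/\ dot3 (val v) (val v) = 1, dot3 (val w) (val w) = 1,
        pclass v = p, pclass w = q & d = acos (dot3 (val v) (val w))]].

Definition pball p (r : R) : set (P2 R) := [set q | pdist p q < r].

Definition pnbhd S (r : R) : set (P2 R) := \bigcup_(p in S) pball p r.

Definition projective_line l : Prop :=
  exists n : nonzero3 R,
    l = [set pclass v | v in [set v | dot3 (val n) (val v) = 0]].

(* The projective line through x = [(x, 1)] and the point at infinity
   a + pi/2 = [(i e^{ia}, 0)], i.e. orthogonal to the direction a. *)
Definition normal_line (x : R * R) (a : R) : set (P2 R) :=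
  [set pclass v | v in [set v | exists s t : R,
    val v = s *: (x, 1) + t *: (cmul (0, 1) (cis a), 0)]].

Definition projective_center (f : R * R -> R * R) p : Prop :=
  exists2 y : nonzero3 R, f = rotation (val y) & p = pclass y.

End ProjectivePlane.

Section PolygonalPath.
Context {R : realType} (n : nat).
Implicit Types (x : 'I_n -> nonzero3 R) (i : 'I_n).

Definition compm (f g : R * R -> R * R) : R * R -> R * R := f \o g.

(* rho_1 o ... o rho_n; [\big] over 'I_n composes in increasing index order *)
Definition path_end x : R * R -> R * R :=
  \big[compm/id]_(j < n) rotation (val (x j)).

(* rho_1 o ... o rho_(i-1) *)
Definition path_vertex x i : R * R -> R * R :=
  \big[compm/id]_(j < n | (j < i)%N) rotation (val (x j)).

Definition path_segment x i : set (R * R -> R * R) :=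
  [set path_vertex x i \o rotation (t *: val (x i)) |
    t in [set t : R | 0 <= t <= 1]].

End PolygonalPath.

(* Main.v *)
From HB Require Import structures.
Require Import Defs.
From mathcomp Require Import all_boot all_order all_algebra generic_quotient.
From mathcomp Require Import all_classical all_reals all_analysis.
From mathcomp Require Import ring lra.
Import Order.TTheory GRing.Theory Num.Theory.
Import numFieldNormedType.Exports.
Set Implicit Arguments.
Unset Strict Implicit.
Unset Printing Implicit Defensive.
Local Open Scope classical_set_scope.
Local Open Scope ring_scope.

(** A rotation [rotation x] is the time-one map of the flow [t |-> rotation (t *: x)],
whose initial velocity at [u] is linear in [x] ([rotation_velocity]).  If [u] lies
on a curve with tangent [T], the component of this velocity across the curve is proportional
to [dot3 (normal_functional u T) x]; as a function of [x] it vanishes exactly when the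
centre of the rotation is on the normal line at [u].  A short arc whose normals
almost pass through the centre therefore moves almost along itself, and the area
that it sweeps is a small multiple of its length times the length of the motion
([covers_strip]).

The proof replaces the given rotation by a long list of tiny rotations whose
centres stay near [l].  A unit vector of the plane of [l] in R^3 is written
[dirv a]; each step of the list carries a vector close to a multiple of [dirv] of
one end of an angular sector [[a, b]].  At the start there is one step with a sector of
width zero.  One refinement increases all widths by [del]: a step with sector
[[a, b]] is replaced by [n] alternating copies of two steps, one with sector
[[a, b + del]] and direction [b + del], the other with sector [[a - del, b]] and
direction [a - del]; for [n] large their composite is the old step
([split_rotation]).  Call an arc aligned with a step if its normal functional is
small at some direction of the sector of the step.

Consider what aligned arcs sweep ([refine_step]).  If an arc is aligned with a step,
it is aligned with both of its children, and for large [n] the zigzag stays in a thin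
neighbourhood of the motion of the parent: hardly any area is added.  If an arc is
aligned with a child but not with its parent, the small value occurs in the part of
the sector that was just added, hence within [del] of the direction of that child,
so the child moves the arc almost along itself.  Summing over all levels, the area
swept by aligned arcs is at most a constant times the tolerance used for alignment
times the total length of the motion.  Each refinement multiplies the length
by a ratio of cosines, and the product telescopes ([inv_lengthS]): when the widths
reach [pi - 2 * e] the length has grown by a factor at most
[(sin e * sin (e / 2))^-1], whatever [del] is ([inv_length_bound]).  Letting the
tolerance, and [del] with it, tend to zero makes the area small ([zigzag_arcs]).

A point of [E] that has to be controlled during a step with sector
[[a, a + (pi - 2 * e)]] has a normal line that avoids the ball of radius [eps] about
the point of angle [a - e] on [l].  The remaining angles are within [e] of [a - e]
modulo [pi], so its normal functional has a zero in the sector: the arc through it is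
aligned with the step ([normal_zero_in_sector]).  Finally, up to a set of small length,
a rectifiable set of finite length lies on finitely many compact arcs with the
prescribed tangents ([rectifiable_arcs]), and a set of small length sweeps little area
along a motion of bounded length ([lebesgue2_sweep]). *)

(** * Rotations of the plane and their generators *)

Section Rotations.
Context {R : realType}.
Implicit Types (u v w : R * R) (x y z : R * R * R) (p : R * R -> R * R).

Lemma pair_norm_le {U V : normedModType R} (u : U * V) (r : R) :
  (`|u| <= r) = (`|u.1| <= r) && (`|u.2| <= r).
Proof. by rewrite prod_normE ge_max. Qed.

Lemma norm_fst {U V : normedModType R} (u : U * V) : `|u.1| <= `|u|.
Proof. by rewrite prod_normE le_max lexx. Qed.

Lemma norm_snd {U V : normedModType R} (u : U * V) : `|u.2| <= `|u|.
Proof. by rewrite prod_normE le_max lexx orbT. Qed.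

Lemma scaleRE (a b : R^o) : a *: b = a * b.
Proof. by []. Qed.

Lemma norm_cmul u v : `|cmul u v| <= 2 * (`|u| * `|v|).
Proof.
have h (a b c d : R) : `|a| <= `|u| -> `|b| <= `|v| -> `|c| <= `|u| ->
    `|d| <= `|v| -> `|a * b| + `|c * d| <= 2 * (`|u| * `|v|).
  by move=> *; rewrite !normrM mulr_natl mulr2n lerD// ler_pM.
rewrite pair_norm_le /cmul /=; apply/andP; split.
  by apply: le_trans (ler_normB _ _) (h _ _ _ _ _ _ _ _);
    rewrite ?norm_fst ?norm_snd.
by apply: le_trans (ler_normD _ _) (h _ _ _ _ _ _ _ _);
    rewrite ?norm_fst ?norm_snd.
Qed.

Lemma cmulDr u v w : cmul u (v + w) = cmul u v + cmul u w.
Proof. by apply: injective_projections; rewrite /=; ring. Qed.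
Lemma cmulBr u v w : cmul u (v - w) = cmul u v - cmul u w.
Proof. by apply: injective_projections; rewrite /=; ring. Qed.
Lemma cmulA u v w : cmul u (cmul v w) = cmul (cmul u v) w.
Proof. by apply: injective_projections; rewrite /=; ring. Qed.

Lemma cisD (a b : R) : cis (a + b) = cmul (cis a) (cis b).
Proof. by apply: injective_projections => /=; rewrite ?cosD ?sinD // addrC. Qed.

Lemma cis0 : cis (0 : R) = (1, 0).
Proof. by rewrite /cis cos0 sin0. Qed.

Lemma norm_cis (a : R) : `|cis a| <= 1.
Proof. by rewrite pair_norm_le /= cos_max sin_max. Qed.

Lemma norm_sin_le (a : R) : `|sin a| <= `|a|.
Proof.
wlog a0 : a / 0 <= a => [h|].
  have [/h//|/ltW] := leP 0 a; rewrite -oppr_ge0 => /h.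
  by rewrite sinN !normrN.
have [|c _] := @MVT_segment R sin cos 0 a a0.
  by apply: continuous_subspaceT; apply: continuous_sin.
rewrite sin0 !subr0 => ->; rewrite normrM ler_piMl// cos_max//.
Qed.

Lemma norm_cosB1_le (a : R) : `|cos a - 1| <= `|a| ^+ 2.
Proof.
wlog a0 : a / 0 <= a => [h|].
  have [/h//|/ltW] := leP 0 a; rewrite -oppr_ge0 => /h.
  by rewrite cosN !normrN.
have [|c] := @MVT_segment R cos (fun t => - sin t) 0 a a0.
  by apply: continuous_subspaceT; apply: continuous_cos.
rewrite in_itv/= => /andP[c0 ca]; rewrite cos0 !subr0 => ->.
rewrite normrM normrN expr2 ler_wpM2r//.
by rewrite (le_trans (norm_sin_le _))// !ger0_norm.
Qed.

Lemma norm_cosB1_le1 (a : R) : `|cos a - 1| <= `|a|.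
Proof.
wlog a0 : a / 0 <= a => [h|].
  have [/h//|/ltW] := leP 0 a; rewrite -oppr_ge0 => /h.
  by rewrite cosN !normrN.
have [|c _] := @MVT_segment R cos (fun t => - sin t) 0 a a0.
  by apply: continuous_subspaceT; apply: continuous_cos.
by rewrite cos0 !subr0 => ->; rewrite normrM normrN ler_piMl// sin_max.
Qed.

Lemma norm_sinB_le (a : R) : `|sin a - a| <= `|a| ^+ 2.
Proof.
wlog a0 : a / 0 <= a => [h|].
  have [/h//|/ltW] := leP 0 a; rewrite -oppr_ge0 => /h.
  by rewrite sinN -opprD !normrN.
have [|c] := @MVT_segment R (fun t => sin t - t) (fun t => cos t - 1) 0 a a0.
  apply: continuous_subspaceT => t; apply: cvgB; [exact: continuous_sin|exact: cvg_id].
rewrite in_itv/= => /andP[c0 ca]; rewrite sin0 !subr0 => ->.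
rewrite normrM expr2 ler_wpM2r//.
by rewrite (le_trans (norm_cosB1_le1 _))// !ger0_norm.
Qed.

Lemma norm_cisB (a : R) : `|cis a - (1, 0)| <= `|a|.
Proof. by rewrite pair_norm_le /= subr0 norm_cosB1_le1 norm_sin_le. Qed.

Lemma norm_cisB2 (a : R) : `|cis a - (1, a)| <= `|a| ^+ 2.
Proof. by rewrite pair_norm_le /= norm_cosB1_le norm_sinB_le. Qed.

(** [cmul (drift phi) w] is the image of the origin under [rotation (w, phi)].
The factor [(1 - cis phi) / phi] extends continuously to [phi = 0] by [- i], so
[rotation x u] is affine in [u] by one formula that covers translations too
([rotationE]). *)
Definition drift (a : R) : R * R :=
  if a == 0 then (0, - 1) else a^-1 *: ((1, 0) - cis a).

Lemma norm_driftD (a : R) : `|drift a + (0, 1)| <= `|a|.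
Proof.
rewrite /drift; case: eqP => [->|/eqP a0].
  by rewrite pair_norm_le /= addr0 addNr !normr0 lexx.
have a1 : 0 < `|a| by rewrite normr_gt0.
have -> : a^-1 *: ((1, 0) - cis a) + (0, 1) = - (a^-1 *: (cis a - (1, a))).
  by apply: injective_projections; rewrite /= ?scaleRE; field.
rewrite normrN normrZ normfV mulrC ler_pdivrMr// -expr2.
exact: norm_cisB2.
Qed.

Lemma rotationE x u :
  rotation x u = cmul (cis x.2) u + cmul (drift x.2) x.1.
Proof.
case: x => w a; rewrite /rotation /drift /=; case: eqP => [->|/eqP a0].
  by rewrite cis0; apply: injective_projections => /=; ring.
by rewrite /cis; apply: injective_projections => /=; rewrite ?scaleRE; field.
Qed.

Lemma drift_mul (a t : R) :
  t *: drift (t * a) = if a == 0 then t *: (0, -1) else a^-1 *: ((1, 0) - cis (t * a)).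
Proof.
rewrite /drift; have [->|a0] := eqVneq a 0; first by rewrite mulr0 eqxx.
have [->|t0] := eqVneq t 0; first by rewrite mul0r eqxx scale0r cis0 subrr scaler0.
by rewrite mulf_eq0 (negbTE a0) (negbTE t0) /= scalerA invfM mulVKf.
Qed.

Lemma rotation_scale (t : R) x u :
  rotation (t *: x) u = cmul (cis (t * x.2)) u + cmul (t *: drift (t * x.2)) x.1.
Proof.
by rewrite rotationE /=; congr (_ + _); apply: injective_projections; rewrite /= ?scaleRE; ring.
Qed.

(** [t |-> rotation (t *: x)] is a one-parameter group; this is what allows a
rotation to be cut into equal pieces. *)
Lemma rotation_add (s t : R) x u :
  rotation ((s + t) *: x) u = rotation (s *: x) (rotation (t *: x) u).
Proof.
rewrite !rotation_scale !drift_mul mulrDl cisD; case: eqP => [->|/eqP a0].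
  by rewrite !mulr0 !cis0; apply: injective_projections; rewrite /= ?scaleRE; ring.
by apply: injective_projections; rewrite /= ?scaleRE; field.
Qed.

Lemma rotation0 u : rotation 0 u = u.
Proof. by rewrite rotationE /= cis0; apply: injective_projections; rewrite /=; ring. Qed.

Lemma rotationKN x u : rotation x (rotation (- x) u) = u.
Proof.
by rewrite -{1}(scale1r x) -scaleN1r -rotation_add addrN scale0r rotation0.
Qed.

Definition velocity x u : R * R := cmul (0, 1) (x.2 *: u - x.1).

(** Second-order Taylor bound: [velocity x] is the vector field that generates
the rotations about the centre of [x]. *)
Lemma rotation_velocity x u :
  `|rotation x u - u - velocity x u| <= 2 * `|x| ^+ 2 * (`|u| + 1).
Proof.
have -> : rotation x u - u - velocity x u =
    cmul (cis x.2 - (1, x.2)) u + cmul (drift x.2 + (0, 1)) x.1.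
  by rewrite rotationE; apply: injective_projections; rewrite /= ?scaleRE; ring.
apply: le_trans (ler_normD _ _) _.
apply: le_trans (lerD (norm_cmul _ _) (norm_cmul _ _)) _.
have h1 := norm_cisB2 x.2; have h2 := norm_driftD x.2.
have h3 := norm_fst x; have h4 := norm_snd x.
rewrite -mulrDr -mulrA ler_wpM2l// mulrDr mulr1 lerD//.
  rewrite ler_wpM2r// (le_trans h1)// ler_sqr ?nnegrE//.
by rewrite expr2 ler_pM// (le_trans h2).
Qed.

Lemma rotation_move x u : `|rotation x u - u| <= 4 * `|x| * (`|u| + 1).
Proof.
have h1 := norm_cisB x.2; have h2 := norm_driftD x.2.
have h3 := norm_fst x; have h4 := norm_snd x.
have -> : rotation x u - u = cmul (cis x.2 - (1, 0)) u + cmul (drift x.2) x.1.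
  by rewrite rotationE; apply: injective_projections; rewrite /= ?scaleRE; ring.
apply: le_trans (ler_normD _ _) _.
apply: le_trans (lerD (norm_cmul _ _) (norm_cmul _ _)) _.
have h5 : `|drift x.2| <= 2.
  rewrite /drift; case: eqP => [_|/eqP a0].
    by rewrite pair_norm_le /= normr0 normrN normr1 ler0n ler1n.
  rewrite normrZ normfV mulrC ler_pdivrMr ?normr_gt0// -normrN opprB.
  by rewrite (le_trans h1)// ler_peMl// ler1n.
have := normr_ge0 u; have := normr_ge0 x.
have : `|cis x.2 - (1, 0)| * `|u| <= `|x| * `|u|.
  by rewrite ler_wpM2r// (le_trans h1).
have : `|drift x.2| * `|x.1| <= 2 * `|x| by rewrite ler_pM.
nra.
Qed.

(** The partial composites of a polygonal path have this form, which is closed under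
composition and Lipschitz; the constant 2 in [rigid_lip] comes from the sup norm. *)
Definition rigid p := exists a v, forall u, p u = cmul (cis a) u + v.

Lemma rigid_rotation x : rigid (rotation x).
Proof. by exists x.2, (cmul (drift x.2) x.1) => u; rewrite rotationE. Qed.

Lemma rigid_id : rigid id.
Proof. by exists 0, 0 => u; rewrite cis0; apply: injective_projections; rewrite /=; ring. Qed.

Lemma rigid_comp p q : rigid p -> rigid q -> rigid (p \o q).
Proof.
move=> [a [v hp]] [b [w hq]]; exists (a + b), (cmul (cis a) w + v) => u /=.
by rewrite hp hq cmulDr cisD cmulA addrA.
Qed.

Lemma rigid_lip p u v : rigid p -> `|p u - p v| <= 2 * `|u - v|.
Proof.
move=> [a [w hp]]; rewrite !hp opprD addrACA subrr addr0 -cmulBr.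
apply: le_trans (norm_cmul _ _) _; rewrite ler_wpM2l// ler_piMl//.
exact: norm_cis.
Qed.

(** [drift a] is within [`|a|] of [- i], so it is invertible and its inverse is within
[O(`|a|)] of [i]. *)
Lemma drift_solve (a : R) v : `|a| <= 1 / 2 ->
  exists2 w, cmul (drift a) w = v & `|w - cmul (0, 1) v| <= 48 * (`|a| * `|v|).
Proof.
move=> a12; have h := norm_driftD a.
set e := drift a in h *.
have h1 : `|e.1| <= `|a| by have := norm_fst (e + (0, 1)) => /= ; rewrite addr0 => /le_trans; apply.
have h2 : `|e.2 + 1| <= `|a| by have := norm_snd (e + (0, 1)) => /= => /le_trans; apply.
have n2 : 1 / 4 <= e.1 ^+ 2 + e.2 ^+ 2.
  have : `|e.2 + 1| <= 1 / 2 by lra.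
  rewrite ler_norml => /andP[]; nra.
set n := e.1 ^+ 2 + e.2 ^+ 2 in n2.
have n0 : n != 0 by apply: lt0r_neq0; lra.
set w := n^-1 *: cmul (e.1, - e.2) v.
exists w.
  by apply: injective_projections; rewrite /w /= ?scaleRE /n; field; exact: n0.
have wE : w - cmul (0, 1) v = cmul (1 + e.2, - e.1) w.
  by apply: injective_projections; rewrite /w /= ?scaleRE /n; field; exact: n0.
have ew : `|w| <= 24 * `|v|.
  rewrite /w normrZ normfV (@ger0_norm _ n); last by lra.
  rewrite mulrC ler_pdivrMr; last by lra.
  apply: le_trans (norm_cmul _ _) _.
  have : `|(e.1, - e.2)| <= 2.
    rewrite pair_norm_le /= normrN; apply/andP; split; first by lra.
    have := ler_normB (e.2 + 1) 1; rewrite addrK normr1; lra.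
  have := normr_ge0 v; have := normr_ge0 (e.1, - e.2); nra.
rewrite wE; apply: le_trans (norm_cmul _ _) _.
have : `|(1 + e.2, - e.1)| <= `|a| by rewrite pair_norm_le /= normrN addrC h2 h1.
have := normr_ge0 v; have := normr_ge0 w; have := normr_ge0 (1 + e.2, - e.1).
nra.
Qed.

(** Baker-Campbell-Hausdorff to first order: [rotation x] followed by the inverse of
[rotation y] is [rotation z] with [z] equal to [x - y] up to a quadratic error.  The angles
subtract exactly; only the translation part has to be solved for. *)
Lemma rotation_log x y : `|x| <= 1 / 4 -> `|y| <= 1 / 4 ->
  exists2 z, (forall u, rotation y (rotation z u) = rotation x u) &
    `|z - (x - y)| <= 300 * (`|x| + `|y|) ^+ 2.
Proof.
move=> x4 y4.
pose v := cmul (cis (- y.2)) (cmul (drift x.2) x.1) + cmul (drift (- y.2)) (- y.1).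
have [[[x1 x2] y1] y2] := (norm_fst x, norm_snd x, norm_fst y, norm_snd y).
have a12 : `|x.2 - y.2| <= `|x| + `|y|.
  by rewrite (le_trans (ler_normB _ _))// lerD.
have [|w wv wi] := @drift_solve (x.2 - y.2) v; first by lra.
exists (w, x.2 - y.2).
  move=> u; rewrite -(rotationKN y (rotation x u)); congr (rotation y _).
  rewrite !rotationE /= wv /v !cmulDr !addrA; congr (_ + _ + _).
  by rewrite cmulA addrC cisD.
have -> : (w, x.2 - y.2) - (x - y) = (w - (x.1 - y.1), 0) by apply: injective_projections => //=; ring.
rewrite pair_norm_le; apply/andP; split; last first.
  by rewrite [X in `|X|]/= normr0 mulr_ge0 ?ler0n// exprn_ge0// addr_ge0.
rewrite [X in `|X|]/=.
have vE : v - cmul (0, - 1) (x.1 - y.1) =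
    cmul (cmul (cis (- y.2)) (drift x.2 + (0, 1)) + cmul (cis (- y.2) - (1, 0)) (0, -1)) x.1
      - cmul (drift (- y.2) + (0, 1)) y.1.
  by apply: injective_projections; rewrite /v /=; ring.
set X := `|x| in x1 x2 x4 a12 *; set Y := `|y| in y1 y2 y4 a12 *.
have X0 : 0 <= X by exact: normr_ge0.
have Y0 : 0 <= Y by exact: normr_ge0.
have vb : `|v - cmul (0, - 1) (x.1 - y.1)| <= 4 * ((X + Y) * (X + Y)).
  rewrite vE; apply: le_trans (ler_normB _ _) _.
  have e1 : `|cmul (drift (- y.2) + (0, 1)) y.1| <= 2 * (Y * Y).
    apply: le_trans (norm_cmul _ _) _; rewrite ler_wpM2l// ler_pM//.
    by apply: le_trans (norm_driftD _) _; rewrite normrN.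
  have e2 : `|cmul (cis (- y.2)) (drift x.2 + (0, 1)) + cmul (cis (- y.2) - (1, 0)) (0, -1)| <= 2 * X + 2 * Y.
    apply: le_trans (ler_normD _ _) _; apply: lerD.
      apply: le_trans (norm_cmul _ _) _; rewrite ler_wpM2l//.
      rewrite -[leRHS]mul1r ler_pM ?norm_cis//.
      by rewrite (le_trans (norm_driftD _)).
    apply: le_trans (norm_cmul _ _) _; rewrite ler_wpM2l// -[leRHS]mulr1.
    rewrite ler_pM//; first by rewrite (le_trans (norm_cisB _))// normrN.
    by rewrite pair_norm_le /= normr0 normrN normr1 ler01 lexx.
  have := norm_cmul (cmul (cis (- y.2)) (drift x.2 + (0, 1)) + cmul (cis (- y.2) - (1, 0)) (0, -1)) x.1.
  move: (cmul _ _ + _) e2 => q qb.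
  have := normr_ge0 q; have := normr_ge0 x.1; nra.
have xy : `|x.1 - y.1| <= X + Y by rewrite (le_trans (ler_normB _ _))// lerD.
have c01 : `|(0, -1) : R * R| <= 1 by rewrite pair_norm_le /= normr0 normrN normr1 ler01 lexx.
have c10 : `|(0, 1) : R * R| <= 1 by rewrite pair_norm_le /= normr0 normr1 ler01 lexx.
have vb2 : `|v| <= 4 * (X + Y).
  rewrite -[v](subrK (cmul (0, - 1) (x.1 - y.1))).
  apply: le_trans (ler_normD _ _) _.
  have := norm_cmul (0, -1) (x.1 - y.1).
  have := normr_ge0 (x.1 - y.1); nra.
have -> : w - (x.1 - y.1) = (w - cmul (0, 1) v) + cmul (0, 1) (v - cmul (0, - 1) (x.1 - y.1)).
  by apply: injective_projections; rewrite /=; ring.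
apply: le_trans (ler_normD _ _) _.
have := norm_cmul (0, 1) (v - cmul (0, - 1) (x.1 - y.1)).
have : `|x.2 - y.2| * `|v| <= (X + Y) * (4 * (X + Y)) by rewrite ler_pM.
move: (`|v - _|) vb (normr_ge0 (v - cmul (0, - 1) (x.1 - y.1))) => q qb q0.
rewrite expr2; nra.
Qed.

End Rotations.

(** * Covers by squares of small total area *)

Section Covers.
Context {R : realType}.
Implicit Types (u v w : R * R) (x y z : R * R * R) (p : R * R -> R * R).
Implicit Types (A B W : set (R * R)).

(** Finite families of balls of the sup norm, that is, of squares with side
[2 * b.2], whose areas add up to at most [c].  Finiteness is what makes
[covers_thick] hold. *)
Definition covers W (c : R) := exists s : seq ((R * R) * R),
  [/\ forall b, b \in s -> 0 <= b.2,
      forall u, W u -> exists2 b, b \in s & `|u - b.1| <= b.2 &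
      \sum_(b <- s) (2 * b.2) ^+ 2 <= c].

Lemma covers0 : covers set0 0.
Proof. by exists [::]; split => //; rewrite big_nil. Qed.

Lemma covers_sub A B (c d : R) : A `<=` B -> c <= d -> covers B c -> covers A d.
Proof.
move=> AB cd [s [s0 sB sc]]; exists s; split => //; last exact: le_trans cd.
by move=> u /AB /sB.
Qed.

Lemma coversU A B (c d : R) :
  covers A c -> covers B d -> covers (A `|` B) (c + d).
Proof.
move=> [s [s0 sA sc]] [t [t0 tB td]]; exists (s ++ t); split.
- by move=> b; rewrite mem_cat => /orP[/s0|/t0].
- move=> u [/sA|/tB] [b bs ub]; exists b => //; rewrite mem_cat bs ?orbT//.
- by rewrite big_cat/= lerD.
Qed.

Lemma covers_bigcup (n : nat) (F : nat -> set (R * R)) (c : R) :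
  (forall i, (i < n)%N -> covers (F i) c) ->
  covers [set u | exists2 i, (i < n)%N & F i u] (n%:R * c).
Proof.
elim: n => [|n ih] h.
  by apply: (@covers_sub _ set0 0) covers0; [move=> u [] //|rewrite mul0r].
have h1 : covers [set u | exists2 i, (i < n)%N & F i u] (n%:R * c).
  by apply: ih => i ni; apply: h; rewrite ltnS ltnW.
apply: covers_sub (coversU h1 (h n (ltnSn n))); last by rewrite -addn1 natrD mulrDl mul1r.
move=> u [i]; rewrite ltnS leq_eqVlt => /orP[/eqP ->|ni] Fu; [by right|left].
by exists i.
Qed.

(** A finite cover has room to spare: enlarging all its squares slightly costs
arbitrarily little area. *)
Lemma covers_thick W (c d : R) : covers W c -> c < d ->
  exists2 eta : R, 0 < eta &
    covers [set u | exists2 v, W v & `|u - v| <= eta] d.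
Proof.
move=> [s [s0 sW sc]] cd.
have [eta eta0 he] : exists2 eta : R, 0 < eta &
    forall e, 0 <= e <= eta ->
      \sum_(b <- s) (2 * (b.2 + e)) ^+ 2 <= \sum_(b <- s) (2 * b.2) ^+ 2 + (d - c).
  have : 0 < d - c by rewrite subr_gt0.
  move: (d - c) => e.
  elim: s s0 {sW sc cd} e => [|b s ih] s0 e e0.
    by exists 1 => // r _; rewrite !big_nil add0r ltW.
  have [||eta eta0 h] := ih _ (e / 2).
  - by move=> a bs; apply: s0; rewrite inE bs orbT.
  - by rewrite divr_gt0.
  have b0 : 0 <= b.2 by apply: s0; rewrite inE eqxx.
  have q0 : 0 < 8 * b.2 + 4 by lra.
  exists (Num.min eta (Num.min 1 (e / 2 / (8 * b.2 + 4)))).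
    by rewrite !lt_min eta0 ltr01 !divr_gt0.
  move=> r /andP[r0]; rewrite !le_min => /and3P[re r1].
  rewrite ler_pdivlMr// => rq.
  rewrite !big_cons; have := h r; rewrite r0 re => /(_ isT) h1.
  have : (2 * (b.2 + r)) ^+ 2 <= (2 * b.2) ^+ 2 + e / 2.
    have : r * r <= r by rewrite ler_piMl.
    nra.
  lra.
exists eta => //; exists [seq (b.1, b.2 + eta) | b <- s]; split.
- by move=> b /mapP[a /s0 a0 ->] /=; rewrite addr_ge0// ltW.
- move=> u [v /sW[b bs vb] uv]; exists (b.1, b.2 + eta).
    by apply/mapP; exists b.
  by rewrite /= [leRHS]addrC -(subrKA v) (le_trans (ler_normD _ _))// lerD.
- rewrite big_map/= (le_trans (he eta _))//; first by rewrite lexx ltW.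
  lra.
Qed.

(** A square turned by a rigid motion fits in a square of twice the side. *)
Lemma covers_rigid W (c : R) p : rigid p -> covers W c -> covers (p @` W) (4 * c).
Proof.
move=> rp [s [s0 sW sc]]; exists [seq (p b.1, 2 * b.2) | b <- s]; split.
- by move=> b /mapP[a /s0 a0 ->] /=; rewrite mulr_ge0.
- move=> _ [u /sW[b bs ub] <-]; exists (p b.1, 2 * b.2).
    by apply/mapP; exists b.
  by rewrite /= (le_trans (rigid_lip _ _ rp))// ler_wpM2l.
- rewrite big_map/=.
  have -> : \sum_(b <- s) (2 * (2 * b.2)) ^+ 2 = 4 * \sum_(b <- s) (2 * b.2) ^+ 2.
    by rewrite mulr_sumr; apply: eq_bigr => b _; ring.
  by rewrite ler_wpM2l.
Qed.

Lemma unit_grid (n : nat) (t : R) : (0 < n)%N -> 0 <= t <= 1 ->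
  exists2 i : nat, (i < n)%N & i%:R / n%:R <= t <= (i%:R + 1) / n%:R.
Proof.
move=> n0 /andP[t0 t1].
have n1 : 0 < n%:R :> R by rewrite ltr0n.
move: t1; rewrite le_eqVlt => /orP[/eqP ->|t1].
  exists n.-1; first by rewrite prednK.
  have -> : n.-1%:R + 1 = n%:R :> R by rewrite natr1 prednK.
  by rewrite divff ?gt_eqF// lexx ler_pdivrMr// mul1r ler_nat leq_pred.
have tn0 : 0 <= t * n%:R by rewrite mulr_ge0.
have /andP[h1 h2] := truncn_itv tn0.
exists (Num.truncn (t * n%:R)).
  by rewrite -(ltr_nat R) (le_lt_trans h1)// gtr_pMl.
by rewrite ler_pdivrMr// h1 ler_pdivlMr// natr1 ltW.
Qed.

Lemma exists_nat_ge (r : R) : exists2 n : nat, (0 < n)%N & r <= n%:R.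
Proof.
exists (Num.truncn `|r|).+1 => //.
by rewrite ltW// (le_lt_trans (ler_norm _))// truncnS_gt.
Qed.

Lemma exists_nat_ceil (r : R) : 0 <= r ->
  exists2 n : nat, (0 < n)%N & r <= n%:R <= r + 1.
Proof.
move=> r0; exists (Num.truncn r).+1 => //.
by rewrite ltW ?truncnS_gt//= -natr1 lerD2r; have /andP[] := truncn_itv r0.
Qed.

(** Squares of side [6 * r] centred at about [L / r] points of the segment. *)
Lemma covers_segment v w (L r : R) : 0 < r -> r <= L -> `|w| <= L ->
  covers [set u | exists2 t : R, `|t| <= 1 & `|u - (v + t *: w)| <= r]
    (144 * (L * r)).
Proof.
move=> r0 rL wL.
have L0 : 0 <= L by rewrite (le_trans _ rL)// ltW.
have [k k0 /andP[k1 k2]] : exists2 n : nat, (0 < n)%N & L / r <= n%:R <= L / r + 1.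
  by apply: exists_nat_ceil; rewrite divr_ge0// ltW.
have kR : 0 < k%:R :> R by rewrite ltr0n.
pose c (i : nat) : R * R := v + (2 * (i%:R / k%:R) - 1) *: w.
exists [seq (c i, 3 * r) | i <- iota 0 k]; split.
- by move=> b /mapP[i _ ->] /=; rewrite mulr_ge0// ltW.
- move=> u [t t1 ut].
  have [|i ik /andP[i1 i2]] := @unit_grid k ((t + 1) / 2) k0.
    by move: t1; rewrite ler_norml => /andP[]; lra.
  exists (c i, 3 * r); first by apply/mapP; exists i => //; rewrite mem_iota.
  rewrite /=; have -> : u - c i = (u - (v + t *: w)) + (t - (2 * (i%:R / k%:R) - 1)) *: w :> R * R.
    by rewrite scalerBl /c !opprD !addrA subrK.
  apply: le_trans (ler_normD _ _) _; rewrite normrZ.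
  have : `|t - (2 * (i%:R / k%:R) - 1)| <= 2 / k%:R.
    by rewrite ler_norml; rewrite mulrDl div1r in i2; lra.
  have : 2 / k%:R * L <= 2 * r.
    by rewrite mulrAC ler_pdivrMr// -mulrA ler_wpM2l// mulrC -ler_pdivrMr.
  move=> h1 h2; have : `|t - (2 * (i%:R / k%:R) - 1)| * `|w| <= 2 / k%:R * L.
    by rewrite ler_pM.
  lra.
- rewrite big_map /= big_const_seq count_predT size_iota iter_addr_0 -[leLHS]mulr_natl.
  have : k%:R * r <= L + r by rewrite -ler_pdivlMr// mulrDl divff ?gt_eqF.
  move: (k%:R) => q; nra.
Qed.

(** * Arcs that move almost along themselves *)

(** Coefficients of the linear form [x |-> cross T (velocity x v)]
([cross_velocity]): the speed at which [x] pushes [v] across the line of direction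
[T].  Its kernel consists of the vectors of the points of the normal line at [v]
([mem_normal_line]). *)
Definition normal_functional (v T : R * R) : R * R * R :=
  (- T, T.1 * v.1 + T.2 * v.2).

Lemma cross_velocity T x u :
  cross T (velocity x u) = dot3 (normal_functional u T) x.
Proof. by rewrite /cross /dot3 /velocity /= ?scaleRE; ring. Qed.

Lemma dot3Zr (t : R) x y : dot3 x (t *: y) = t * dot3 x y.
Proof. by rewrite /dot3 /= ?scaleRE; ring. Qed.

(** The quantitative content of being a C1 arc on [[a, b]] that the area estimates
need; [dg] is the derivative of [g]. *)
Definition tame_arc (g dg : R -> R * R) (M a b : R) :=
  [/\ 1 <= M,
      forall s, a <= s <= b -> [/\ `|g s| <= M, `|dg s| <= M & 1 <= M * `|dg s|] &
      forall d : R, 0 < d -> exists2 r : R, 0 < r &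
        forall s t, a <= s <= b -> a <= t <= b -> `|t - s| <= r ->
          `|g t - g s - (t - s) *: dg s| <= d * `|t - s| /\ `|dg t - dg s| <= d].

Lemma tame_arc_sub (g dg : R -> R * R) (M a b a' b' : R) :
  tame_arc g dg M a b -> a <= a' -> b' <= b -> tame_arc g dg M a' b'.
Proof.
move=> [M1 h u] aa bb.
have sub s : a' <= s <= b' -> a <= s <= b.
  by move=> /andP[s1 s2]; rewrite (le_trans aa)//= (le_trans s2).
split => //; first by move=> s /sub /h.
move=> d /u [r r0 ru]; exists r => // s t /sub hs /sub ht; exact: ru.
Qed.

Lemma norm_cmul_i u : `|cmul (0, 1) u| = `|u|.
Proof.
have -> : cmul (0, 1) u = (- u.2, u.1).
  by apply: injective_projections; rewrite /=; ring.
by rewrite !prod_normE /= normrN maxC.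
Qed.

Lemma velocity_sub x u v :
  `|velocity x u - velocity x v| <= `|x| * `|u - v|.
Proof.
have -> : velocity x u - velocity x v = cmul (0, 1) (x.2 *: (u - v)).
  by apply: injective_projections; rewrite /= ?scaleRE; ring.
by rewrite norm_cmul_i normrZ ler_wpM2r// norm_snd.
Qed.

Lemma norm_velocity x u : `|velocity x u| <= `|x| * (`|u| + 1).
Proof.
rewrite norm_cmul_i (le_trans (ler_normB _ _))// normrZ mulrDr mulr1.
by rewrite lerD ?ler_wpM2r// ?norm_snd ?norm_fst.
Qed.

(** Splitting [X] into its parts along and across [T]; the part across is governed by
[cross T X]. *)
Lemma cross_decomposition (T X : R * R) (n := T.1 ^+ 2 + T.2 ^+ 2) : n != 0 ->
  X = ((T.1 * X.1 + T.2 * X.2) / n) *: T + (cross T X / n) *: (- T.2, T.1).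
Proof.
rewrite /n /cross => n0.
by apply: injective_projections; rewrite /= ?scaleRE; field.
Qed.

(** The basic estimate.  For time and length both of size [h], the points
[rotation (t *: x) (g s)] lie within [O(d * h)] of the tangent segment at [u0]: the
deviation of the arc from its tangent, the quadratic error of the motion and the
part of the velocity across [T] are all of order [d * h]. *)
Lemma covers_patch (g : R -> R * R) (T : R * R) (M K d h s0 : R) x (u0 := g s0) :
  1 <= M -> (500 * M) ^+ 2 <= K -> 0 < d <= 1 -> 0 < h <= d -> `|x| <= 2 * h ->
  `|u0| <= M -> `|T| <= M -> 1 <= M * `|T| ->
  `|dot3 (normal_functional u0 T) x| <= d * h ->
  covers [set u | exists s t : R, [/\ `|s - s0| <= h,
      `|g s - u0 - (s - s0) *: T| <= d * h, 0 <= t <= 1 & u = rotation (t *: x) (g s)]]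
    (K * (d * h ^+ 2)).
Proof.
move=> M1 MK /andP[d0 d1] /andP[h0 hd] xh uM TM MT nx.
have T0 : 0 < `|T|.
  by rewrite lt_def normr_ge0 andbT; apply: contraTneq MT => ->; rewrite mulr0 -ltNge ltr01.
have M0 : 0 < M by exact: lt_le_trans M1.
(* along [T] the arc advances by at most [M * h] and the motion by at most [8 * M * h] *)
pose S := 9 * M * h / `|T|.
have S0 : 0 < S by rewrite divr_gt0// !mulr_gt0.
pose r := 40 * M * d * h.
pose L := 40 * M * h.
have r0 : 0 < r by rewrite !mulr_gt0.
have rL : r <= L by rewrite /r /L mulrAC ler_piMr// !mulr_ge0// ltW.
apply: (@covers_sub _ [set u | exists2 t : R, `|t| <= 1 & `|u - (u0 + t *: (S *: T))| <= r]
  (144 * (L * r)) _); last 2 first.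
- have -> : 144 * (L * r) = 144 * (40 ^+ 2) * (M ^+ 2 * (d * h ^+ 2)) by rewrite /L /r; ring.
  rewrite mulrA ler_wpM2r//; last by rewrite (le_trans _ MK)// exprMn ler_wpM2r ?sqr_ge0//; lra.
  by rewrite !mulr_ge0// ?exprn_ge0// ltW.
- apply: covers_segment => //.
  rewrite normrZ ger0_norm ?(ltW S0)// /S divfK ?gt_eqF// /L.
  by rewrite -!mulrA ler_wpM2r ?mulr_ge0 ?ltW//; lra.
move=> _ [s [t [sh gs /andP[t0 t1] ->]]].
set u := g s in gs *; pose z := t *: x.
have zh : `|z| <= 2 * h by rewrite normrZ ger0_norm// (le_trans _ xh)// ler_piMl.
pose X := velocity z u0.
have cX : `|cross T X| <= d * h.
  rewrite cross_velocity dot3Zr normrM ger0_norm// (le_trans _ nx)// ler_piMl//.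
have Xh : `|X| <= 4 * M * h.
  apply: le_trans (norm_velocity _ _) _.
  have : `|z| * (`|u0| + 1) <= (2 * h) * (M + 1) by rewrite ler_pM ?addr_ge0 ?lerD.
  have : h <= M * h by rewrite ler_peMl// ltW.
  nra.
pose n := T.1 ^+ 2 + T.2 ^+ 2.
have nT : `|T| ^+ 2 <= n.
  rewrite prod_normE /n; case: (leP `|T.1| `|T.2|) => _; rewrite real_normK ?num_real//.
    by rewrite lerDr sqr_ge0.
  by rewrite lerDl sqr_ge0.
have n0 : 0 < n by rewrite (lt_le_trans _ nT)// exprn_gt0.
pose al := (T.1 * X.1 + T.2 * X.2) / n.
pose be := cross T X / n.
have XE : X = al *: T + be *: (- T.2, T.1).
  by apply: cross_decomposition; rewrite gt_eqF.
have bb : `|be *: (- T.2, T.1)| <= M * d * h.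
  rewrite normrZ.
  have -> : `|(- T.2, T.1)| = `|T| by rewrite !prod_normE /= normrN maxC.
  rewrite /be normrM normfV (ger0_norm (ltW n0)).
  rewrite mulrAC ler_pdivrMr//.
  have : `|cross T X| * `|T| <= (d * h) * (M * `|T| * `|T|).
    by rewrite ler_pM// ler_peMl.
  have : (d * h) * (M * `|T| ^+ 2) <= (d * h) * (M * n).
    by rewrite !ler_wpM2l// ?mulr_ge0 ?ltW.
  rewrite expr2; lra.
have ab : `|al| * `|T| <= 8 * M * h.
  rewrite /al normrM normfV (ger0_norm (ltW n0)).
  rewrite mulrAC ler_pdivrMr//.
  have : `|T.1 * X.1 + T.2 * X.2| <= 2 * (`|T| * `|X|).
    apply: le_trans (ler_normD _ _) _; rewrite !normrM.
    have := ler_pM (normr_ge0 _) (normr_ge0 _) (norm_fst T) (norm_fst X).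
    have := ler_pM (normr_ge0 _) (normr_ge0 _) (norm_snd T) (norm_snd X).
    lra.
  move=> h1.
  have : `|T.1 * X.1 + T.2 * X.2| * `|T| <= (2 * (`|T| * (4 * M * h))) * `|T|.
    by rewrite ler_wpM2r// (le_trans h1)// !ler_wpM2l.
  have : (8 * M * h) * `|T| ^+ 2 <= (8 * M * h) * n.
    by rewrite ler_wpM2l// !mulr_ge0// ltW.
  rewrite expr2; lra.
exists ((s - s0 + al) / S).
  rewrite normrM normfV (ger0_norm (ltW S0)) ler_pdivrMr// mul1r /S.
  rewrite ler_pdivlMr//.
  have : `|s - s0 + al| * `|T| <= (`|s - s0| + `|al|) * `|T|.
    by rewrite ler_wpM2r// ler_normD.
  have : `|s - s0| * `|T| <= h * M by rewrite ler_pM.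
  lra.
have -> : rotation z u - (u0 + ((s - s0 + al) / S) *: (S *: T)) =
    (rotation z u - u - velocity z u) + (velocity z u - velocity z u0)
    + (u - u0 - (s - s0) *: T) + be *: (- T.2, T.1).
  rewrite scalerA divfK ?gt_eqF//.
  have -> : be *: (- T.2, T.1) = X - al *: T by rewrite XE addrC addKr.
  have E (a b c e f q : R * R) (A B : R) : a - (e + (A + B) *: q) =
      a - f - b + (b - c) + (f - e - A *: q) + (c - B *: q).
    by apply: injective_projections; rewrite /= ?scaleRE; ring.
  exact: E.
have e1 := rotation_velocity z u.
have e2 := velocity_sub z u u0.
have uu : `|u - u0| <= 2 * M * h.
  have -> : u - u0 = (u - u0 - (s - s0) *: T) + (s - s0) *: T by rewrite subrK.
  apply: le_trans (ler_normD _ _) _; rewrite normrZ.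
  have : `|s - s0| * `|T| <= h * M by rewrite ler_pM.
  have : d * h <= M * h by rewrite ler_wpM2r ?(ltW h0)// (le_trans d1).
  lra.
have ub : `|u| <= 3 * M.
  rewrite -(subrK u0 u) (le_trans (ler_normD _ _))//.
  have : M * h <= M * 1 by rewrite ler_wpM2l ?(ltW M0)// (le_trans hd).
  lra.
have hh : h * h <= d * h by rewrite ler_wpM2r// ltW.
have e1' : `|rotation z u - u - velocity z u| <= 32 * M * (d * h).
  apply: le_trans e1 _.
  have zz : `|z| ^+ 2 <= 4 * (h * h).
    have -> : 4 * (h * h) = (2 * h) ^+ 2 by ring.
    by rewrite ler_sqr ?nnegrE ?mulr_ge0 ?(ltW h0).
  have : 2 * `|z| ^+ 2 * (`|u| + 1) <= 2 * (4 * (h * h)) * (4 * M).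
    by rewrite ler_pM ?mulr_ge0 ?addr_ge0 ?exprn_ge0 ?ler_wpM2l//; lra.
  have : M * (h * h) <= M * (d * h) by rewrite ler_wpM2l// ltW.
  lra.
have e2' : `|velocity z u - velocity z u0| <= 4 * M * (d * h).
  apply: le_trans e2 _.
  have : `|z| * `|u - u0| <= (2 * h) * (2 * M * h) by rewrite ler_pM.
  have : M * (h * h) <= M * (d * h) by rewrite ler_wpM2l// ltW.
  lra.
have dh : d * h <= M * (d * h) by rewrite ler_peMl// mulr_ge0// ltW.
apply: le_trans (ler_normD _ _) _.
apply: le_trans (lerD (le_trans (ler_normD _ _)
  (lerD (le_trans (ler_normD _ _) (lerD e1' e2')) gs)) bb) _.
have dh0 : 0 <= d * h by rewrite mulr_ge0// ltW.
rewrite /r; lra.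
Qed.

(** Cutting the parameter interval into [k] pieces of length [q] and the motion into [m] pieces
of comparable length reduces the estimate to [covers_patch], each patch being
carried along by a rigid motion. *)
Lemma covers_strip (g dg : R -> R * R) (M K s0 h d lam : R) x p :
  tame_arc g dg M s0 (s0 + h) -> (500 * M) ^+ 2 <= K -> 0 < h -> 0 < d <= 1 -> 0 < lam ->
  `|x| <= 2 * lam ->
  (forall s, s0 <= s <= s0 + h ->
    `|dot3 (normal_functional (g s) (dg s)) x| <= d * lam) ->
  rigid p ->
  covers [set u | exists s t : R, [/\ s0 <= s <= s0 + h, 0 <= t <= 1 &
      u = p (rotation (t *: x) (g s))]]
    (8 * K * (d * (h * lam))).
Proof.
move=> [M1 bd unif] MK h0 /andP[d0 d1] lam0 xl nx rp.
have K0 : 0 <= K by apply: le_trans MK; apply: sqr_ge0.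
have [r r0 hr] := unif d d0.
(* patches no larger than [d] and [r], so that [covers_patch] applies, nor than [lam] *)
pose e := Num.min d (Num.min lam r).
have e0 : 0 < e by rewrite !lt_min d0 lam0 r0.
have [k k0 hk] := exists_nat_ge (h / e).
have kR : 0 < k%:R :> R by rewrite ltr0n.
pose q := h / k%:R.
have q0 : 0 < q by rewrite divr_gt0.
have qe : q <= e by rewrite /q ler_pdivrMr// mulrC -ler_pdivrMr.
have := qe; rewrite !le_min => /and3P[qd ql qr].
have [m m0 /andP[m1 m2]] := exists_nat_ceil (divr_ge0 (ltW lam0) (ltW q0)).
have mR : 0 < m%:R :> R by rewrite ltr0n.
have lm : lam / m%:R <= q by rewrite ler_pdivrMr// mulrC -ler_pdivrMr.
pose F (i j : nat) := [set u | exists s t : R,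
   [/\ s0 + i%:R * q <= s <= s0 + (i%:R + 1) * q, 0 <= t <= 1 &
    u = p (rotation ((j%:R / m%:R) *: x) (rotation (t *: (m%:R^-1 *: x)) (g s)))]].
have FP i j : (i < k)%N -> covers (F i j) (4 * (K * (d * q ^+ 2))).
  move=> ik.
  have gi : s0 <= s0 + i%:R * q <= s0 + h.
    rewrite lerDl mulr_ge0 ?(ltW q0)//= lerD2l mulrCA ler_piMr ?(ltW h0)//.
    by rewrite ler_pdivrMr// mul1r ler_nat ltnW.
  have [b1 b2 b3] := bd _ gi.
  have := @covers_patch g (dg (s0 + i%:R * q)) M K d q (s0 + i%:R * q) (m%:R^-1 *: x) M1 MK.
  rewrite d0 d1 q0 qd => /(_ isT isT).
  have xm : `|m%:R^-1 *: x| <= 2 * q.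
    rewrite normrZ ger0_norm ?invr_ge0// mulrC.
    apply: le_trans (_ : 2 * lam / m%:R <= _).
      by rewrite ler_wpM2r ?invr_ge0.
    by rewrite -mulrA ler_wpM2l.
  move=> /(_ xm b1 b2 b3) h1.
  have rp' : rigid (p \o rotation ((j%:R / m%:R) *: x)).
    by apply: rigid_comp => //; apply: rigid_rotation.
  have {h1}h2 := covers_rigid rp' (h1 _).
  apply: covers_sub (h2 _) => //; last first.
    rewrite dot3Zr normrM ger0_norm ?invr_ge0// mulrC.
    apply: le_trans (_ : d * lam / m%:R <= _).
      by rewrite ler_wpM2r ?invr_ge0 ?nx.
    by rewrite -mulrA ler_wpM2l// ltW.
  move=> _ [s [t [/andP[s1 s2] t01 ->]]].
  exists (rotation (t *: (m%:R^-1 *: x)) (g s)) => //=.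
  have ss : `|s - (s0 + i%:R * q)| <= q.
    by rewrite ger0_norm ?subr_ge0// lerBlDr; move: s2; rewrite mulrDl mul1r; lra.
  have sJ : s0 <= s <= s0 + h.
    move: gi => /andP[g1 g2]; rewrite (le_trans g1)//= (le_trans s2)// lerD2l.
    by rewrite mulrCA ler_piMr ?(ltW h0)// ler_pdivrMr// mul1r natr1 ler_nat.
  exists s, t; split => //.
  have [|h3 _] := hr _ _ gi sJ; first exact: le_trans qr.
  by apply: le_trans h3 _; rewrite ler_wpM2l// ltW.
have FI i : (i < k)%N -> covers [set u | exists2 j, (j < m)%N & F i j u]
    (m%:R * (4 * (K * (d * q ^+ 2)))).
  by move=> ik; apply: covers_bigcup => j _; apply: FP.
apply: covers_sub (covers_bigcup FI); last first.
  have kq : k%:R * q = h by rewrite /q mulrC divfK// gt_eqF.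
  have mq : m%:R * q <= 2 * lam.
    have : m%:R * q <= (lam / q + 1) * q by rewrite ler_wpM2r// ltW.
    rewrite mulrDl divfK ?gt_eqF//; lra.
  have -> : k%:R * (m%:R * (4 * (K * (d * q ^+ 2)))) =
     (4 * K * d) * ((k%:R * q) * (m%:R * q)) by ring.
  rewrite kq; have -> : 8 * K * (d * (h * lam)) =
     (4 * K * d) * (h * (2 * lam)) by ring.
  apply: ler_wpM2l; last by apply: ler_wpM2l => //; exact: ltW.
  exact: mulr_ge0 (mulr_ge0 (ler0n _ _) K0) (ltW d0).
move=> _ [s [t [/andP[s1 s2] /andP[t0 t1] ->]]].
have [|i ik /andP[i1 i2]] := @unit_grid k ((s - s0) / h) k0.
  by rewrite divr_ge0 ?subr_ge0 ?(ltW h0)//= ler_pdivrMr// mul1r; lra.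
have [j jm /andP[j1 j2]] : exists2 j : nat, (j < m)%N & j%:R / m%:R <= t <= (j%:R + 1) / m%:R.
  by apply: unit_grid => //; rewrite t0.
exists i => //; exists j => //; exists s, (t * m%:R - j%:R); split.
- move: i1 i2; rewrite ler_pdivlMr// ler_pdivrMr// /q => i1 i2.
  by apply/andP; split; lra.
- move: j1 j2; rewrite ler_pdivrMr// ler_pdivlMr// => j1 j2.
  by apply/andP; split; lra.
- rewrite scalerA -rotation_add; congr (p (rotation (_ *: _) _)).
  by field; rewrite gt_eqF.
Qed.

End Covers.

Arguments rotation : simpl never.

Lemma covers_ge0 {R : realType} (W : set (R * R)) c : covers W c -> 0 <= c.
Proof.
by move=> [s [_ _ sc]]; apply: le_trans sc; apply: sumr_ge0 => b _; exact: sqr_ge0.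
Qed.

(** * The great circle of a projective line *)

Section Directions.
Context {R : realType}.
Implicit Types (x y z e : R * R * R).

Lemma norm_dot3 x y : `|dot3 x y| <= 3 * (`|x| * `|y|).
Proof.
have [a b] := (norm_fst x, norm_fst y).
have [a1 b1] := (le_trans (norm_fst x.1) a, le_trans (norm_fst y.1) b).
have [a2 b2] := (le_trans (norm_snd x.1) a, le_trans (norm_snd y.1) b).
have [a3 b3] := (norm_snd x, norm_snd y).
apply: le_trans (ler_normD _ _) _.
apply: le_trans (lerD (ler_normD _ _) (lexx _)) _; rewrite !normrM.
have := ler_pM (normr_ge0 _) (normr_ge0 _) a1 b1.
have := ler_pM (normr_ge0 _) (normr_ge0 _) a2 b2.
have := ler_pM (normr_ge0 _) (normr_ge0 _) a3 b3.
lra.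
Qed.

Lemma dot3Dr x y z : dot3 x (y + z) = dot3 x y + dot3 x z.
Proof. by rewrite /dot3 /=; ring. Qed.

Lemma dot3C x y : dot3 x y = dot3 y x.
Proof. by rewrite /dot3; ring. Qed.

Lemma norm_le_dot3 x : `|x| ^+ 2 <= dot3 x x.
Proof.
have sq (a : R) : `|a| ^+ 2 = a * a by rewrite real_normK ?num_real// expr2.
have [h1 h2 h3] : [/\ 0 <= x.1.1 * x.1.1, 0 <= x.1.2 * x.1.2 & 0 <= x.2 * x.2].
  by rewrite -!expr2 !sqr_ge0.
rewrite /dot3 prod_normE; case: (leP `|x.1| `|x.2|) => _; first by rewrite sq; lra.
by rewrite prod_normE; case: (leP `|x.1.1| `|x.1.2|) => _; rewrite sq; lra.
Qed.

Variables e1 e2 : R * R * R.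
(** For orthonormal [e1], [e2] these are the unit vectors of the plane that they span. *)
Definition dirv (a : R) : R * R * R := cos a *: e1 + sin a *: e2.

Hypotheses (e11 : dot3 e1 e1 = 1) (e22 : dot3 e2 e2 = 1) (e12 : dot3 e1 e2 = 0).

Lemma dot3_dirv (a b : R) : dot3 (dirv a) (dirv b) = cos (a - b).
Proof.
rewrite cosB /dirv !dot3Dr !dot3Zr ![dot3 (_ + _) _]dot3C !dot3Dr !dot3Zr.
by rewrite e11 e22 (dot3C e2 e1) e12; ring.
Qed.

Lemma norm_dirv (a : R) : `|dirv a| <= 1.
Proof.
rewrite -(@ler_pXn2r _ 2%N) ?nnegrE// expr1n.
by rewrite (le_trans (norm_le_dot3 _))// dot3_dirv subrr cos0.
Qed.

Lemma norm_scale_dirv (q a : R) : 0 <= q -> `|q *: dirv a| <= q.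
Proof. by move=> q0; rewrite normrZ ger0_norm// ler_piMr// norm_dirv. Qed.

Lemma norm_dirvB (a b : R) : `|dirv a - dirv b| <= 4 * `|a - b|.
Proof.
have n1 (e : R * R * R) : dot3 e e = 1 -> `|e| <= 1.
  by move=> ee; rewrite -(@ler_pXn2r _ 2%N) ?nnegrE// expr1n -ee norm_le_dot3.
have -> : dirv a - dirv b = (cos a - cos b) *: e1 + (sin a - sin b) *: e2.
  by apply: injective_projections; [apply: injective_projections|];
     rewrite /= ?scaleRE; ring.
have h : `|cis a - cis b| <= 2 * `|a - b|.
  have -> : cis a - cis b = cmul (cis b) (cis (a - b) - (1, 0)).
    have -> : cis a = cmul (cis b) (cis (a - b)) by rewrite -cisD subrKC.
    by apply: injective_projections; rewrite /=; ring.
  apply: le_trans (norm_cmul _ _) _; rewrite ler_wpM2l// -[leRHS]mul1r.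
  by rewrite ler_pM// ?norm_cis ?norm_cisB.
have h1 : `|cos a - cos b| <= 2 * `|a - b| := le_trans (norm_fst (cis a - cis b)) h.
have h2 : `|sin a - sin b| <= 2 * `|a - b| := le_trans (norm_snd (cis a - cis b)) h.
apply: le_trans (ler_normD _ _) _; rewrite !normrZ.
have := ler_pM (normr_ge0 _) (normr_ge0 _) h1 (n1 _ e11).
have := ler_pM (normr_ge0 _) (normr_ge0 _) h2 (n1 _ e22).
lra.
Qed.

(** Sine rule: a direction between [A] and [B] is a combination of [dirv A] and
[dirv B] with nonnegative coefficients when [B - A < pi]. *)
Lemma dirv_split (A B a : R) :
  sin (B - A) *: dirv a = sin (a - A) *: dirv B + sin (B - a) *: dirv A.
Proof.
have E1 : sin (B - A) * cos a = sin (a - A) * cos B + sin (B - a) * cos A.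
  by rewrite !sinB; ring.
have E2 : sin (B - A) * sin a = sin (a - A) * sin B + sin (B - a) * sin A.
  by rewrite !sinB; ring.
rewrite /dirv !scalerDr !scalerA E1 E2 !scalerDl.
by rewrite addrACA.
Qed.

End Directions.

(** During either of two consecutive short rotations a point of the ball of radius
[D] stays near its position at the start. *)
Lemma rotation_move2 {R : realType} (y1 y2 : R * R * R) (q D t : R) (u : R * R) :
  `|y1| <= q -> `|y2| <= q -> q <= 1 / 4 -> 0 <= t <= 1 -> `|u| <= D ->
  `|rotation (t *: y1) u - u| <= 12 * (D + 1) * q /\
  `|rotation y1 (rotation (t *: y2) u) - u| <= 12 * (D + 1) * q.
Proof.
move=> h1 h2 q4 /andP[t0 t1] uD.
have q0 : 0 <= q := le_trans (normr_ge0 _) h1.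
have D0 : 0 <= D := le_trans (normr_ge0 _) uD.
have mv (z : R * R * R) (v : R * R) (E : R) : `|z| <= q -> `|v| <= E ->
    `|rotation z v - v| <= 4 * q * (E + 1).
  move=> zq vE; apply: le_trans (rotation_move _ _) _.
  by apply: ler_pM; rewrite ?mulr_ge0 ?addr_ge0 ?ler_wpM2l ?lerD2r.
have sc (z : R * R * R) : `|z| <= q -> `|t *: z| <= q.
  by move=> zq; rewrite normrZ ger0_norm// (le_trans _ zq)// ler_piMl.
have Dq : q * D <= 1 / 4 * D by rewrite ler_wpM2r.
have m1 := mv _ _ _ (sc _ h1) uD.
have m2 := mv _ _ _ (sc _ h2) uD.
have Dq0 : 0 <= q * D by rewrite mulr_ge0.
split; first lra.
have h3 := ler_normD (rotation (t *: y2) u - u) u; rewrite subrK in h3.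
have h4 : `|rotation (t *: y2) u| <= 2 * D + 1 by lra.
have m3 := mv _ _ _ h1 h4.
rewrite -(subrKA (rotation (t *: y2) u)) (le_trans (ler_normD _ _))//.
lra.
Qed.

Lemma widen_right {R : realType} (a b q d : R) : 0 <= d -> a <= q <= b + d ->
  ~~ (a <= q <= b) -> `|b + d - q| <= d.
Proof.
move=> d0 /andP[aq qb]; rewrite aq /= -ltNge => bq.
by rewrite ger0_norm; lra.
Qed.

Lemma widen_left {R : realType} (a b q d : R) : 0 <= d -> a - d <= q <= b ->
  ~~ (a <= q <= b) -> `|a - d - q| <= d.
Proof.
move=> d0 /andP[aq qb]; rewrite qb andbT -ltNge => bq.
by rewrite ler0_norm; lra.
Qed.

(** * Zigzag refinement of a rotation *)

Section Refinement.
Context {R : realType}.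
Implicit Types (u v : R * R) (x y z : R * R * R) (p : R * R -> R * R).
Variables e1 e2 : R * R * R.
Hypotheses (e11 : dot3 e1 e1 = 1) (e22 : dot3 e2 e2 = 1) (e12 : dot3 e1 e2 = 0).
Local Notation dirv := (dirv e1 e2).

(** A step moves by [rotation svec]; [[slo, shi]] is its sector, [sdir] the end of
the sector that [svec] points to, and [slen] the approximate length of [svec]. *)
Record step := Step { svec : R * R * R ; slo : R ; shi : R ; sdir : R ; slen : R }.

Variables (del : R) (K : nat).
Hypotheses (del0 : 0 < del) (Kpi : (K%:R + 1) * del < pi).

(** Steps of level [k] have a sector of width [k * del].  Their vectors are only
approximately on the line because [rotation_log] is not exact; [kap] is the
relative error. *)
Definition sector_step (k : nat) (kap : R) (it : step) : bool :=
  [&& 0 < slen it, shi it == slo it + k%:R * del,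
      (sdir it == slo it) || (sdir it == shi it) &
      `|svec it - slen it *: dirv (sdir it)| <= kap * slen it].

Variable J : finType.
Variables (pts : J -> set (R * R)) (nu : J -> R * R * R) (cst : J -> R).
Variables (D c0 c1 : R).
Hypothesis (D0 : 0 <= D).
Hypothesis (ptsD : forall j u, pts j u -> `|u| <= D).
Hypothesis (cst0 : forall j, 0 <= cst j).
Hypothesis (nuc : forall j, c0 + 15 * `|nu j| * del <= c1).
Hypothesis strip : forall j x (lam : R) p, rigid p -> 0 < lam -> `|x| <= 2 * lam ->
  `|dot3 (nu j) x| <= c1 * lam ->
  covers [set v | exists u t, [/\ pts j u, 0 <= t <= 1 & v = p (rotation (t *: x) u)]]
    (cst j * lam).

(** The piece [j] of an arc, with normal functional [nu j], is aligned with a step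
if a rotation centred at some direction of the sector moves it almost along
itself. *)
Definition aligned (j : J) (it : step) : bool :=
  `[< exists2 b : R, slo it <= b <= shi it & `|dot3 (nu j) (dirv b)| <= c0 >].

(** What the piece [j] sweeps during the steps that it is aligned with, [p] being the
position before the first step. *)
Fixpoint aligned_sweep (j : J) p (s : seq step) : set (R * R) :=
  if s is it :: s' then
    [set v | aligned j it /\ exists u t,
       [/\ pts j u, 0 <= t <= 1 & v = p (rotation (t *: svec it) u)]]
    `|` aligned_sweep j (p \o rotation (svec it)) s'
  else set0.

(** Intrinsic rotations: later steps are composed on the right. *)
Fixpoint composite (s : seq step) : R * R -> R * R :=
  if s is it :: s' then rotation (svec it) \o composite s' else id.

Definition aligned_length (j : J) (s : seq step) : R := \sum_(it <- s | aligned j it) slen it.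

Definition thick (eta : R) (W : set (R * R)) : set (R * R) :=
  [set u | exists2 v, W v & `|u - v| <= eta].

Lemma composite_cat s t : composite (s ++ t) = composite s \o composite t.
Proof. by elim: s => //= it s ->. Qed.

Lemma aligned_sweep_cat j p s t :
  aligned_sweep j p (s ++ t) =
  aligned_sweep j p s `|` aligned_sweep j (p \o composite s) t.
Proof.
elim: s p => [|it s ih] p /=; first by rewrite set0U.
by rewrite ih setUA.
Qed.

Lemma aligned_length_cat j s t : aligned_length j (s ++ t) = aligned_length j s + aligned_length j t.
Proof. by rewrite /aligned_length big_cat. Qed.

Lemma covers_aligned_sweep j p s : rigid p ->
  (forall it, List.In it s -> aligned j it -> [/\ 0 < slen it, `|svec it| <= 2 * slen it &
     `|dot3 (nu j) (svec it)| <= c1 * slen it]) ->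
  covers (aligned_sweep j p s) (cst j * aligned_length j s).
Proof.
elim: s p => [|it s ih] p rp h /=.
  by rewrite /aligned_length big_nil mulr0; exact: covers0.
rewrite /aligned_length big_cons.
have rp' : rigid (p \o rotation (svec it)) by apply: rigid_comp => //; exact: rigid_rotation.
have := ih _ rp' (fun it' hi => h it' (or_intror hi)).
case: ifPn => [cit|ncit] hs.
  have [l0 x2 nx] := h it (or_introl erefl) cit.
  rewrite mulrDr; apply: coversU => //.
  by apply: covers_sub (strip rp l0 x2 nx) => // v [].
by apply: covers_sub hs => // v [[]|].
Qed.

(** In a repeated pattern, a point reached in copy [m] is reached by the pattern
itself after [m] full repetitions. *)
Lemma aligned_sweep_copies j p n s v : aligned_sweep j p (flatten (nseq n s)) v ->
  exists2 m, (m < n)%N & aligned_sweep j (p \o iter m (fun q => composite s \o q) id) s v.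
Proof.
elim: n p => [|n ih] p //=; rewrite aligned_sweep_cat => -[h|/ih[m mn hm]].
  by exists 0%N.
exists m.+1 => //; move: hm; congr (aligned_sweep j _ s v); rewrite -compA; congr (_ \o _).
Qed.

(** The factor by which a refinement lengthens a step: the coefficients of the sine
rule for a sector that is widened by [del] at both ends, seen from one of its
old ends. *)
Definition growth (k : nat) : R :=
  (sin del + sin (k%:R * del + del)) / sin (k%:R * del + del + del).

(** Up to a constant factor, the inverse of the total length at level [k]
([inv_lengthS]). *)
Definition inv_length (k : nat) : R := cos (k%:R * del / 2) * cos ((k%:R + 1) * del / 2).

(** Sum-to-product formulas turn the ratio of sines into a ratio of cosines of
half-angles, which telescopes. *)
Lemma growthE k : (k < K)%N ->
  growth k = cos (k%:R * del / 2) / cos (k%:R * del / 2 + del).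
Proof.
move=> kK; rewrite /growth; set f := k%:R * del / 2; set t := f + del.
have tpi : 0 < t < pi / 2.
  rewrite /t /f ltr_wpDl ?divr_ge0 ?mulr_ge0 ?(ltW del0)//=.
  have : (k%:R + 1 + 1) * del < pi.
    rewrite (le_lt_trans _ Kpi)// ler_wpM2r ?(ltW del0)//.
    by rewrite lerD2r natr1 ler_nat.
  lra.
have s0 : 0 < sin t by exact: sin_gt0_pihalf.
have c0' : 0 < cos t.
  apply: cos_gt0_pihalf; move: tpi => /andP[t0 ->]; rewrite andbT.
  by rewrite (lt_trans _ t0)// oppr_lt0 divr_gt0// pi_gt0.
have -> : k%:R * del + del + del = t + t by rewrite /t /f; field.
have -> : k%:R * del + del = t + f by rewrite /t /f; field.
have E : sin del = sin (t - f) by rewrite /t addrC addKr.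
rewrite E sinB (sinD t f) (sinD t t); field.
by rewrite !gt_eqF//= addr_gt0 ?mulr_gt0.
Qed.

Lemma cos_halfstep_gt0 k : (k <= K.+1)%N -> 0 < cos (k%:R * del / 2).
Proof.
move=> kK; apply: cos_gt0_pihalf.
have : 0 <= k%:R * del by rewrite mulr_ge0// ltW.
have : k%:R * del < pi.
  by rewrite (le_lt_trans _ Kpi)// ler_wpM2r ?(ltW del0)// natr1 ler_nat.
have := @pi_gt0 R; move: (k%:R * del) => q *; apply/andP; split; lra.
Qed.

Lemma inv_length_gt0 k : (k <= K)%N -> 0 < inv_length k.
Proof.
by move=> kK; rewrite /inv_length natr1 mulr_gt0// cos_halfstep_gt0// ltnW.
Qed.

Lemma inv_lengthS k : (k < K)%N -> inv_length k.+1 * growth k = inv_length k.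
Proof.
move=> kK; rewrite growthE// /inv_length -natr1.
have -> : (k%:R + 1 + 1) * del / 2 = k%:R * del / 2 + del by field.
have := @cos_halfstep_gt0 k.+2; rewrite ltnS => /(_ kK).
have -> : k.+2%:R * del / 2 = k%:R * del / 2 + del by rewrite -addn2 natrD; field.
move=> c; rewrite mulrC; field; rewrite gt_eqF//.
Qed.

Lemma growth_ge1 k : (k < K)%N -> 1 <= growth k.
Proof.
move=> kK; rewrite growthE//.
have := @cos_halfstep_gt0 k.+2; rewrite ltnS => /(_ kK).
have <- : k%:R * del / 2 + del = k.+2%:R * del / 2 by rewrite -addn2 natrD; field.
have h : k%:R * del + del + del < pi.
  rewrite (le_lt_trans _ Kpi)//.
  have -> : k%:R * del + del + del = (k.+1%:R + 1) * del by rewrite -natr1; ring.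
  by rewrite ler_wpM2r ?(ltW del0)// lerD2r ler_nat.
have k0 : 0 <= k%:R * del by rewrite mulr_ge0// ltW.
move=> c; rewrite ler_pdivlMr// mul1r leNgt ltr_cos ?in_itv/=; last 2 first.
- by apply/andP; split; move: (@pi_gt0 R) (del0); lra.
- by apply/andP; split; move: (@pi_gt0 R) (del0); lra.
by rewrite ltNge lerDl (ltW del0).
Qed.

Lemma inv_length_le k : (k <= K)%N -> inv_length K <= inv_length k.
Proof.
move=> kK; have [n nE] : exists n, K = (k + n)%N by exists (K - k)%N; rewrite subnKC.
elim: n k kK nE => [|n ih] k kK nE; first by rewrite nE addn0.
have kK1 : (k < K)%N by rewrite nE addnS ltnS leq_addr.
apply: (le_trans (ih k.+1 kK1 _)); first by rewrite nE addSnnS.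
rewrite -(inv_lengthS kK1) ler_peMr ?growth_ge1//.
by rewrite ltW// inv_length_gt0.
Qed.

Lemma iter_rotation (f : R * R -> R * R) (y : R * R * R) (m : nat) :
  f = rotation y -> iter m (fun q => f \o q) id = rotation (m%:R *: y).
Proof.
move=> ->; elim: m => [|m ih]; first by apply/funext => u; rewrite scale0r rotation0.
rewrite iterS ih; apply/funext => u /=.
by rewrite -{1}(scale1r y) -rotation_add [1 + _]addrC natr1.
Qed.

(** Instead of solving for two vectors exactly on the line, the first one is taken
exactly on it and the second is the logarithm of what remains of the n-th part of
the motion.  By [rotation_log] its error is [O(n^-2)], which is small relative to
its length [lam * cb / n]; this is how errors are kept proportional to [kap]. *)
Lemma split_rotation x (psi A B lam ca cb kap q : R) :
  0 < lam -> 0 < ca -> 0 < cb -> dirv psi = ca *: dirv B + cb *: dirv A ->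
  0 < kap <= 1 -> `|x - lam *: dirv psi| <= kap * cb / 2 * lam -> `|x| <= 2 * lam -> 0 < q ->
  exists (n : nat) y, let y1 := (lam * ca / n%:R) *: dirv B in
    [/\ (0 < n)%N, rotation y1 \o rotation y = rotation (n%:R^-1 *: x),
      `|y - (lam * cb / n%:R) *: dirv A| <= kap * (lam * cb / n%:R),
      `|y1| <= q & `|y| <= q].
Proof.
move=> lam0 ca0 cb0 psiE /andP[kap0 kap1] xE xl q0.
(* [C / n] bounds the sizes of all the vectors; [n] is taken large for each of [n1], [n2], [n3] *)
pose C := (2 + ca + 2 * cb) * lam.
have C0 : 0 < C by apply: mulr_gt0 => //; lra.
have kcl : 0 < kap * cb * lam by rewrite !mulr_gt0.
have [n n0 nC] := exists_nat_ge (4 * C + 600 * C ^+ 2 / (kap * cb * lam) + C / q).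
have nR : 0 < n%:R :> R by rewrite ltr0n.
have [P1 P2 P3] : [/\ 0 <= 4 * C, 0 <= 600 * C ^+ 2 / (kap * cb * lam) & 0 <= C / q].
  split.
  - by rewrite mulr_ge0// ltW.
  - exact: divr_ge0 (mulr_ge0 (ler0n _ _) (sqr_ge0 _)) (ltW kcl).
  - by rewrite divr_ge0 ?(ltW q0) ?(ltW C0).
have n1 : C / n%:R <= 1 / 4 by rewrite ler_pdivrMr//; lra.
have n2 : 300 * (C / n%:R) ^+ 2 <= kap * cb / 2 * lam / n%:R.
  have : 600 * C ^+ 2 / (kap * cb * lam) <= n%:R by lra.
  rewrite ler_pdivrMr// => h.
  rewrite expr_div_n mulrA expr2 invfM mulrA ler_pM2r ?invr_gt0// ler_pdivrMr//.
  lra.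
have n3 : C / n%:R <= q.
  have : C / q <= n%:R by lra.
  by rewrite ler_pdivrMr// => h; rewrite ler_pdivrMr// [leRHS]mulrC.
clear nC P1 P2 P3.
pose y1 := (lam * ca / n%:R) *: dirv B.
have xn : `|n%:R^-1 *: x| <= 2 * lam / n%:R.
  by rewrite normrZ ger0_norm ?invr_ge0// mulrC ler_pM2r ?invr_gt0.
have lca0 : 0 < lam * ca / n%:R := divr_gt0 (mulr_gt0 lam0 ca0) nR.
have lcb0 : 0 < lam * cb / n%:R := divr_gt0 (mulr_gt0 lam0 cb0) nR.
have y1n : `|y1| <= lam * ca / n%:R by rewrite norm_scale_dirv ?ltW.
have CE : C / n%:R = 2 * lam / n%:R + lam * ca / n%:R + 2 * (lam * cb / n%:R).
  by rewrite /C; field; rewrite gt_eqF.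
have ll : 0 < 2 * lam / n%:R by rewrite divr_gt0 ?mulr_gt0.
have [xC y1C] : `|n%:R^-1 *: x| + `|y1| <= C / n%:R /\ `|y1| <= C / n%:R.
  by move: y1n xn CE lcb0 ll; lra.
have x4 : `|n%:R^-1 *: x| <= 1 / 4.
  by apply: le_trans n1; apply: le_trans xC; rewrite lerDl.
have [y yE yn] := rotation_log x4 (le_trans y1C n1).
have yA : `|y - (lam * cb / n%:R) *: dirv A| <= kap * (lam * cb / n%:R).
  have psin : n%:R^-1 *: (lam *: dirv psi) = y1 + (lam * cb / n%:R) *: dirv A.
    rewrite psiE /y1 (scalerDr lam) (scalerDr n%:R^-1) !scalerA.
    by congr (_ *: _ + _ *: _); field; rewrite gt_eqF.
  have E (a b c d : R * R * R) : a - d = a - (b - c) + (b - (c + d)).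
    by apply: injective_projections; [apply: injective_projections|]; rewrite /=; ring.
  rewrite (E y (n%:R^-1 *: x) y1) -psin -scalerBr.
  apply: le_trans (ler_normD _ _) _.
  have h1 : `|n%:R^-1 *: (x - lam *: dirv psi)| <= kap * cb / 2 * lam / n%:R.
    by rewrite normrZ ger0_norm ?invr_ge0// mulrC ler_pM2r ?invr_gt0.
  have h2 : 300 * (`|n%:R^-1 *: x| + `|y1|) ^+ 2 <= 300 * (C / n%:R) ^+ 2.
    apply: ler_wpM2l; first exact: ler0n.
    by rewrite ler_sqr ?nnegrE ?addr_ge0 ?divr_ge0 ?(ltW C0).
  have -> : kap * (lam * cb / n%:R) = kap * cb / 2 * lam / n%:R + kap * cb / 2 * lam / n%:R.
    by field; rewrite gt_eqF.
  by rewrite lerD// (le_trans yn)// (le_trans h2).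
exists n, y; split => //; first by apply/funext => u /=; rewrite yE.
  exact: le_trans y1C n3.
apply: le_trans n3.
rewrite -(subrK ((lam * cb / n%:R) *: dirv A) y) (le_trans (ler_normD _ _))//.
have h1 : `|(lam * cb / n%:R) *: dirv A| <= lam * cb / n%:R by rewrite norm_scale_dirv ?ltW.
have h2 : kap * (lam * cb / n%:R) <= 1 * (lam * cb / n%:R) by rewrite ler_wpM2r ?(ltW lcb0).
by move: h1 h2 yA CE lca0 ll; lra.
Qed.

(** A step whose direction is within [del] of an almost-zero of [nu j] has a small
normal component, because [dirv] is Lipschitz. *)
Lemma near_aligned_step k kap j it (q : R) : kap <= 1 -> kap <= del -> sector_step k kap it ->
  `|sdir it - q| <= del -> `|dot3 (nu j) (dirv q)| <= c0 ->
  [/\ 0 < slen it, `|svec it| <= 2 * slen it & `|dot3 (nu j) (svec it)| <= c1 * slen it].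
Proof.
move=> k1 kdel /and4P[l0 _ _ vE] q1 q2; have l0' := ltW l0.
split => //.
  rewrite -(subrK (slen it *: dirv (sdir it)) (svec it)) (le_trans (ler_normD _ _))//.
  have : `|slen it *: dirv (sdir it)| <= slen it by rewrite norm_scale_dirv.
  have : kap * slen it <= 1 * slen it by rewrite ler_wpM2r.
  by move: vE; lra.
have -> : svec it = (svec it - slen it *: dirv (sdir it)) +
   slen it *: ((dirv (sdir it) - dirv q) + dirv q) by rewrite !subrK.
rewrite (dot3Dr _ (svec it - slen it *: dirv (sdir it))) dot3Zr
  (dot3Dr _ (dirv (sdir it) - dirv q)).
have h1 : `|dot3 (nu j) (svec it - slen it *: dirv (sdir it))| <= 3 * `|nu j| * (del * slen it).
  rewrite (le_trans (norm_dot3 _ _))// -mulrA ler_wpM2l// ler_wpM2l//.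
  by rewrite (le_trans vE)// ler_wpM2r.
have h2 : `|dot3 (nu j) (dirv (sdir it) - dirv q)| <= 3 * `|nu j| * (4 * del).
  rewrite (le_trans (norm_dot3 _ _))// -mulrA ler_wpM2l// ler_wpM2l//.
  by rewrite (le_trans (norm_dirvB _ _ _ _))// ler_wpM2l.
have h3 := ler_wpM2r l0' (nuc j).
have h4 := ler_wpM2l l0' (le_trans (ler_normD _ _) (lerD h2 q2)).
apply: le_trans (ler_normD _ _) _; rewrite [in X in _ + X]normrM (gtr0_norm l0).
by move: h1 h3 h4; lra.
Qed.

Lemma composite_copies x (n : nat) s : composite s = rotation x ->
  composite (flatten (nseq n s)) = rotation (n%:R *: x).
Proof.
move=> sx; elim: n => [|n ih]; first by apply/funext => u; rewrite scale0r rotation0.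
rewrite /= composite_cat ih sx; apply/funext => u.
by rewrite /comp -{1}(scale1r x) -rotation_add addrC natr1.
Qed.

Lemma in_copies (n : nat) (s : seq step) it :
  List.In it (flatten (nseq n s)) -> List.In it s.
Proof. by elim: n => //= n ih h; case: (@List.in_app_or step _ _ _ h). Qed.

Lemma big_copies (n : nat) (s : seq step) (P : pred step) :
  \sum_(i <- flatten (nseq n s) | P i) slen i = n%:R * \sum_(i <- s | P i) slen i.
Proof.
elim: n => [|n ih]; first by rewrite big_nil mul0r.
by rewrite /= big_cat /= ih -natr1 mulrDl mul1r addrC.
Qed.

Lemma sector_step_children (a b lam : R) k kap y1 y2 (la lb : R) (A := a - del) (B := b + del)
  (k1 := Step y1 a B B la) (k2 := Step y2 A b A lb) : b = a + k%:R * del ->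
  0 < la -> 0 < lb -> `|y1 - la *: dirv B| <= kap * la -> `|y2 - lb *: dirv A| <= kap * lb ->
  sector_step k.+1 kap k1 && sector_step k.+1 kap k2.
Proof.
move=> bE la0 lb0 y1E y2E; apply/andP; split; apply/and4P; split; rewrite /= ?eqxx ?orbT//.
  by rewrite /B bE -natr1 mulrDl mul1r addrA.
by rewrite -natr1 mulrDl mul1r /A addrACA addNr addr0 -bE.
Qed.

(** The replacement of one step by a zigzag, with the cost bookkeeping for each piece
[j]: what it sweeps is close to what it swept before, up to a set [N] of cost [c],
and [c] is paid for by the part of the new aligned length that exceeds the old one
multiplied by [growth k]. *)
Lemma refine_step k (kap' : R) : (k < K)%N -> 0 < kap' <= 1 -> kap' <= del ->
  exists2 kap : R, 0 < kap <= 1 & forall it (eta : R), sector_step k kap it -> 0 < eta ->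
   exists s, [/\ all (sector_step k.+1 kap') s, composite s = rotation (svec it),
     \sum_(i <- s) slen i = growth k * slen it &
     forall j p, rigid p -> exists N c, [/\ covers N c,
       aligned_sweep j p s `<=` thick eta (aligned_sweep j p [:: it]) `|` N &
       c + cst j * growth k * aligned_length j [:: it] <= cst j * aligned_length j s]].
Proof.
move=> kK kap01 kapdel; have /andP[kap0 kap1] := kap01.
set w := k%:R * del.
have w0 : 0 <= w by rewrite mulr_ge0// ltW.
have wpi : w + del + del < pi.
  rewrite (le_lt_trans _ Kpi)//.
  have -> : w + del + del = (k.+1%:R + 1) * del by rewrite -natr1 /w; ring.
  by rewrite ler_wpM2r ?(ltW del0)// lerD2r ler_nat.
have sd : 0 < sin del by apply: sin_gt0_pi; move: del0 w0 wpi; lra.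
have swd : 0 < sin (w + del) by apply: sin_gt0_pi; move: del0 w0 wpi; lra.
have sW : 0 < sin (w + del + del) by apply: sin_gt0_pi; move: del0 w0 wpi; lra.
(* a lower bound for both coefficients that does not depend on the step *)
pose m0 := sin del * sin (w + del).
have m00 : 0 < m0 by rewrite mulr_gt0.
have m01 : m0 <= 1 by rewrite mulr_ile1 ?sin_le1 ?(ltW sd) ?(ltW swd).
have km1 : kap' * m0 <= 1 * 1 := ler_pM (ltW kap0) (ltW m00) kap1 m01.
exists (kap' * m0 / 2).
  by rewrite !mulr_gt0//=; move: km1; lra.
move=> [x a b psi lam] eta /and4P[/= lam0 /eqP bE psiE xE] eta0.
rewrite -/w in bE.
pose A := a - del; pose B := b + del.
have BA : B - A = w + del + del by rewrite /A /B bE; ring.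
have [ca [cb [cam cbm cab psiE']]] : exists ca cb : R, [/\ m0 <= ca, m0 <= cb,
    ca + cb = growth k & dirv psi = ca *: dirv B + cb *: dirv A].
  exists (sin (psi - A) / sin (w + del + del)), (sin (B - psi) / sin (w + del + del)).
  have h (q : R) : 0 <= q -> m0 <= q -> m0 <= q / sin (w + del + del).
    by move=> q0 mq; rewrite ler_pdivlMr// (le_trans _ mq)// ler_piMr ?(ltW m00)// sin_le1.
  have h1 : m0 <= sin del / sin (w + del + del).
    by rewrite h ?(ltW sd)// /m0 ler_piMr ?(ltW sd) ?sin_le1.
  have h2 : m0 <= sin (w + del) / sin (w + del + del).
    by rewrite h ?(ltW swd)// /m0 ler_piMl ?(ltW swd) ?sin_le1.
  split.
  - case/orP: psiE => /eqP ->; first by have -> : a - A = del by rewrite /A; ring.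
    by have -> : b - A = w + del by rewrite /A bE; ring.
  - case/orP: psiE => /eqP ->; last by have -> : B - b = del by rewrite /B; ring.
    by have -> : B - a = w + del by rewrite /B bE; ring.
  - rewrite /growth -mulrDl -/w; congr (_ / _).
    case/orP: psiE => /eqP ->.
      by congr (sin _ + sin _); rewrite /A /B ?bE; ring.
    by rewrite addrC; congr (sin _ + sin _); rewrite /A /B ?bE; ring.
  - have := dirv_split e1 e2 A B psi; rewrite BA.
    move=> /(congr1 (fun z => (sin (w + del + del))^-1 *: z)).
    rewrite scalerA mulVf ?gt_eqF// scale1r => ->; rewrite scalerDr !scalerA.
    by rewrite ![_ / sin _]mulrC.
clearbody m0.
have ca0 : 0 < ca by exact: lt_le_trans cam.
have cb0 : 0 < cb by exact: lt_le_trans cbm.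
have D1 : 0 < D + 1 by rewrite ltr_wpDl.
(* [Q] bounds the two moves of the pattern, so that points move by less than [eta] *)
pose Q := Num.min (1 / 4) (eta / (24 * (D + 1))).
have q0 : 0 < Q.
  by rewrite lt_min !divr_gt0 ?ltr0n//= mulr_gt0 ?ltr0n.
have xl : `|x| <= 2 * lam.
  rewrite -[x](subrK (lam *: dirv psi)) (le_trans (ler_normD _ _))//.
  have h1 : `|lam *: dirv psi| <= lam by rewrite norm_scale_dirv ?ltW.
  have h2 : kap' * m0 / 2 * lam <= 1 * lam by rewrite ler_wpM2r ?(ltW lam0)//; move: km1; lra.
  by rewrite mulr_natl mulr2n lerD// (le_trans xE)// (le_trans h2)// mul1r.
have xE' : `|x - lam *: dirv psi| <= kap' * cb / 2 * lam.
  rewrite (le_trans xE)// ler_wpM2r ?(ltW lam0)// ler_wpM2r ?invr_ge0//.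
  by rewrite ler_wpM2l ?(ltW kap0).
have [n [y2 /= [n0 kidsE y2A y1Q y2Q]]] := split_rotation lam0 ca0 cb0 psiE' kap01 xE' xl q0.
set y1 := (lam * ca / n%:R) *: dirv B in kidsE y1Q *.
have nR : 0 < n%:R :> R by rewrite ltr0n.
have lca0 : 0 < lam * ca / n%:R := divr_gt0 (mulr_gt0 lam0 ca0) nR.
have lcb0 : 0 < lam * cb / n%:R := divr_gt0 (mulr_gt0 lam0 cb0) nR.
pose k1 := Step y1 a B B (lam * ca / n%:R).
pose k2 := Step y2 A b A (lam * cb / n%:R).
have /andP[k1v k2v] : sector_step k.+1 kap' k1 && sector_step k.+1 kap' k2.
  by apply: sector_step_children => //; rewrite subrr normr0 mulr_ge0 ?(ltW kap0) ?(ltW lca0).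
have endk : composite [:: k1; k2] = rotation (n%:R^-1 *: x) by rewrite -kidsE.
exists (flatten (nseq n [:: k1; k2])); split.
- by elim: (n) => //= m ->; rewrite k1v k2v.
- by rewrite (composite_copies _ endk) scalerA divff ?gt_eqF// scale1r.
- by rewrite big_copies !big_cons big_nil -cab /=; field; rewrite gt_eqF.
move=> j p rp.
have [cj|ncj] := boolP (aligned j (Step x a b psi lam)); last first.
  exists (aligned_sweep j p (flatten (nseq n [:: k1; k2]))),
    (cst j * aligned_length j (flatten (nseq n [:: k1; k2]))); split.
  - apply: covers_aligned_sweep => // it /in_copies itE cit.
    have [itv [q q1 q2]] : sector_step k.+1 kap' it /\
        exists2 q, `|sdir it - q| <= del & `|dot3 (nu j) (dirv q)| <= c0.
      have nq q : `|dot3 (nu j) (dirv q)| <= c0 -> ~~ (a <= q <= b).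
        by move=> qc; apply: contra ncj => qab; apply/asboolP; exists q.
      case: itE cit => [<-|[<-|//]] /asboolP[q /= aqb qc]; split => //; exists q => //=.
        exact: widen_right (ltW del0) aqb (nq _ qc).
      exact: widen_left (ltW del0) aqb (nq _ qc).
    exact: near_aligned_step kap1 kapdel itv q1 q2.
  - by move=> v; right.
  - by rewrite {2}/aligned_length big_cons (negbTE ncj) big_nil mulr0 addr0.
move/asboolP: (cj) => [/= q /andP[aq qb] qc].
have c1' : aligned j k1.
  by apply/asboolP; exists q => //=; rewrite aq (le_trans qb)// lerDl ltW.
have c2' : aligned j k2.
  by apply/asboolP; exists q => //=; rewrite qb andbT (le_trans _ aq)// lerBlDr lerDl ltW.
exists set0, 0; split; first exact: covers0; last first.
  rewrite /aligned_length big_copies !big_cons cj c1' c2' big_nil add0r /= -cab !addr0 -mulrA.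
  rewrite ler_wpM2l// le_eqVlt; apply/orP; left; apply/eqP; field; rewrite gt_eqF//.
move=> v /aligned_sweep_copies[m mn hv]; left.
rewrite (iter_rotation _ endk) in hv.
have m01' : 0 <= (m%:R / n%:R : R) <= 1.
  by rewrite divr_ge0//= ler_pdivrMr// mul1r ler_nat ltnW.
have Q4 : Q <= 1 / 4 by rewrite ge_min lexx.
have [u [w' [ju vE wu]]] : exists u w', [/\ pts j u,
    v = p (rotation (m%:R *: (n%:R^-1 *: x)) w') & `|w' - u| <= 12 * (D + 1) * Q].
  case: hv => [[_ [u [t [ju t01 vE]]]]|[[_ [u [t [ju t01 vE]]]]|//]].
    exists u, (rotation (t *: y1) u); split => //.
    exact: (rotation_move2 y1Q y2Q Q4 t01 (ptsD ju)).1.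
  exists u, (rotation y1 (rotation (t *: y2) u)); split => //.
  exact: (rotation_move2 y1Q y2Q Q4 t01 (ptsD ju)).2.
exists (p (rotation ((m%:R / n%:R) *: x) u)).
  by left; split => //; exists u, (m%:R / n%:R).
rewrite vE scalerA.
have rr : rigid (p \o rotation ((m%:R / n%:R) *: x)).
  by apply: rigid_comp => //; exact: rigid_rotation.
apply: le_trans (rigid_lip w' u rr) _.
apply: le_trans (ler_wpM2l (ler0n R 2) wu) _.
have -> : 2 * (12 * (D + 1) * Q) = Q * (24 * (D + 1)) by ring.
rewrite -ler_pdivlMr; last by rewrite mulr_gt0 ?ltr0n.
by rewrite ge_min lexx orbT.
Qed.

Lemma thick_sub (eta : R) (V W : set (R * R)) : V `<=` W -> thick eta V `<=` thick eta W.
Proof. by move=> VW u [v /VW Wv uv]; exists v. Qed.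

Lemma refine_seq k (kap' : R) : (k < K)%N -> 0 < kap' <= 1 -> kap' <= del ->
  exists2 kap : R, 0 < kap <= 1 & forall (t : seq step) (eta : R), all (sector_step k kap) t -> 0 < eta ->
   exists s, [/\ all (sector_step k.+1 kap') s, composite s = composite t,
     \sum_(i <- s) slen i = growth k * \sum_(i <- t) slen i &
     forall j p, rigid p -> exists N c, [/\ covers N c,
       aligned_sweep j p s `<=` thick eta (aligned_sweep j p t) `|` N &
       c + cst j * growth k * aligned_length j t <= cst j * aligned_length j s]].
Proof.
move=> kK k01 kdel; have [kap kap0 h] := refine_step kK k01 kdel.
exists kap => // t eta + eta0; elim: t => [_|it t ih /= /andP[vit /ih[s [s1 s2 s3 s4]]]].
  exists [::]; split => //; first by rewrite !big_nil mulr0.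
  move=> j p rp; exists set0, 0; split; first exact: covers0.
    by move=> v [].
  by rewrite /aligned_length !big_nil !mulr0 addr0.
have [s' [s'1 s'2 s'3 s'4]] := h _ _ vit eta0.
exists (s' ++ s); split.
- by rewrite all_cat s'1.
- by rewrite composite_cat s'2 s2.
- by rewrite big_cat /= s'3 s3 big_cons mulrDr.
move=> j p rp; have [N' [c' [cN' hN' hc']]] := s'4 j p rp.
have rp' : rigid (p \o rotation (svec it)) by apply: rigid_comp => //; exact: rigid_rotation.
have [N [c [cN hN hc]]] := s4 j _ rp'.
exists (N' `|` N), (c' + c); split; first exact: coversU.
- rewrite aligned_sweep_cat s'2 => v [/hN'[hv|hv]|/hN[hv|hv]].
  + by left; apply: thick_sub hv => v' [hv|//]; left.
  + by right; left.
  + by left; apply: thick_sub hv => v' hv; right.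
  + by right; right.
- have -> : aligned_length j (it :: t) = aligned_length j [:: it] + aligned_length j t
    by rewrite -aligned_length_cat.
  rewrite aligned_length_cat; lra.
Qed.

Variables (y : R * R * R) (lam0 zeta : R).
Hypotheses (lam00 : 0 < lam0) (yE : y = lam0 *: dirv 0) (zeta0 : 0 < zeta).

(** The invariant: multiplied by [inv_length K], the cost is at most [cst j] times
[inv_length k] times the aligned length, plus [zeta].  The accuracy [kap] at level
[k] has to be chosen after the one at level [k + 1], so the induction provides all
accuracies at once; the slack in the strict inequality pays for the thickening. *)
Lemma refine_level k : (k <= K)%N -> forall kap : R, 0 < kap <= 1 -> kap <= del ->
  exists s, [/\ all (sector_step k kap) s, composite s = rotation y,
    inv_length k * \sum_(i <- s) slen i = inv_length 0 * lam0 &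
    forall j, exists2 c, covers (aligned_sweep j id s) c &
      inv_length K * c < cst j * inv_length k * aligned_length j s + zeta].
Proof.
elim: k => [_|k ih kK] kap kap0 kapdel.
  exists [:: Step y 0 0 0 lam0]; split.
  - rewrite /= andbT; apply/and4P; split => //=; first by rewrite mul0r addr0.
      by rewrite eqxx.
    rewrite yE subrr normr0 mulr_ge0//; last exact: ltW.
    by case/andP: kap0 => /ltW.
  - by [].
  - by rewrite big_cons big_nil addr0.
  move=> j; set s := [:: _]; exists (cst j * aligned_length j s).
    apply: covers_aligned_sweep; first exact: rigid_id.
    move=> it [<-|//] /asboolP[/= q q0]; have -> : q = 0 by apply/le_anti; rewrite andbC.
    move=> qc; split => //.
      by rewrite yE (le_trans (norm_scale_dirv e11 e22 e12 _ (ltW lam00)))// ler_peMl ?(ltW lam00)// ler1n.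
    rewrite yE dot3Zr normrM gtr0_norm// [leRHS]mulrC ler_wpM2l ?(ltW lam00)//.
    rewrite (le_trans qc)// (le_trans _ (nuc j))// lerDl mulr_ge0 ?(ltW del0)//.
  have S0 : 0 <= aligned_length j s.
    by rewrite /aligned_length big_cons big_nil; case: ifP => _ //=; rewrite addr0 ltW.
  have := inv_length_le (leq0n K) => h.
  apply: le_lt_trans (_ : cst j * inv_length 0 * aligned_length j s < _); last by rewrite ltrDl.
  by rewrite mulrCA -mulrA ler_wpM2l// ler_wpM2r.
have [kap' k'0 h] := refine_seq kK kap0 kapdel.
have m0 : 0 < Num.min kap' del <= 1.
  by case/andP: k'0 => a b; rewrite lt_min a del0 /= ge_min b.
have [|t [t1 t2 t3 t4]] := ih (ltnW kK) _ m0; first by rewrite ge_min lexx orbT.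
have {}t1 : all (sector_step k kap') t.
  apply: sub_all t1 => it /and4P[a b c d]; apply/and4P; split => //.
  by apply: le_trans d _; rewrite ler_wpM2r ?(ltW a)// ge_min lexx.
have ex j : exists eta, 0 < eta /\ exists2 c, covers (thick eta (aligned_sweep j id t)) c &
    inv_length K * c < cst j * inv_length k * aligned_length j t + zeta.
  have [c hc cc] := t4 j.
  have fK := inv_length_gt0 (leqnn K).
  have [d cd dd] : exists2 d, c < d & inv_length K * d < cst j * inv_length k * aligned_length j t + zeta.
    set T := (_ + zeta) in cc *; exists ((c + T / inv_length K) / 2).
      move: cc; rewrite mulrC -ltr_pdivlMr//; lra.
    move: cc; rewrite mulrC -ltr_pdivlMr// => cc; rewrite mulrC -ltr_pdivlMr//; lra.
  by have [eta e0 he] := covers_thick hc cd; exists eta; split => //; exists d.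
have [etaf hf] := choice ex.
(* one thickness that is small enough for all the pieces *)
pose eta := \big[Num.min/1]_j etaf j.
have eta0 : 0 < eta.
  by rewrite /eta; elim/big_ind: _ => // [a b a0 b0|j _]; rewrite ?lt_min ?a0//; have [] := hf j.
have [s [s1 s2 s3 s4]] := h t eta t1 eta0.
exists s; split => //; first by rewrite s2.
  by rewrite s3 mulrA inv_lengthS.
move=> j; have [N [c [cN hN hc]]] := s4 j id rigid_id.
have [_ [d hd dd]] := hf j.
exists (d + c).
  apply: covers_sub (coversU hd cN) => // v /hN[[v' sv vv]|]; [left|by right].
  by exists v' => //; rewrite (le_trans vv)// bigmin_le_cond.
have f1 := inv_length_gt0 kK.
have fK := inv_length_le kK.
have c0' : 0 <= c := covers_ge0 cN.
have h1 := ler_wpM2r c0' fK.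
have h2 := ler_wpM2l (ltW f1) hc.
have h3 : inv_length k.+1 * (c + cst j * growth k * aligned_length j t) =
    inv_length k.+1 * c + cst j * inv_length k * aligned_length j t.
  by rewrite -(inv_lengthS kK); ring.
rewrite h3 in h2; rewrite mulrDr.
have -> : cst j * inv_length k.+1 * aligned_length j s =
    inv_length k.+1 * (cst j * aligned_length j s) by ring.
move: dd h1 h2; lra.
Qed.

(** The aligned length never exceeds the total length, which is known exactly. *)
Theorem zigzag (kap : R) : 0 < kap <= 1 -> kap <= del ->
  exists s, [/\ all (sector_step K kap) s, composite s = rotation y,
    \sum_(i <- s) slen i = inv_length 0 / inv_length K * lam0 &
    forall j, covers (aligned_sweep j id s)
      (cst j * (inv_length 0 / inv_length K * lam0) + zeta / inv_length K)].
Proof.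
move=> kap0 kapdel; have [s [s1 s2 s3 s4]] := refine_level (leqnn K) kap0 kapdel.
have fK := inv_length_gt0 (leqnn K).
have lE : \sum_(i <- s) slen i = inv_length 0 / inv_length K * lam0.
  by rewrite mulrAC -s3; field; rewrite gt_eqF.
exists s; split => // j; have [c hc cc] := s4 j.
apply: covers_sub hc => //; rewrite -lE.
have clE : aligned_length j s <= \sum_(i <- s) slen i.
  rewrite /aligned_length big_mkcond /=; elim: s s1 {s2 s3 s4 lE cc} => [|it s ih].
    by rewrite !big_nil.
  rewrite !big_cons => /= /andP[/and4P[l0 _ _ _] /ih hs].
  by rewrite lerD//; case: ifP => // _; exact: ltW.
have := ler_wpM2l (cst0 j) clE.
have : c < cst j * aligned_length j s + zeta / inv_length K.
  rewrite -(ltr_pM2l fK) mulrDr (mulrC _ (zeta / _)) divfK ?gt_eqF//.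
  by apply: lt_le_trans cc _; rewrite lerD2r mulrAC mulrC.
lra.
Qed.

End Refinement.

(** * Planar outer measure of a cover *)

Section Area.
Context {R : realType}.
Implicit Types (u v : R * R) (x y z : R * R * R) (p : R * R -> R * R).
Implicit Types (A B W U : set (R * R)).
Local Open Scope ereal_scope.

Lemma le_lebesgue2 A B : A `<=` B -> lebesgue2 A <= lebesgue2 B.
Proof. exact: le_mu_ext. Qed.

Lemma lebesgue2_bigcup (F : nat -> set (R * R)) :
  lebesgue2 (\bigcup_k F k) <= \sum_(0 <= k <oo) lebesgue2 (F k).
Proof. by apply: mu_ext_sigma_subadditive. Qed.

Lemma lebesgue2_setU A B : lebesgue2 (A `|` B) <= lebesgue2 A + lebesgue2 B.
Proof. exact: outer_measureU2. Qed.

Lemma lebesgue2_set0 : lebesgue2 (set0 : set (R * R)) = 0.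
Proof. exact: mu_ext0. Qed.

Lemma lebesgue2_square u (r : R) : (0 <= r)%R ->
  lebesgue2 [set v | (`|v - u| <= r)%R] <= ((2 * r) ^+ 2)%:E.
Proof.
move=> r0.
pose I (c : R) : set R := `[(c - r)%R, (c + r)%R]%classic.
have I_lebesgue c : (@lebesgue_measure R) (I c) = (2 * r)%:E.
  rewrite /I lebesgue_measure_itv /= lte_fin.
  case: ifPn => [_|]; first by rewrite -EFinB; congr (_%:E); ring.
  rewrite -leNgt => h; have -> : r = 0%R by lra.
  by rewrite mulr0.
have mI c : measurable (I c) by exact: measurable_itv.
apply: (@le_trans _ _ (lebesgue2 (I u.1 `*` I u.2))).
  apply: le_lebesgue2 => v /=; rewrite pair_norm_le /I /= !in_itv/=.
  by rewrite !ler_norml => /andP[/andP[a b] /andP[c d]]; split; apply/andP; split; lra.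
rewrite /lebesgue2 measurable_mu_extE; last by apply: measurableX; exact: mI.
apply: (@le_trans _ _ (lebesgue_measure (I u.1) * lebesgue_measure (I u.2))).
  rewrite le_eqVlt; apply/orP; left; apply/eqP.
  by apply: product_measure1E; exact: mI.
by rewrite !I_lebesgue -EFinM expr2.
Qed.

Lemma lebesgue2_covers W (c : R) : covers W c -> lebesgue2 W <= c%:E.
Proof.
move=> [s [s0 sW sc]]; apply: (@le_trans _ _ (\sum_(b <- s) (2 * b.2) ^+ 2)%R%:E); last by rewrite lee_fin.
elim: s W s0 sW {sc} => [|b s ih] W s0 sW.
  rewrite big_nil (_ : W = set0) ?lebesgue2_set0//.
  by apply/seteqP; split => // u /sW[].
rewrite big_cons EFinD.
apply: (@le_trans _ _ (lebesgue2 ([set v | (`|v - b.1| <= b.2)%R] `|`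
    [set v | exists2 b, b \in s & (`|v - b.1| <= b.2)%R]))).
  apply: le_lebesgue2 => u /sW[a]; rewrite inE => /orP[/eqP ->|as_] ua; [by left|right].
  by exists a.
apply: (le_trans (lebesgue2_setU _ _)); apply: leeD.
  by apply: lebesgue2_square; apply: s0; rewrite inE eqxx.
by apply: ih => // a as_; apply: s0; rewrite inE as_ orbT.
Qed.

End Area.

(** * Area swept by a set of small length *)

Section Sweep.
Context {R : realType}.
Implicit Types (u v : R * R) (x y z : R * R * R) (p : R * R -> R * R).
Implicit Types (A B W U : set (R * R)).

(** What [U] sweeps during all the steps, [p] being the position before the first
one. *)
Fixpoint sweep p (s : seq (@step R)) U : set (R * R) :=
  if s is it :: s' then
    [set v | exists u t, [/\ U u, 0 <= t <= 1 & v = p (rotation (t *: svec it) u)]]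
    `|` sweep (p \o rotation (svec it)) s' U
  else set0.

(** A set of diameter [r] is carried along a motion of length [lam] through about
[lam / r] positions, each contained in a square of side [O(r)]. *)
Lemma covers_sweep1 (D r lam K : R) x p U u0 : rigid p ->
  0 < r <= lam -> `|x| <= 2 * lam -> (2 * (36 * (r * (D + 1)))) ^+ 2 * 2 <= K * r ^+ 2 ->
  (forall u, U u -> `|u| <= D /\ `|u - u0| <= r) ->
  covers [set v | exists u t, [/\ U u, 0 <= t <= 1 & v = p (rotation (t *: x) u)]]
    (K * (lam * r)).
Proof.
move=> rp /andP[r0 rl] xl KE hU.
have lam0 : 0 < lam := lt_le_trans r0 rl.
have [[u1 Uu1]|Un] := pselect (U !=set0); last first.
  apply: (@covers_sub _ _ set0 0) covers0; first by move=> v [u [t [Uu]]]; case: Un; exists u.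
  apply: mulr_ge0; last by rewrite mulr_ge0 ?(ltW lam0) ?(ltW r0).
  have : 0 <= K * r ^+ 2 by apply: le_trans KE; rewrite mulr_ge0// sqr_ge0.
  by rewrite pmulr_lge0// exprn_gt0.
have D0 : 0 <= D by case: (hU _ Uu1) => h _; exact: le_trans h.
have [m m0 /andP[m1 m2]] := exists_nat_ceil (divr_ge0 (ltW lam0) (ltW r0)).
have mR : 0 < m%:R :> R by rewrite ltr0n.
have lm : lam / m%:R <= r by rewrite ler_pdivrMr// mulrC -ler_pdivrMr.
pose Q := 36 * (r * (D + 1)).
have D1 : 0 < D + 1 by rewrite ltr_wpDl.
exists [seq (p (rotation ((i%:R / m%:R) *: x) u0), Q) | i <- iota 0 m]; split.
- move=> b /mapP[i _ ->] /=; apply: mulr_ge0; first exact: ler0n.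
  by rewrite mulr_ge0 ?(ltW r0) ?(ltW D1).
- move=> _ [u [t [/hU[uD uu] t01 ->]]].
  have [i im /andP[i1 i2]] := unit_grid m0 t01.
  exists (p (rotation ((i%:R / m%:R) *: x) u0), Q).
    by apply/mapP; exists i => //; rewrite mem_iota.
  rewrite /=.
  have -> : t = i%:R / m%:R + (t - i%:R / m%:R) by ring.
  rewrite rotation_add.
  have rr : rigid (p \o rotation ((i%:R / m%:R) *: x)).
    by apply: rigid_comp => //; exact: rigid_rotation.
  apply: le_trans (rigid_lip _ _ rr) _.
  have tm : `|t - i%:R / m%:R| <= m%:R^-1.
    by rewrite ger0_norm ?subr_ge0// lerBlDr; move: i2; rewrite mulrDl mul1r addrC.
  have h1 : `|(t - i%:R / m%:R) *: x| <= 2 * r.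
    rewrite normrZ; apply: le_trans (ler_pM _ _ tm xl) _ => //.
    by rewrite mulrC -mulrA ler_wpM2l.
  have h2 := rotation_move ((t - i%:R / m%:R) *: x) u.
  have h3 : 4 * `|(t - i%:R / m%:R) *: x| * (`|u| + 1) <= 4 * (2 * r) * (D + 1).
    by apply: ler_pM; rewrite ?mulr_ge0 ?addr_ge0 ?ler_wpM2l ?lerD2r.
  have h4 : `|rotation ((t - i%:R / m%:R) *: x) u - u0| <= 4 * (2 * r) * (D + 1) + r.
    by rewrite -(subrKA u) (le_trans (ler_normD _ _))// lerD// (le_trans h2).
  have h5 : 0 <= r * D by rewrite mulr_ge0// ltW.
  rewrite /Q; move: h4 r0; lra.
- rewrite big_map /= big_const_seq count_predT size_iota iter_addr_0 -[leLHS]mulr_natl.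
  apply: (@le_trans _ _ (m%:R * (K * r ^+ 2 / 2))).
    by rewrite ler_wpM2l// ler_pdivlMr.
  have Kr : 0 <= K * r by
    rewrite -(pmulr_lge0 _ r0) -mulrA -expr2 (le_trans _ KE)// mulr_ge0// sqr_ge0.
  have mr : m%:R * r <= 2 * lam.
    have : m%:R * r <= (lam / r + 1) * r by rewrite ler_wpM2r// ltW.
    rewrite mulrDl divfK ?gt_eqF//; lra.
  have -> : m%:R * (K * r ^+ 2 / 2) = (m%:R * r) * (K * r) / 2 by ring.
  have -> : K * (lam * r) = (2 * lam) * (K * r) / 2 by field.
  by rewrite ler_pM2r ?invr_gt0// ler_wpM2r.
Qed.

Lemma covers_sweep (D r K : R) p s U u0 : rigid p -> 0 < r ->
  (forall it, List.In it s -> r <= slen it /\ `|svec it| <= 2 * slen it) ->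
  (2 * (36 * (D + 1))) ^+ 2 * 2 <= K ->
  (forall u, U u -> `|u| <= D /\ `|u - u0| <= r) ->
  covers (sweep p s U) (K * ((\sum_(it <- s) slen it) * r)).
Proof.
move=> rp r0 + KE hU; elim: s p rp => [|it s ih] p rp h /=.
  by rewrite big_nil mul0r mulr0; exact: covers0.
rewrite big_cons mulrDl mulrDr; apply: coversU; last first.
  apply: ih; last by move=> i hi; apply: h; right.
  by apply: rigid_comp => //; exact: rigid_rotation.
have [rl xl] := h it (or_introl erefl).
apply: (covers_sweep1 rp _ xl _ hU); first by rewrite r0.
have -> : (2 * (36 * (r * (D + 1)))) ^+ 2 * 2 = (2 * (36 * (D + 1))) ^+ 2 * 2 * r ^+ 2 by ring.
by rewrite ler_wpM2r// sqr_ge0.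
Qed.

Lemma sweep_bigcup p s (F : nat -> set (R * R)) :
  sweep p s (\bigcup_k F k) `<=` \bigcup_k sweep p s (F k).
Proof.
elim: s p => [|it s ih] p /= v; first by [].
move=> [[u [t [[k _ Fu] t01 vE]]]|/ih[k _ hk]]; exists k => //; [left|by right].
by exists u, t.
Qed.

Lemma sweep_sub p s U W : U `<=` W -> sweep p s U `<=` sweep p s W.
Proof.
move=> UW; elim: s p => [|it s ih] p //= v [[u [t [/UW Wu t01 vE]]]|/ih ?]; [left|by right].
by exists u, t.
Qed.

Lemma dist_le_dist2 u v : `|u - v| <= dist2 u v.
Proof.
have h (a b : R) : `|a| <= Num.sqrt (a ^+ 2 + b ^+ 2).
  by rewrite -sqrtr_sqr ler_wsqrtr// lerDl sqr_ge0.
have h' (a b : R) : `|b| <= Num.sqrt (a ^+ 2 + b ^+ 2) by rewrite addrC.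
by rewrite pair_norm_le; apply/andP; split; [exact: h|exact: h'].
Qed.

Lemma diam_ge0 U : (0 <= diam U)%E.
Proof. by rewrite /diam le_max lexx. Qed.

Lemma norm_le_diam U u v (r : R) : U u -> U v -> (diam U <= r%:E)%E -> `|u - v| <= r.
Proof.
move=> Uu Uv dr; apply: le_trans (dist_le_dist2 _ _) _; rewrite -lee_fin.
apply: le_trans dr; rewrite /diam le_max; apply/orP; right.
by apply: ereal_sup_ubound; exists u, v.
Qed.

(** A cover of [W] by sets of diameters [r_k], all smaller than every step, yields a
cover of the swept set with area [O(L * r_k)] for each [k], where [L] is the total
length.  The [r_k] add up to about the Hausdorff measure. *)
Lemma lebesgue2_sweep (D K eta : R) p s W : rigid p -> (0 < eta) ->
  (forall it, List.In it s -> 0 < slen it /\ `|svec it| <= 2 * slen it) ->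
  (2 * (36 * (D + 1))) ^+ 2 * 2 <= K ->
  (forall u, W u -> `|u| <= D) -> (hausdorff1 W < eta%:E)%E ->
  (lebesgue2 (sweep p s W) <= (K * (\sum_(it <- s) slen it) * (2 * eta))%:E)%E.
Proof.
move=> rp eta0 hs KE hW Heta.
have [d d0 hd] : exists2 d : R, 0 < d & forall it, List.In it s -> d <= slen it.
  elim: s hs => [|it s ih] hs; first by exists 1.
  have [|d d0 hd] := ih; first by move=> i hi; apply: hs; right.
  have [l0 _] := hs it (or_introl erefl).
  exists (Num.min d (slen it)); first by rewrite lt_min d0.
  by move=> i [<-|/hd hi]; rewrite ge_min ?lexx ?orbT// hi.
have L0 : 0 <= \sum_(it <- s) slen it.
  elim: s hs {hd} => [|it s ih] hs; first by rewrite big_nil.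
  rewrite big_cons addr_ge0 ?ih//; last by move=> i hi; apply: hs; right.
  by have [/ltW] := hs it (or_introl erefl).
have K0 : 0 <= K by apply: le_trans KE; rewrite mulr_ge0// sqr_ge0.
set L := \sum_(it <- s) slen it in L0 *.
pose e := Num.min (d / 2) eta.
have e0 : 0 < e by rewrite lt_min divr_gt0.
have : (hausdorff1_pre (d / 2) W < eta%:E)%E.
  by apply: le_lt_trans Heta; apply: ereal_sup_ubound; exists (d / 2) => //=; rewrite divr_gt0.
move=> /ereal_inf_lt[_ [U [WU Ud] <-]] Ueta.
have Ufin k : diam (U k) \is a fin_num.
  by rewrite ge0_fin_numE ?diam_ge0// (le_lt_trans (Ud k))// ltry.
(* positive radii, even for pieces that reduce to a point *)
pose r k : R := fine (diam (U k)) + e / (2 ^ k.+1)%:R.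
have r0 k : 0 < r k.
  by rewrite /r ltr_wpDl ?fine_ge0 ?diam_ge0// divr_gt0// ltr0n expn_gt0.
have rE k : (r k)%:E = (diam (U k) + (e / (2 ^ k.+1)%:R)%:E)%E.
  by rewrite /r EFinD fineK.
have rd k : r k <= d.
  have h1 : fine (diam (U k)) <= d / 2 by rewrite -lee_fin fineK.
  have h2 : e / (2 ^ k.+1)%:R <= d / 2.
    apply: (@le_trans _ _ e); last by rewrite ge_min lexx.
    rewrite ler_pdivrMr ?ltr0n ?expn_gt0// ler_peMr ?(ltW e0)//.
    by rewrite ler1n expn_gt0.
  by rewrite /r; lra.
apply: (@le_trans _ _ (lebesgue2 (\bigcup_k sweep p s (W `&` U k)))).
  apply: le_lebesgue2; apply: subset_trans (@sweep_bigcup p s _).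
  by apply: sweep_sub => u Wu; have [k _ Uu] := WU _ Wu; exists k.
apply: le_trans (lebesgue2_bigcup _) _.
apply: (@le_trans _ _ (\sum_(0 <= k <oo) ((K * L)%:E * (r k)%:E))%E).
  apply: lee_nneseries => k _; first by move=> _; exact: mu_ext_ge0.
  rewrite -EFinM -mulrA; apply: lebesgue2_covers.
  have [[u0 [Wu0 Uu0]]|Un] := pselect ((W `&` U k) !=set0).
    apply: (@covers_sweep D (r k) K p s _ u0 rp (r0 k)) => //.
      by move=> it hi; have [_ ?] := hs it hi; split => //; apply: le_trans (rd k) (hd _ hi).
    move=> u [Wu Uu]; split; first exact: hW.
    by apply: (norm_le_diam Uu Uu0); rewrite rE leeDl// lee_fin ltW// divr_gt0// ltr0n expn_gt0.
  apply: (@covers_sweep D (r k) K p s _ 0 rp (r0 k)) => //.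
    by move=> it hi; have [_ ?] := hs it hi; split => //; apply: le_trans (rd k) (hd _ hi).
  by move=> u Wu; case: Un; exists u.
rewrite nneseriesZl; last by move=> k _; rewrite lee_fin ltW.
rewrite [leRHS]EFinM; apply: lee_wpmul2l; first by rewrite lee_fin mulr_ge0.
under eq_eseriesr do rewrite rE.
apply: (le_trans (epsilon_trick _ _ _)); [by move=> k; exact: diam_ge0|exact: ltW|].
rewrite mulr_natl mulr2n EFinD; apply: leeD; first exact: ltW.
by rewrite lee_fin ge_min lexx orbT.
Qed.

End Sweep.

(** * Hausdorff measure and closed sets *)

(** [mu_ext] takes covers by measurable sets only, whereas the covers that define
[hausdorff1_pre] are arbitrary; on this copy every set is measurable, which makes
[hausdorff1_pre] an instance of [mu_ext] ([hausdorff1_preE]). *)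
Definition discrete_copy (T : Type) : Type := T.
HB.instance Definition _ (T : pointedType) := Pointed.copy (discrete_copy T) T.
HB.instance Definition _ (T : pointedType) := @isMeasurable.Build default_measure_display
  (discrete_copy T) discrete_measurable discrete_measurable0 discrete_measurableC discrete_measurableU.

Section Hausdorff.
Context {R : realType}.
Implicit Types (A B C X E : set (R * R)) (u v : R * R).
Local Open Scope ereal_scope.

Lemma diam0 : diam (set0 : set (R * R)) = 0.
Proof.
apply/eqP; rewrite eq_le diam_ge0 andbT /diam ge_max lexx /=.
by apply: ge_ereal_sup => d [u [v []]].
Qed.

(** Giving infinite weight to large sets expresses the constraint on the diameters
of a cover. *)
Definition gauge (d : R) (U : set (discrete_copy (R * R)%type)) : \bar R :=
  if diam (U : set (R * R)) <= d%:E then diam (U : set (R * R)) else +oo.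

Lemma gauge_ge0 d U : 0 <= gauge d U.
Proof. by rewrite /gauge; case: ifP => // _; exact: diam_ge0. Qed.

Lemma gauge0 (d : R) : (0 <= d)%R -> gauge d set0 = 0.
Proof. by move=> d0; rewrite /gauge diam0 lee_fin d0. Qed.

Lemma hausdorff1_preE (d : R) A : hausdorff1_pre d A = mu_ext (gauge d) A.
Proof.
apply/eqP; rewrite eq_le; apply/andP; split; apply: le_ereal_inf_tmp.
  move=> _ [U [_ AU] <-]; have [h|] := pselect (forall k, diam (U k : set (R * R)) <= d%:E).
    apply: ereal_inf_lbound; exists U => //.
    by apply: eq_eseriesr => k _; rewrite /gauge h.
  move=> /existsNP[k /negP hk]; rewrite (eseries_pinfty (k := k)) ?leey//.
    by move=> n _; rewrite gt_eqF// (lt_le_trans _ (gauge_ge0 _ _)).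
  by rewrite /gauge (negbTE hk).
move=> _ [U [AU Ud] <-]; apply: ereal_inf_lbound; exists U; first by split.
by apply: eq_eseriesr => k _; rewrite /gauge Ud.
Qed.

Lemma hausdorff1_pre_ge0 d A : 0 <= hausdorff1_pre d A.
Proof. by rewrite hausdorff1_preE; apply: mu_ext_ge0 => ?; exact: gauge_ge0. Qed.

Lemma hausdorff1_pre_le (d : R) A : (0 < d)%R -> hausdorff1_pre d A <= hausdorff1 A.
Proof. by move=> d0; apply: ereal_sup_ubound; exists d. Qed.

Lemma hausdorff1_pre_anti (d d' : R) A : (d <= d')%R ->
  hausdorff1_pre d' A <= hausdorff1_pre d A.
Proof.
move=> dd; apply: ereal_inf_le_tmp => _ [U [AU Ud] <-]; exists U => //; split => // k.
by rewrite (le_trans (Ud k))// lee_fin.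
Qed.

Lemma hausdorff1_set0 : hausdorff1 (set0 : set (R * R)) = 0.
Proof.
apply/eqP; rewrite eq_le; apply/andP; split.
  apply: ge_ereal_sup => _ [d /= d0 <-]; rewrite hausdorff1_preE mu_ext0// ?gauge0 ?ltW//.
  exact: gauge_ge0.
exact: le_trans (hausdorff1_pre_ge0 1 _) (hausdorff1_pre_le _ ltr01).
Qed.

Lemma hausdorff1_ge0 A : 0 <= hausdorff1 A.
Proof. exact: le_trans (hausdorff1_pre_ge0 1 _) (hausdorff1_pre_le _ ltr01). Qed.

Lemma le_hausdorff1 A B : A `<=` B -> hausdorff1 A <= hausdorff1 B.
Proof.
move=> AB; apply: ge_ereal_sup => _ [d /= d0 <-].
by apply: le_trans (hausdorff1_pre_le _ d0); rewrite !hausdorff1_preE; exact: le_mu_ext.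
Qed.

Lemma hausdorff1_sigma_subadditive : sigma_subadditive (@hausdorff1 R).
Proof.
move=> F; apply: ge_ereal_sup => _ [d /= d0 <-].
rewrite hausdorff1_preE; apply: (le_trans (mu_ext_sigma_subadditive (gauge_ge0 d) _)).
apply: lee_nneseries => k _; first by move=> _; apply: mu_ext_ge0; exact: gauge_ge0.
by rewrite -hausdorff1_preE hausdorff1_pre_le.
Qed.

HB.instance Definition _ := isOuterMeasure.Build R (R * R)%type (@hausdorff1 R)
  hausdorff1_set0 hausdorff1_ge0 le_hausdorff1 hausdorff1_sigma_subadditive.

Lemma hausdorff1_setU A B : hausdorff1 (A `|` B) <= hausdorff1 A + hausdorff1 B.
Proof. exact: outer_measureU2. Qed.

Definition separated A B := exists2 r : R, (0 < r)%R & forall u v, A u -> B v -> (r <= `|u - v|)%R.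

(** A set of diameter less than [r] cannot meet both [A] and [B], so every fine
cover splits into a cover of [A] and one of [B]. *)
Lemma hausdorff1_pre_separated (d r : R) A B : (d < r)%R ->
  (forall u v, A u -> B v -> (r <= `|u - v|)%R) ->
  hausdorff1_pre d A + hausdorff1_pre d B <= hausdorff1_pre d (A `|` B).
Proof.
move=> dr sep; apply: le_ereal_inf_tmp => _ [U [ABU Ud] <-].
pose V C k := if `[< U k `&` C !=set0 >] then U k else set0.
have Vd C k : diam (V C k) <= d%:E.
  by rewrite /V; case: ifP => // _; rewrite diam0 (le_trans _ (Ud k))// diam_ge0.
have VC C : C `<=` A `|` B -> hausdorff1_pre d C <= \sum_(0 <= k <oo) diam (V C k).
  move=> CAB; apply: ereal_inf_lbound; exists (V C) => //; split => // u Cu.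
  have [k _ Uu] := ABU _ (CAB _ Cu); exists k => //.
  by rewrite /V; case: asboolP => //; case; exists u.
apply: le_trans (leeD (VC A _) (VC B _)) _; [by left|by right|].
rewrite -nneseriesD; [|by move=> *; exact: diam_ge0..].
apply: lee_nneseries => k _; first by move=> _; apply: adde_ge0; exact: diam_ge0.
rewrite /V; case: asboolP => [[u [Uu Au]]|_]; last first.
  by rewrite diam0 add0e; case: asboolP => // _; rewrite diam0 diam_ge0.
case: asboolP => [[v [Uv Bv]]|_]; last by rewrite diam0 adde0.
by have := norm_le_diam Uu Uv (Ud k); rewrite leNgt (lt_le_trans dr)// sep.
Qed.

Lemma hausdorff1_separated A B : separated A B ->
  hausdorff1 A + hausdorff1 B <= hausdorff1 (A `|` B).
Proof.
move=> [r r0 sep].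
have [Xoo|Xfin] := eqVneq (hausdorff1 (A `|` B)) +oo; first by rewrite Xoo leey.
have X0 : hausdorff1 (A `|` B) < +oo by rewrite lt_neqAle Xfin leey.
have fin C : C `<=` A `|` B -> hausdorff1 C \is a fin_num.
  by move=> /le_hausdorff1 h; rewrite ge0_fin_numE ?hausdorff1_ge0// (le_lt_trans h).
have finA := fin A (@subsetUl _ _ _); have finB := fin B (@subsetUr _ _ _).
have key (d d' : R) : (0 < d)%R -> (0 < d')%R ->
    hausdorff1_pre d A + hausdorff1_pre d' B <= hausdorff1 (A `|` B).
  move=> d0 d'0; pose e := Num.min (Num.min d d') (r / 2)%R.
  have e0 : (0 < e)%R by rewrite !lt_min d0 d'0 divr_gt0.
  apply: le_trans (hausdorff1_pre_le _ e0).
  apply: le_trans (hausdorff1_pre_separated _ sep); last first.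
    by rewrite (@le_lt_trans _ _ (r / 2)%R)// ?ge_min ?lexx ?orbT// ltr_pdivrMr// ltr_pMr// ltr1n.
  by apply: leeD; apply: hausdorff1_pre_anti; rewrite !ge_min lexx ?orbT.
rewrite -leeBrDr//; apply: ge_ereal_sup => _ [d /= d0 <-]; rewrite leeBrDr//.
have finp : hausdorff1_pre d A \is a fin_num.
  by rewrite ge0_fin_numE ?hausdorff1_pre_ge0// (le_lt_trans (hausdorff1_pre_le A d0))// ltey_eq finA.
rewrite addeC -leeBrDr//; apply: ge_ereal_sup => _ [d' /= d'0 <-]; rewrite leeBrDr// addeC.
exact: key.
Qed.

(** Continuity from below without measurability, under summability of the
increments: the tail of the series bounds what is missing. *)
Lemma hausdorff1_increasing (F : nat -> set (R * R)) (e : R) :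
  (forall n, F n `<=` F n.+1) ->
  \sum_(0 <= n <oo) hausdorff1 (F n.+1 `\` F n) < +oo -> (0 < e)%R ->
  exists N, hausdorff1 ((\bigcup_n F n) `\` F N) <= e%:E.
Proof.
move=> incF sumF e0.
have tail := nneseries_tail_cvg sumF (fun k _ => hausdorff1_ge0 (F k.+1 `\` F k)).
have [N hN] : exists N, \sum_(N <= k <oo) hausdorff1 (F k.+1 `\` F k) <= e%:E.
  have /fine_cvgP[fin /cvgrPdist_le/(_ _ e0) near] := tail.
  have [N _ /(_ N (leqnn N))[finN]] := filterI fin near.
  rewrite sub0r normrN => h; exists N; rewrite -(fineK finN) lee_fin.
  exact: le_trans (ler_norm _) h.
exists N; apply: le_trans hN.
apply: le_trans (outer_measure_sigma_subadditive_tail _ N (fun k => F k.+1 `\` F k)).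
apply: le_hausdorff1 => u [[n _ Fn] FN].
have : exists n, u \in F n by exists n; rewrite inE.
move=> /ex_minnP[m]; rewrite inE => Fm hm.
have mN : (N < m)%N.
  rewrite ltnNge; apply/negP => mN; apply: FN; elim: N mN => [|N ih].
    by rewrite leqn0 => /eqP <-.
  by rewrite leq_eqVlt => /orP[/eqP <-//|]; rewrite ltnS => /ih /incF.
case: m mN Fm hm => // m; rewrite ltnS => mN Fm hm; exists m => /=.
  by apply/negP; rewrite -leqNgt.
by split => // Fu; have := hm m; rewrite inE ltnn => /(_ Fu).
Qed.

Lemma nneseries_bounded (f : nat -> \bar R) (M : \bar R) : (forall n, 0 <= f n) ->
  (forall n, \sum_(0 <= k < n) f k <= M) -> \sum_(0 <= k <oo) f k <= M.
Proof.
move=> f0 fM; apply: lime_le; first by apply: is_cvg_nneseries => n _ _; exact: f0.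
by apply: nearW.
Qed.

(** An increasing exhaustion of the complement of a closed set [C]: shells
[far C n.+1 `\` far C n] that are not consecutive are separated ([separated_shell]). *)
Definition far (C : set (R * R)) (n : nat) : set (R * R) :=
  [set u | forall v, C v -> (n.+1%:R^-1 <= `|u - v|)%R].

Lemma farS C n : far C n `<=` far C n.+1.
Proof.
move=> u h v /h; apply: le_trans; rewrite lef_pV2 ?posrE ?ltr0n//.
by rewrite ler_nat.
Qed.

Lemma closed_far C u : closed C -> ~ C u -> exists n, far C n u.
Proof.
move=> cC Cu; have : open (~` C) by exact: closed_openC.
rewrite openE => /(_ u Cu); rewrite /interior -nbhs_ballE => -[r /= r0 hr].
have [n n0 nr] := exists_nat_ge (r^-1)%R.
exists n => v Cv; rewrite leNgt; apply/negP => uv.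
have : ball u r v.
  rewrite -ball_normE /=; apply: lt_le_trans uv _.
  rewrite invf_ple ?posrE ?ltr0n//; apply: (le_trans nr).
  by rewrite ler_nat.
by move=> /hr.
Qed.

Lemma inv_gap (m n : nat) : (m < n)%N -> (0 < m.+1%:R^-1 - n.+1%:R^-1 :> R)%R.
Proof. by move=> mn; rewrite subr_gt0 ltf_pV2 ?posrE ?ltr0n// ltr_nat. Qed.

Lemma separated_shell C (X : set (R * R)) m n : (m < n)%N ->
  separated (X `&` far C m) (X `\` far C n).
Proof.
move=> mn; exists (m.+1%:R^-1 - n.+1%:R^-1)%R; first exact: inv_gap.
move=> u v [_ hu] [_ /existsNP[c /not_implyP[Cc /negP]]]; rewrite -ltNge => vc.
have := hu c Cc; have := @ler_normD _ (R * R)%type (u - v)%R (v - c)%R; rewrite subrKA => h1 h2.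
by rewrite lerBlDr (le_trans h2)// (le_trans h1)// lerD2l ltW.
Qed.

(** Shells of the same parity are mutually separated, so either parity adds up to at
most the measure of [X]; the induction by steps of one carries both
parities at once. *)
Lemma shells_bounded C X n (F := fun k => X `&` far C k) :
  \sum_(0 <= k < n.+1) hausdorff1 (F k.+1 `\` F k)
    <= hausdorff1 X + (hausdorff1 (F n) + hausdorff1 (F n.+1)).
Proof.
elim: n => [|n ih].
  rewrite big_nat1; apply: (@le_trans _ _ (hausdorff1 X)).
    by apply: le_hausdorff1 => u [[]].
  by rewrite leeDl// adde_ge0 ?hausdorff1_ge0.
rewrite big_nat_recr //; apply: le_trans (leeD ih (lexx _)) _.
rewrite -addeA leeD2l// [X in X + _]addeC -addeA leeD2l//.
apply: le_trans (hausdorff1_separated _) _; last first.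
  by apply: le_hausdorff1 => u [[Xu /farS/farS fu]|[]//]; split.
have [r r0 sep] := @separated_shell C X n n.+1 (ltnSn _).
exists r => // u v Fu [[Xv _] Fv]; apply: sep => //; split => // fv.
by apply: Fv; split.
Qed.

(** Caratheodory's criterion: closed sets are measurable for a metric outer measure.
The complement of [C] is exhausted by the sets [far C n], which are separated
from [C]. *)
Lemma hausdorff1_closed_split C X : closed C -> hausdorff1 X < +oo ->
  hausdorff1 (X `&` C) + hausdorff1 (X `\` C) <= hausdorff1 X.
Proof.
move=> cC Xfin; pose F k := X `&` far C k.
have incF n : F n `<=` F n.+1 by move=> u [Xu /farS].
have FX n : hausdorff1 (F n) <= hausdorff1 X by apply: le_hausdorff1 => u [].
have sumF : \sum_(0 <= n <oo) hausdorff1 (F n.+1 `\` F n) < +oo.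
  apply: (@le_lt_trans _ _ (hausdorff1 X + (hausdorff1 X + hausdorff1 X))).
    apply: nneseries_bounded => [n|n]; first exact: hausdorff1_ge0.
    apply: (@le_trans _ _ (\sum_(0 <= k < n.+1) hausdorff1 (F k.+1 `\` F k))).
      by rewrite big_nat_recr // leeDl// hausdorff1_ge0.
    by apply: le_trans (shells_bounded C X n) _; apply: leeD => //; apply: leeD; exact: FX.
  by rewrite !lte_add_pinfty.
apply/lee_addgt0Pr => e e0; have [N hN] := hausdorff1_increasing incF sumF e0.
apply: (@le_trans _ _ (hausdorff1 (X `&` C) + (hausdorff1 (F N) + e%:E))).
  apply: leeD => //; apply: (@le_trans _ _ (hausdorff1 (F N `|` ((\bigcup_n F n) `\` F N)))).
    apply: le_hausdorff1 => u [Xu Cu]; have [n fu] := closed_far cC Cu.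
    have [FN|FN] := pselect (F N u); first by left.
    by right; split => //; exists n.
  by apply: le_trans (hausdorff1_setU _ _) _; rewrite leeD2l.
rewrite addeA leeD2r//; apply: le_trans (hausdorff1_separated _) _; last first.
  by apply: le_hausdorff1 => u [[]|[]].
exists (N.+1%:R^-1)%R; first by rewrite invr_gt0 ltr0n.
by move=> u v [_ Cu] [_ fv]; rewrite distrC; exact: fv.
Qed.

(** [E] may be non-measurable, so continuity of a measure does not apply directly;
cutting by the closed sets [K n] one after another gives summability of the increments
instead. *)
Lemma hausdorff1_exhaust E (K : nat -> set (R * R)) (e : R) :
  (forall n, closed (K n)) -> (forall n, K n `<=` K n.+1) -> hausdorff1 E < +oo ->
  hausdorff1 (E `\` \bigcup_n K n) = 0 -> (0 < e)%R ->
  exists N, hausdorff1 (E `\` K N) <= e%:E.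
Proof.
move=> cK incK Efin EK e0; pose F n := E `&` K n.
have incF n : F n `<=` F n.+1 by move=> u [Xu /incK].
have EKfin n : hausdorff1 (E `\` K n) < +oo.
  by apply: le_lt_trans Efin; apply: le_hausdorff1 => u [].
have sumF : \sum_(0 <= n <oo) hausdorff1 (F n.+1 `\` F n) < +oo.
  apply: (@le_lt_trans _ _ (hausdorff1 E)) => //.
  apply: nneseries_bounded => [n|n]; first exact: hausdorff1_ge0.
  apply: (@le_trans _ _ (\sum_(0 <= k < n) hausdorff1 (F k.+1 `\` F k) + hausdorff1 (E `\` K n))).
    by rewrite leeDl// hausdorff1_ge0.
  elim: n => [|n ih]; first by rewrite big_geq// add0e; apply: le_hausdorff1 => u [].
  rewrite big_nat_recr //; apply: le_trans ih; rewrite -addeA leeD2l//.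
  apply: le_trans (hausdorff1_closed_split (cK n.+1) (EKfin n)).
  apply: leeD; apply: le_hausdorff1.
    by move=> u [[Eu Ku] nF]; split => //; split => // Kn; apply: nF.
  by move=> u [Eu Ku]; split => //; split => // /incK.
have [N hN] := hausdorff1_increasing incF sumF e0; exists N.
apply: (@le_trans _ _ (hausdorff1 ((E `\` \bigcup_n K n) `|` ((\bigcup_n F n) `\` F N)))).
  apply: le_hausdorff1 => u [Eu Ku].
  have [[n _ Kn]|h] := pselect ((\bigcup_n K n) u); last by left.
  by right; split; [exists n|move=> []].
by apply: le_trans (hausdorff1_setU _ _) _; rewrite EK add0e.
Qed.

End Hausdorff.

(** * C1 curves on compact intervals *)

Section Arcs.
Context {R : realType}.

Lemma segment_uniform_continuous (V : normedModType R) (f : R -> V) (a b d : R) :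
  continuous f -> 0 < d ->
  exists2 r : R, 0 < r & forall s t, a <= s <= b -> `|t - s| <= r -> `|f t - f s| <= d.
Proof.
move=> cf d0; have := @segment_compact R a b => /compact_near_coveringP.
move=> /(_ R (0^'+) (fun r s => forall t, `|t - s| <= r -> `|f t - f s| <= d)) cov.
have {cov}near : \forall r \near (0 : R)^'+,
    [set` `[a, b]] `<=` (fun s => forall t, `|t - s| <= r -> `|f t - f s| <= d).
  apply: cov => s sab; have := cf s => /cvgrPdist_lt/(_ (d / 2)); rewrite divr_gt0// => /(_ isT).
  rewrite -nbhs_ballE => -[r /= r0 hr].
  exists (ball s (r / 2), [set e | e < r / 2]).
    split; first by apply: nbhsx_ballx; rewrite divr_gt0.
    by apply: nbhs_right_lt; rewrite divr_gt0.
  move=> [s' e] /= [ss' er] t ts'.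
  rewrite -ball_normE /= in ss'.
  have r2 : r / 2 < r by rewrite ltr_pdivrMr// ltr_pMr// ltr1n.
  have h1 : `|f s - f s'| < d / 2 by apply: hr; rewrite -ball_normE /= (lt_trans ss').
  have h2 : `|f s - f t| < d / 2.
    apply: hr; rewrite -ball_normE /= -(subrKA s') (le_lt_trans (ler_normD _ _))//.
    by rewrite (distrC s' t); lra.
  rewrite -(subrKA (f s)) (le_trans (ler_normD _ _))// (distrC (f t)); lra.
have [r [hr r0]] := filter_ex (filterI near (nbhs_right_gt 0)).
by exists r => // s t sab; apply: hr; rewrite /= in_itv.
Qed.

Lemma segment_bounded (V : normedModType R) (f : R -> V) (a b : R) :
  continuous f -> exists M : R, forall s, a <= s <= b -> `|f s| <= M.
Proof.
move=> cf; have [ab|ba] := leP a b; last first.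
  by exists 0 => s /andP[h1 h2]; have := le_trans h1 h2; rewrite leNgt ba.
have [|c _ h] := @EVT_max R (fun s => `|f s|) a b ab.
  apply: continuous_subspaceT => s; apply: (@continuous_comp _ _ _ f (@Num.norm _ V)); first exact: cf.
  exact: norm_continuous.
by exists `|f c| => s sab; apply: h; rewrite in_itv.
Qed.

Lemma segment_bounded_below (V : normedModType R) (f : R -> V) (a b : R) :
  continuous f -> (forall s, f s != 0) -> exists2 M : R, 1 <= M & forall s, a <= s <= b -> 1 <= M * `|f s|.
Proof.
move=> cf f0; have [ab|ba] := leP a b; last first.
  by exists 1 => // s /andP[h1 h2]; have := le_trans h1 h2; rewrite leNgt ba.
have [|c _ h] := @EVT_min R (fun s => `|f s|) a b ab.
  apply: continuous_subspaceT => s; apply: (@continuous_comp _ _ _ f (@Num.norm _ V)); first exact: cf.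
  exact: norm_continuous.
have c0 : 0 < `|f c| by rewrite normr_gt0.
exists (1 + `|f c|^-1); first by rewrite lerDl invr_ge0.
move=> s sab; have hs : `|f c| <= `|f s| by apply: h; rewrite in_itv.
rewrite mulrDl mul1r ler_wpDl// mulrC ler_pdivlMr// mul1r//.
Qed.

Lemma is_derive_fst (g : R -> R * R) (t : R) : derivable g t 1 ->
  is_derive t 1 (fun s => (g s).1) (derive1 g t).1.
Proof.
move=> dg; have cg : h^-1 *: (g (h *: 1 + t) - g t) @[h --> 0^'] --> 'D_1 g t by exact: dg.
have cg1 : (h^-1 *: (g (h *: 1 + t) - g t)).1 @[h --> 0^'] --> ('D_1 g t).1.
  by apply: (cvg_comp _ _ cg); exact: cvg_fst.
apply: DeriveDef; first by apply/cvg_ex; exists ('D_1 g t).1; exact: cg1.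
by rewrite derive1E; apply/cvg_lim => //; exact: cg1.
Qed.

Lemma is_derive_snd (g : R -> R * R) (t : R) : derivable g t 1 ->
  is_derive t 1 (fun s => (g s).2) (derive1 g t).2.
Proof.
move=> dg; have cg : h^-1 *: (g (h *: 1 + t) - g t) @[h --> 0^'] --> 'D_1 g t by exact: dg.
have cg1 : (h^-1 *: (g (h *: 1 + t) - g t)).2 @[h --> 0^'] --> ('D_1 g t).2.
  by apply: (cvg_comp _ _ cg); exact: cvg_snd.
apply: DeriveDef; first by apply/cvg_ex; exists ('D_1 g t).2; exact: cg1.
by rewrite derive1E; apply/cvg_lim => //; exact: cg1.
Qed.

Lemma mean_value (f df : R -> R) (s t : R) : (forall x : R, is_derive x (1 : R) f (df x)) ->
  exists2 x : R, `|x - s| <= `|t - s| & f t - f s = df x * (t - s).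
Proof.
move=> fd; have cf : continuous f.
  by move=> x; apply/differentiable_continuous/derivable1_diffP; have [] := fd x.
have [st|/ltW ts] := leP s t.
  have [|x] := @MVT_segment R f df s t st; first exact: continuous_subspaceT.
  by rewrite in_itv/= => /andP[h1 h2] h; exists x => //; rewrite !ger0_norm ?subr_ge0// lerD2r.
have [|x] := @MVT_segment R f df t s ts; first exact: continuous_subspaceT.
rewrite in_itv/= => /andP[h1 h2] h; exists x.
  by rewrite (distrC x) (distrC t) !ger0_norm ?subr_ge0// lerD2l lerN2.
by rewrite -opprB h -mulrN opprB.
Qed.

(** The mean value theorem for the two coordinates and uniform continuity of the
derivative give the uniform Taylor estimate. *)
Lemma C1_tame_arc (g : R -> R * R) (a b : R) : C1_curve g ->
  exists M, tame_arc g (derive1 g) M a b.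
Proof.
move=> [dg cdg ndg].
have cg : continuous g by move=> t; apply/differentiable_continuous/derivable1_diffP.
have [M1 h1] := segment_bounded a b cg.
have [M2 h2] := segment_bounded a b cdg.
have [M3 M31 h3] := segment_bounded_below a b cdg ndg.
exists (Num.max M3 (Num.max M1 M2)); split; first by rewrite le_max M31.
  move=> s sab; rewrite !le_max h1// h2//= !orbT; split => //.
  by rewrite (le_trans (h3 s sab))// ler_wpM2r// le_max lexx.
move=> d d0; have [r r0 hr] := segment_uniform_continuous a b cdg d0.
exists r => // s t sab tab ts; split; last exact: hr.
have [x1 x1s e1] := mean_value s t (fun x => is_derive_fst (dg x)).
have [x2 x2s e2] := mean_value s t (fun x => is_derive_snd (dg x)).
rewrite pair_norm_le /= ?scaleRE e1 e2.
have E (p q c : R) : p * c - c * q = (p - q) * c by ring.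
rewrite !E !normrM; apply/andP; split; rewrite ler_wpM2r//.
  by apply: le_trans (norm_fst (derive1 g x1 - derive1 g s)) _; rewrite hr// (le_trans x1s).
by apply: le_trans (norm_snd (derive1 g x2 - derive1 g s)) _; rewrite hr// (le_trans x2s).
Qed.

Lemma tame_arc_le (g dg : R -> R * R) (M M' a b : R) : M <= M' ->
  tame_arc g dg M a b -> tame_arc g dg M' a b.
Proof.
move=> MM [M1 h u]; split; [exact: le_trans MM| |exact: u].
move=> s /h[h1 h2 h3]; split; [exact: le_trans MM|exact: le_trans MM|].
by rewrite (le_trans h3)// ler_wpM2r.
Qed.

Lemma tame_normal (g dg : R -> R * R) (M a b d : R) : tame_arc g dg M a b -> 0 < d ->
  exists2 r, 0 < r & forall s t, a <= s <= b -> a <= t <= b -> `|t - s| <= r ->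
    `|normal_functional (g t) (dg t) - normal_functional (g s) (dg s)| <= d.
Proof.
move=> [M1 bd u] d0.
have M0 : 0 < M by exact: lt_le_trans M1.
pose e := Num.min 1 (d / (6 * M)).
have e0 : 0 < e by rewrite lt_min ltr01 divr_gt0// mulr_gt0 ?ltr0n.
have [r r0 hr] := u e e0.
exists (Num.min r (e / (1 + M))); first by rewrite lt_min r0 divr_gt0// addr_gt0.
move=> s t sab tab; rewrite le_min => /andP[tr te].
have [g1 dg1] := hr s t sab tab tr.
have [b1 b2 _] := bd s sab; have [b3 b4 _] := bd t tab.
have eM : e * (6 * M) <= d by rewrite -ler_pdivlMr ?mulr_gt0 ?ltr0n// ge_min lexx orbT.
have e1 : e <= 1 by rewrite ge_min lexx.
have gg : `|g t - g s| <= e.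
  have -> : g t - g s = (g t - g s - (t - s) *: dg s) + (t - s) *: dg s by rewrite subrK.
  apply: le_trans (ler_normD _ _) _; rewrite normrZ.
  have : `|t - s| * (1 + M) <= e by rewrite -ler_pdivlMr// addr_gt0.
  have : e * `|t - s| <= 1 * `|t - s| by rewrite ler_wpM2r.
  have : `|t - s| * `|dg s| <= `|t - s| * M by rewrite ler_wpM2l.
  by move: g1; lra.
have ed : e <= d.
  have : e * 1 <= e * (6 * M) by rewrite ler_wpM2l ?(ltW e0)//; move: M1; lra.
  by move: eM; lra.
have dotb (x y : R * R) : `|x.1 * y.1 + x.2 * y.2| <= 2 * (`|x| * `|y|).
  apply: le_trans (ler_normD _ _) _; rewrite !normrM mulr_natl mulr2n.
  by rewrite lerD// ler_pM ?norm_fst ?norm_snd.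
rewrite pair_norm_le /=; apply/andP; split.
  by rewrite opprK addrC distrC (le_trans dg1).
have -> : (dg t).1 * (g t).1 + (dg t).2 * (g t).2 - ((dg s).1 * (g s).1 + (dg s).2 * (g s).2) =
  ((dg t - dg s).1 * (g t).1 + (dg t - dg s).2 * (g t).2) +
  ((dg s).1 * (g t - g s).1 + (dg s).2 * (g t - g s).2) by rewrite /=; ring.
apply: le_trans (ler_normD _ _) _.
have := dotb (dg t - dg s) (g t); have := dotb (dg s) (g t - g s).
have : `|dg t - dg s| * `|g t| <= e * M by rewrite ler_pM.
have : `|dg s| * `|g t - g s| <= M * e by rewrite ler_pM.
have : 0 <= e * M by rewrite mulr_ge0 ?ltW.
by move: eM; lra.
Qed.

End Arcs.

(** * Distances in the projective plane *)

Section Projective.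
Context {R : realType}.
Implicit Types (u v w : R * R) (x y z : R * R * R).

Lemma nonzero_dot3 x : x != 0 -> 0 < dot3 x x.
Proof.
by move=> x0; apply: lt_le_trans (norm_le_dot3 x); rewrite exprn_gt0// normr_gt0.
Qed.

Lemma dot3Nr x y : dot3 x (- y) = - dot3 x y.
Proof. by rewrite /dot3 /=; ring. Qed.

(** The vector product, which completes two orthogonal unit vectors to a frame. *)
Definition cross3 x y : R * R * R :=
  (x.1.2 * y.2 - x.2 * y.1.2, x.2 * y.1.1 - x.1.1 * y.2, x.1.1 * y.1.2 - x.1.2 * y.1.1).

Lemma dot3_cross3 x y : dot3 (cross3 x y) (cross3 x y) = dot3 x x * dot3 y y - dot3 x y ^+ 2.
Proof. by rewrite /dot3 /cross3 /=; ring. Qed.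

Lemma dot3_cross3l x y : dot3 x (cross3 x y) = 0.
Proof. by rewrite /dot3 /cross3 /=; ring. Qed.

Lemma dot3_cross3r x y : dot3 y (cross3 x y) = 0.
Proof. by rewrite /dot3 /cross3 /=; ring. Qed.

Lemma unit_dot3_bounds x y : dot3 x x = 1 -> dot3 y y = 1 -> -1 <= dot3 x y <= 1.
Proof.
move=> x1 y1.
have h : 0 <= dot3 (x - y) (x - y).
  by apply: le_trans (norm_le_dot3 _); exact: sqr_ge0.
have h' : 0 <= dot3 (x + y) (x + y).
  by apply: le_trans (norm_le_dot3 _); exact: sqr_ge0.
have E : dot3 (x - y) (x - y) = dot3 x x + dot3 y y - 2 * dot3 x y by rewrite /dot3 /=; ring.
have E' : dot3 (x + y) (x + y) = dot3 x x + dot3 y y + 2 * dot3 x y by rewrite /dot3 /=; ring.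
rewrite E x1 y1 in h; rewrite E' x1 y1 in h'.
by apply/andP; split; lra.
Qed.

Lemma pdist_le (v w : nonzero3 R) : dot3 (val v) (val v) = 1 -> dot3 (val w) (val w) = 1 ->
  pdist (pclass v) (pclass w) <= acos (dot3 (val v) (val w)).
Proof.
move=> v1 w1; apply: ge_inf; last by exists v, w.
exists 0 => _ [v' [w' [v'1 w'1 _ _ ->]]]; apply: acos_ge0; exact: unit_dot3_bounds.
Qed.

Lemma pclass_scale (v w : nonzero3 R) (c : R) : c != 0 -> val w = c *: val v -> pclass v = pclass w.
Proof.
by move=> c0 E; apply/(@eqmodP _ (proportional_equiv_rel R)); apply/asboolP; exists c.
Qed.

Lemma pclass_inj (v w : nonzero3 R) : pclass v = pclass w ->
  exists2 c : R, c != 0 & val w = c *: val v.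
Proof. by move=> /(@eqmodP _ (proportional_equiv_rel R)) /asboolP. Qed.

Lemma acos_lt (z e : R) : -1 <= z <= 1 -> 0 <= e <= pi -> cos e < z -> acos z < e.
Proof.
move=> z1 /andP[e0 epi] ez; rewrite ltNge; apply/negP => h.
have : cos (acos z) <= cos e.
  rewrite leNgt ltr_cos ?in_itv/= ?e0 ?acos_ge0 ?acos_lepi//.
  by rewrite -leNgt.
by rewrite acosK ?in_itv// leNgt ez.
Qed.

Lemma sqrt_dot3_unit x : x != 0 -> dot3 ((Num.sqrt (dot3 x x))^-1 *: x) ((Num.sqrt (dot3 x x))^-1 *: x) = 1.
Proof.
move=> x0; have d0 := nonzero_dot3 x0.
rewrite dot3Zr dot3C dot3Zr mulrA -expr2 exprVn sqr_sqrtr ?ltW// mulVf// gt_eqF//.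
Qed.

(** A vector close to a multiple of a unit vector [v] has nearly the class of [v].
Normalising changes the vector, hence the margin 16. *)
Lemma pdist_near (v w : nonzero3 R) (lam k e : R) : 0 < e <= 1 -> 0 < lam ->
  dot3 (val v) (val v) = 1 -> `|val w - lam *: val v| <= k * lam -> 0 <= k ->
  16 * k < 1 - cos e -> pdist (pclass v) (pclass w) < e.
Proof.
move=> /andP[e0 e1] lam0 v1 wv k0 ke.
have w0 := valP w; rewrite /= in w0.
have d0 := nonzero_dot3 w0.
set q := Num.sqrt (dot3 (val w) (val w)).
have q0 : 0 < q by rewrite sqrtr_gt0.
have w'0 : q^-1 *: val w != 0 by rewrite scaler_eq0 negb_or invr_eq0 gt_eqF.
pose w' : nonzero3 R := Sub (q^-1 *: val w) w'0.
have w'1 : dot3 (val w') (val w') = 1 by exact: sqrt_dot3_unit.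
have -> : pclass w = pclass w' by apply: (@pclass_scale _ _ q^-1) => //; rewrite invr_eq0 gt_eqF.
apply: le_lt_trans (pdist_le v1 w'1) _.
have e_pi : e <= pi by rewrite (le_trans e1)// (le_trans _ (@pi_ge2 R))// ler1n.
apply: acos_lt; first exact: unit_dot3_bounds.
  by rewrite (ltW e0).
rewrite [val w']/= dot3Zr mulrC.
have vn : `|val v| <= 1.
  by rewrite -(@ler_pXn2r _ 2%N) ?nnegrE// expr1n (le_trans (norm_le_dot3 _))// v1.
set r := val w - lam *: val v in wv.
have wE : val w = lam *: val v + r by rewrite /r addrC subrK.
have h1 : `|dot3 (val v) r| <= 3 * (k * lam).
  rewrite (le_trans (norm_dot3 _ _))// ler_wpM2l// -[leRHS]mul1r ler_pM//.
have h2 : `|dot3 r r| <= 3 * ((k * lam) * (k * lam)).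
  by rewrite (le_trans (norm_dot3 _ _))// ler_wpM2l// ler_pM.
have dvw : dot3 (val v) (val w) = lam + dot3 (val v) r by rewrite wE dot3Dr dot3Zr v1 mulr1.
have dww : dot3 (val w) (val w) = lam ^+ 2 + 2 * lam * dot3 (val v) r + dot3 r r.
  rewrite {1 2}wE; transitivity (lam ^+ 2 * dot3 (val v) (val v) + 2 * lam * dot3 (val v) r + dot3 r r).
    by rewrite /dot3 /= ?scaleRE; ring.
  by rewrite v1 mulr1.
have k1 : 16 * k < 2 by apply: lt_le_trans ke _; have := cos_geN1 e; lra.
have qle : q <= lam * (1 + 5 * k).
  rewrite /q -(@ler_pXn2r _ 2%N) ?nnegrE ?sqrtr_ge0 ?mulr_ge0 ?addr_ge0 ?mulr_ge0 ?(ltW lam0) ?ler0n//.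
  rewrite sqr_sqrtr ?(ltW d0)// dww.
  have h3 : dot3 (val v) r <= 3 * (k * lam) := le_trans (ler_norm _) h1.
  have h4 : dot3 r r <= 3 * ((k * lam) * (k * lam)) := le_trans (ler_norm _) h2.
  have h5 : 2 * lam * dot3 (val v) r <= 2 * lam * (3 * (k * lam)).
    by rewrite ler_wpM2l// mulr_ge0// ltW.
  have h6 : 0 <= lam ^+ 2 * k by rewrite mulr_ge0// sqr_ge0.
  have h7 : 0 <= lam ^+ 2 * k ^+ 2 by rewrite mulr_ge0// sqr_ge0.
  move: h4 h5 h6 h7; clear; rewrite !expr2; lra.
have h8 : - (3 * (k * lam)) <= dot3 (val v) r by move: h1; rewrite ler_norml => /andP[].
rewrite ltr_pdivlMr// dvw.
have [ce|ce] := leP (cos e) 0.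
  have : cos e * q <= 0 by rewrite mulr_le0_ge0 ?(ltW q0).
  have : 3 * (k * lam) < lam by rewrite mulrA gtr_pMl//; move: k1; lra.
  by move: h8; lra.
have h9 : cos e * q <= cos e * (lam * (1 + 5 * k)) by rewrite ler_wpM2l// ltW.
have h10 : cos e * (lam * (1 + 5 * k)) <= (1 - 16 * k) * (lam * (1 + 5 * k)).
  rewrite ler_wpM2r ?mulr_ge0 ?addr_ge0 ?mulr_ge0 ?(ltW lam0) ?ler0n//.
  by move: ke; lra.
have [k00|kp] := eqVneq k 0.
  move: ke h8; rewrite k00 => ke h8.
  have : cos e * q < 1 * lam.
    apply: le_lt_trans h9 _; rewrite k00 mulr0 addr0 mulr1 ltr_pM2r//; move: ke; lra.
  move: h8; lra.
have kp0 : 0 < k * lam by rewrite mulr_gt0// lt_def kp.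
have h11 : 0 <= k * (k * lam) by rewrite mulr_ge0// ltW.
move: h8 h9 h10 kp0 h11; lra.
Qed.

End Projective.

(** * Normal lines that avoid a ball centred on the line *)

Section Survivors.
Context {R : realType}.
Implicit Types (u v w : R * R) (x y z : R * R * R).
Variables e1 e2 : R * R * R.
Hypotheses (e11 : dot3 e1 e1 = 1) (e22 : dot3 e2 e2 = 1) (e12 : dot3 e1 e2 = 0).
Local Notation dirv := (dirv e1 e2).

Lemma dirv_neq0 a : dirv a != 0.
Proof.
apply/eqP => h; have := dot3_dirv e11 e22 e12 a a; rewrite subrr cos0 h.
by rewrite /dot3 /= => /eqP; rewrite !mul0r !addr0 eq_sym oner_eq0.
Qed.

Definition dirp a : nonzero3 R := Sub (dirv a) (dirv_neq0 a).

Lemma dot3_dirp a : dot3 (val (dirp a)) (val (dirp a)) = 1.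
Proof. by rewrite /= dot3_dirv// subrr cos0. Qed.

Lemma pdist_dirp a b : `|a - b| <= pi -> pdist (pclass (dirp a)) (pclass (dirp b)) <= `|a - b|.
Proof.
move=> ab; apply: le_trans (pdist_le (dot3_dirp a) (dot3_dirp b)) _.
by rewrite /= dot3_dirv// -cos_norm cosK// in_itv/= normr_ge0.
Qed.

Lemma dirvDpi a : dirv (a + pi) = - dirv a.
Proof. by rewrite /dirv cosDpi sinDpi !scaleNr opprD. Qed.

Lemma mem_normal_line u T (th : R) (x : nonzero3 R) : T != 0 -> cross T (cis th) = 0 ->
  dot3 (normal_functional u T) (val x) = 0 -> normal_line u th (pclass x).
Proof.
move=> T0 cT dx; exists x => //.
have c1 := cos2Dsin2 th.
set w := (val x).1; set f := (val x).2.
pose r := w - f *: u.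
have Tr : T.1 * r.1 + T.2 * r.2 = 0.
  by move: dx; rewrite /dot3 /normal_functional /r /= ?scaleRE -/w -/f => dx; lra.
have cr : cos th * r.1 + sin th * r.2 = 0.
  have E1 : T.1 * (cos th * r.1 + sin th * r.2) = 0.
    transitivity (cos th * (T.1 * r.1 + T.2 * r.2) + cross T (cis th) * r.2).
      by rewrite /cross /=; ring.
    by rewrite Tr cT mulr0 mul0r addr0.
  have E2 : T.2 * (cos th * r.1 + sin th * r.2) = 0.
    transitivity (sin th * (T.1 * r.1 + T.2 * r.2) - cross T (cis th) * r.1).
      by rewrite /cross /=; ring.
    by rewrite Tr cT mulr0 mul0r subr0.
  apply/eqP; move: T0; apply: contraNT => h.
  apply/eqP; apply: injective_projections; apply/eqP.
    by move/eqP: E1; rewrite mulf_eq0 (negbTE h) orbF.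
  by move/eqP: E2; rewrite mulf_eq0 (negbTE h) orbF.
exists f, (cos th * r.2 - sin th * r.1).
have -> : val x = (w, f) by exact: surjective_pairing.
have r1E : r.1 = - sin th * (cos th * r.2 - sin th * r.1).
  transitivity (r.1 * (cos th ^+ 2 + sin th ^+ 2)); first by rewrite c1 mulr1.
  transitivity (cos th * (cos th * r.1 + sin th * r.2) - sin th * (cos th * r.2 - sin th * r.1)).
    by ring.
  by rewrite cr mulr0 sub0r mulNr.
have r2E : r.2 = cos th * (cos th * r.2 - sin th * r.1).
  transitivity (r.2 * (cos th ^+ 2 + sin th ^+ 2)); first by rewrite c1 mulr1.
  transitivity (sin th * (cos th * r.1 + sin th * r.2) + cos th * (cos th * r.2 - sin th * r.1)).
    by ring.
  by rewrite cr mulr0 add0r.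
move: r1E r2E; set t := cos th * r.2 - sin th * r.1; rewrite /r /= ?scaleRE => r1E r2E.
apply: injective_projections; [apply: injective_projections|]; rewrite /= ?scaleRE.
- by move: r1E; lra.
- by move: r2E; lra.
- by ring.
Qed.

(** A linear form on the plane changes sign under [dirv (a + pi) = - dirv a], so it has
a zero on each half-circle: the line always meets the normal line. *)
Lemma dot3_dirv_zero x (a : R) : exists2 b, a <= b <= a + pi & dot3 x (dirv b) = 0.
Proof.
have pi0 := @pi_gt0 R.
have fE b : dot3 x (dirv b) = cos b * dot3 x e1 + sin b * dot3 x e2.
  by rewrite /dirv dot3Dr !dot3Zr.
have [|||b] := @IVT R (fun b => dot3 x (dirv b)) a (a + pi) 0.
- by rewrite lerDl ltW.
- apply: continuous_subspaceT => b.
  have -> : (fun b => dot3 x (dirv b)) = (fun b => cos b * dot3 x e1 + sin b * dot3 x e2).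
    by apply/funext.
  by apply: cvgD; apply: cvgM; [exact: continuous_cos|exact: cvg_cst|exact: continuous_sin|exact: cvg_cst].
- rewrite dirvDpi dot3Nr; have [h|h] := leP 0 (dot3 x (dirv a)).
    by rewrite ge_min le_max h oppr_le0 h orbT.
  by rewrite ge_min le_max oppr_ge0 (ltW h) orbT.
by rewrite in_itv/= => h h0; exists b.
Qed.

(** The zero found in [[a - e, a - e + pi]] cannot be within [e] of either end, since
both ends represent the centre of the ball that the normal line avoids. *)
Lemma normal_zero_in_sector (l : set (P2 R)) u T (th eps e a : R) :
  (forall b, l (pclass (dirp b))) -> 0 < e <= 1 -> e <= eps -> T != 0 -> cross T (cis th) = 0 ->
  normal_line u th `&` l `&` pball (pclass (dirp (a - e))) eps = set0 ->
  exists2 b, a <= b <= a + (pi - 2 * e) & dot3 (normal_functional u T) (dirv b) = 0.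
Proof.
move=> hl /andP[e0 e1'] ee T0 cT h0.
have pi2 := @pi_ge2 R.
have far b : dot3 (normal_functional u T) (dirv b) = 0 -> e <= `|a - e - b|.
  move=> hb; rewrite leNgt; apply/negP => he.
  have : (normal_line u th `&` l `&` pball (pclass (dirp (a - e))) eps) (pclass (dirp b)).
    split; first by split; [apply: (mem_normal_line T0 cT); exact: hb|exact: hl].
    rewrite /pball /=; apply: lt_le_trans ee; apply: le_lt_trans (he).
    apply: pdist_dirp; apply/ltW/(lt_le_trans he); lra.
  by rewrite h0.
have [b /andP[b1 b2] hb] := dot3_dirv_zero (normal_functional u T) (a - e).
exists b => //.
(* the other representative of the same projective point *)
have hb' : dot3 (normal_functional u T) (dirv (b - pi)) = 0.
  have : dot3 (normal_functional u T) (dirv (b - pi + pi)) = 0 by rewrite subrK.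
  by rewrite dirvDpi dot3Nr => /eqP; rewrite oppr_eq0 => /eqP.
have f1 := far _ hb; have f2 := far _ hb'.
apply/andP; split.
  by move: f1; rewrite ler0_norm; lra.
by move: f2; rewrite ger0_norm; lra.
Qed.

End Survivors.

(** * Polygonal paths of a list of steps *)

Section Paths.
Context {R : realType}.
Implicit Types (p : R * R -> R * R) (s : seq (@step R)).

Lemma compositeE (it0 : step) s :
  composite s = \big[@compm R/id]_(j < size s) rotation (svec (nth it0 s j)).
Proof.
rewrite -(big_mkord xpredT (fun j => rotation (svec (nth it0 s j)))).
rewrite -(big_nth it0 xpredT (fun it => rotation (svec it))).
by elim: s => [|it s ih]; rewrite ?big_nil// big_cons /= ih.
Qed.

Lemma path_endE (it0 : step) s (x : 'I_(size s) -> nonzero3 R) :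
  (forall i, val (x i) = svec (nth it0 s i)) -> path_end x = composite s.
Proof.
move=> xE; rewrite (compositeE it0); apply: eq_bigr => i _; by rewrite xE.
Qed.

Lemma path_vertexE (it0 : step) s (x : 'I_(size s) -> nonzero3 R) (i : 'I_(size s)) :
  (forall i, val (x i) = svec (nth it0 s i)) -> path_vertex x i = composite (take i s).
Proof.
move=> xE; rewrite (compositeE it0) size_takel ?(ltnW (ltn_ord i))//.
rewrite (big_ord_widen _ (fun j => rotation (svec (nth it0 (take i s) j))) (ltnW (ltn_ord i))).
by apply: eq_bigr => j ji; rewrite xE nth_take.
Qed.

Lemma mem_sweep (it0 : step) p s i U u (t : R) : (i < size s)%N -> U u -> 0 <= t <= 1 ->
  sweep p s U (p (composite (take i s) (rotation (t *: svec (nth it0 s i)) u))).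
Proof.
elim: s p i => [|it s ih] p [|i] //= si Uu t01; first by left; exists u, t.
by right; exact: (ih (p \o rotation (svec it))).
Qed.

Lemma mem_aligned_sweep (e1 e2 : R * R * R) (J : finType) (pts : J -> set (R * R)) nu c0 j
    (it0 : step) p s i u (t : R) : (i < size s)%N -> aligned e1 e2 nu c0 j (nth it0 s i) ->
  pts j u -> 0 <= t <= 1 ->
  aligned_sweep e1 e2 pts nu c0 j p s (p (composite (take i s) (rotation (t *: svec (nth it0 s i)) u))).
Proof.
elim: s p i => [|it s ih] p [|i] //= si cv ju t01.
  by left; split => //; exists u, t.
by right; exact: (ih (p \o rotation (svec it))).
Qed.

Lemma covers_bigcup_fin (J : finType) (F : J -> set (R * R)) (c : J -> R) :
  (forall j, covers (F j) (c j)) -> covers [set u | exists j, F j u] (\sum_j c j).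
Proof.
move=> h; have key (r : seq J) : covers [set u | exists2 j, j \in r & F j u] (\sum_(j <- r) c j).
  elim: r => [|j r ih].
    by rewrite big_nil; apply: (covers_sub _ (lexx 0) covers0) => u [].
  rewrite big_cons; apply: covers_sub (coversU (h j) ih) => // u [k].
  by rewrite inE => /orP[/eqP ->|kr] Fu; [left|right; exists k].
apply: covers_sub (key (index_enum J)) => // u [j Fu]; exists j => //.
Qed.

End Paths.

(** * Finitely many arcs carry almost all the length *)

Section Exhaustion.
Context {R : realType}.

(** Restricting the curves to compact parameter intervals gives closed sets, to which
[hausdorff1_exhaust] applies; the points where a curve and the tangent field
disagree form a null set for each curve. *)
Lemma rectifiable_arcs (E : set (R * R)) theta (eta : R) : rectifiable E ->
  (hausdorff1 E < +oo)%E -> tangent_field E theta -> 0 < eta ->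
  exists (g : nat -> R -> R * R) (N : nat), (forall i, C1_curve (g i)) /\
    (hausdorff1 (E `\` [set u | exists (i : nat) (t : R), [/\ (i < N)%N, (- N%:R <= t <= N%:R)%R,
       u = g i t & cross (derive1 (g i) t) (cis (theta u)) = 0%R]]) < eta%:E)%E.
Proof.
move=> [g gC gE] Efin tE eta0.
have cg i : continuous (g i).
  by move=> t; apply/differentiable_continuous/derivable1_diffP; have [] := gC i.
pose K (n : nat) := \bigcup_(i in `I_n) (g i @` `[- n%:R, n%:R]).
have Kcl n : closed (K n).
  apply: closed_bigcup => // i _; apply: compact_closed; first exact: norm_hausdorff.
  apply: continuous_compact; last exact: segment_compact.
  exact: continuous_subspaceT.
have KS n : K n `<=` K n.+1.
  move=> u [i /= iN [t ht <-]]; exists i => /=; first exact: ltnW.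
  exists t => //; move: ht; rewrite /= !in_itv/= -natr1 => /andP[]; have := ler0n R n; lra.
have KU : \bigcup_n K n = \bigcup_k range (g k).
  apply/seteqP; split=> u; first by move=> [n _ [i _ [t _ <-]]]; exists i => //; exists t.
  move=> [i _ [t _ <-]]; have [m m0 tm] := exists_nat_ge `|t|.
  exists (maxn i.+1 m) => //; exists i; first by rewrite /= leq_max ltnSn.
  exists t => //; rewrite /= in_itv/= -ler_norml (le_trans tm)// ler_nat leq_maxr//.
have eta2 : 0 < eta / 2 by rewrite divr_gt0.
have [N hN] := hausdorff1_exhaust Kcl KS Efin (etrans (congr1 (fun A => hausdorff1 (E `\` A)) KU) gE) eta2.
exists g, N; split => //.
pose bad i := [set x | E x /\ exists2 t, g i t = x & cross (derive1 (g i) t) (cis (theta x)) != 0].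
apply: (@le_lt_trans _ _ (hausdorff1 (E `\` K N) + hausdorff1 (\bigcup_i bad i))%E).
  apply: le_trans (hausdorff1_setU _ _); apply: le_hausdorff1 => u [Eu nu].
  have [[i /= iN [t ht gt]]|nK] := pselect (K N u); last by left.
  right; exists i => //; split => //; exists t => //; apply/eqP => c0; apply: nu.
  by exists i, t; split => //; move: ht; rewrite /= in_itv.
have -> : hausdorff1 (\bigcup_i bad i) = 0%E.
  apply/le_anti; rewrite hausdorff1_ge0 andbT (le_trans (hausdorff1_sigma_subadditive _))//.
  by rewrite eseries0// => i _ _; exact: tE.
rewrite adde0 (le_lt_trans hN)// lte_fin ltr_pdivrMr// ltr_pMr// ltr1n//.
Qed.

End Exhaustion.

Section UniformArcs.
Context {R : realType}.
Variables (g : nat -> R -> R * R).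
Hypothesis gC : forall i, C1_curve (g i).

Lemma uniform_tame (N : nat) (a b : R) :
  exists M, 1 <= M /\ forall i, (i < N)%N -> tame_arc (g i) (derive1 (g i)) M a b.
Proof.
elim: N => [|N [M [M1 hM]]]; first by exists 1.
have [M' hM'] := C1_tame_arc a b (gC N).
exists (Num.max M M'); split; first by rewrite le_max M1.
move=> i; rewrite ltnS leq_eqVlt => /predU1P[->|/hM h].
  by apply: tame_arc_le hM'; rewrite le_max lexx orbT.
by apply: tame_arc_le h; rewrite le_max lexx.
Qed.

Lemma uniform_normals (N : nat) (a b M d : R) : 0 < d ->
  (forall i, (i < N)%N -> tame_arc (g i) (derive1 (g i)) M a b) ->
  exists2 r : R, 0 < r & forall i, (i < N)%N -> forall s t, a <= s <= b -> a <= t <= b -> `|t - s| <= r ->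
    `|normal_functional (g i t) (derive1 (g i) t) - normal_functional (g i s) (derive1 (g i) s)| <= d.
Proof.
move=> d0; elim: N => [_|N ih hM]; first by exists 1.
have [|r r0 hr] := ih; first by move=> i iN; apply: hM; exact: ltnW.
have [r' r'0 hr'] := tame_normal (hM N (ltnSn N)) d0.
exists (Num.min r r'); first by rewrite lt_min r0.
move=> i; rewrite ltnS leq_eqVlt => /predU1P[->|iN] s t hs ht; rewrite le_min => /andP[h1 h2].
  exact: hr'.
exact: hr.
Qed.

End UniformArcs.

(** * Choice of the number of refinements *)

Section Angles.
Context {R : realType}.

(** With widths adding up to exactly [pi - 2 * e], the final [inv_length] is
[sin e * sin (e - del / 2)], bounded below for every [del <= e]. *)
Lemma inv_length_bound (e d0 : R) : 0 < e <= 1 / 2 -> 0 < d0 ->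
  exists (K : nat) (del : R), [/\ 0 < del <= d0, K%:R * del = pi - 2 * e, (K%:R + 1) * del < pi,
    0 < inv_length del K & inv_length del 0 / inv_length del K <= (sin e * sin (e / 2))^-1].
Proof.
move=> /andP[e0 e1] d00; have pi2 := @pi_ge2 R.
have pe0 : 0 < Num.min d0 e by rewrite lt_min d00.
have [K K0 hK] := exists_nat_ge (pi / Num.min d0 e).
have K0' : 0 < K%:R :> R by rewrite ltr0n.
pose T : R := pi - 2 * e.
have T0 : 0 < T by rewrite /T; lra.
have hd : T / K%:R <= Num.min d0 e.
  rewrite ler_pdivrMr//; move: hK; rewrite ler_pdivrMr// mulrC => hK; apply: le_trans hK; rewrite /T; lra.
move: hd; rewrite le_min => /andP[hd he].
exists K, (T / K%:R).
have KT : K%:R * (T / K%:R) = T by rewrite mulrC divfK// gt_eqF.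
have del0 : 0 < T / K%:R by rewrite divr_gt0.
have Kpi : (K%:R + 1) * (T / K%:R) < pi by rewrite mulrDl KT mul1r; move: he; rewrite /T; lra.
have se : 0 < sin e by apply: sin_gt0_pi; lra.
have se2 : 0 < sin (e / 2) by apply: sin_gt0_pi; lra.
have C0 := inv_length_gt0 del0 Kpi (leqnn K).
split => //; first by rewrite del0.
rewrite ler_pdivrMr// ler_pdivlMl ?mulr_gt0//.
apply: le_trans (_ : sin e * sin (e / 2) * 1 <= _).
  rewrite ler_wpM2l ?mulr_ge0 ?(ltW se) ?(ltW se2)//.
  by rewrite /inv_length mul0r mul0r cos0 mul1r cos_le1.
rewrite mulr1 /inv_length.
move: (T / K%:R) del0 he KT => del del0 he KT.
rewrite KT.
rewrite [(_ + 1) * _]mulrDl KT mul1r.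
have -> : T / 2 = pi / 2 - e by rewrite /T; field.
have -> : (T + del) / 2 = pi / 2 - (e - del / 2) by rewrite /T; field.
have cE (x : R) : cos (pi / 2 - x) = sin x by rewrite -cosN opprB cosBpihalf.
rewrite !cE ler_wpM2l ?(ltW se)//.
rewrite leNgt ltr_sin ?in_itv/= -?leNgt; lra.
Qed.

End Angles.

(** * Zigzags for finitely many arcs *)

Section Sweeps.
Context {R : realType}.
Variables e1 e2 : R * R * R.
Hypotheses (e11 : dot3 e1 e1 = 1) (e22 : dot3 e2 e2 = 1) (e12 : dot3 e1 e2 = 0).
Local Notation dirv := (dirv e1 e2).
Variables (g : nat -> R -> R * R) (N : nat) (b M : R).
Hypotheses (M1 : 1 <= M) (b0 : 0 < b).
Hypothesis tame : forall i, (i < N)%N -> tame_arc (g i) (derive1 (g i)) M (- b) b.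

Definition normal_at i s := normal_functional (g i s) (derive1 (g i) s).

(** Passing from the normal functional at the start of a piece to the one at another
of its points; the constants are those used in [zigzag_arcs]. *)
Lemma dot3_perturb (n n' x : R * R * R) (d lam : R) : `|n' - n| <= d -> `|x| <= 2 * lam ->
  `|dot3 n x| <= 4 * d * lam -> `|dot3 n' x| <= 10 * d * lam.
Proof.
move=> hn hx h; rewrite -(subrK n n') dot3C dot3Dr.
apply: le_trans (ler_normD _ _) _; rewrite ![dot3 x _]dot3C.
have := norm_dot3 (n' - n) x.
have := ler_pM (normr_ge0 _) (normr_ge0 _) hn hx.
lra.
Qed.

Lemma norm_normal_at i (s : R) : (i < N)%N -> - b <= s <= b -> `|normal_at i s| <= 2 * M ^+ 2.
Proof.
move=> iN sb; have [_ /(_ s sb)[gM dM _] _] := tame iN.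
have M0 : 0 <= M by exact: le_trans M1.
have M2 : M <= M ^+ 2 by rewrite expr2 ler_peMr.
rewrite /normal_at /normal_functional; rewrite pair_norm_le /=; apply/andP; split.
  by rewrite normrN; lra.
apply: le_trans (ler_normD _ _) _; rewrite !normrM mulr_natl mulr2n.
have f1 := le_trans (norm_fst _) gM; have f2 := le_trans (norm_snd _) gM.
have d1 := le_trans (norm_fst _) dM; have d2 := le_trans (norm_snd _) dM.
by rewrite expr2 lerD// ler_pM.
Qed.

Lemma piece_of (q : nat) (a : R) : (0 < q)%N -> - b <= a <= b ->
  exists k : 'I_q, - b + k%:R * (2 * b / q%:R) <= a <= - b + k%:R * (2 * b / q%:R) + 2 * b / q%:R.
Proof.
move=> q0 /andP[ba ab]; have qR : 0 < q%:R :> R by rewrite ltr0n.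
set h := 2 * b / q%:R.
have h0 : 0 < h by rewrite /h divr_gt0 ?mulr_gt0.
have qh : q%:R * h = 2 * b by rewrite /h mulrC divfK// gt_eqF.
clearbody h.
suff [k kq] : exists2 k, (k < q)%N & - b + k%:R * h <= a <= - b + k%:R * h + h.
  by move=> hk; exists (Ordinal kq).
have : a <= - b + q%:R * h by lra.
elim: (q) q0 => // m ih _ am; have [lt_a|le_a] := ltP a (- b + m%:R * h).
  case: m ih am lt_a => [|m] ih am lt_a; first by move: lt_a; rewrite mul0r addr0; lra.
  by have [k km hk] := ih isT (ltW lt_a); exists k => //; exact: ltnW.
by exists m => //; rewrite le_a /=; move: am; rewrite -natr1 mulrDl mul1r addrA.
Qed.

(** All the constants are chosen here.  The arcs are cut into pieces on which the
normal functional varies by at most [d], so that the area is at most a constant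
times [d] times the length of the motion. *)
Lemma zigzag_arcs (lam0 e c k0 : R) (it0 : step) : 0 < lam0 -> 0 < e <= 1 / 2 -> 0 < c -> 0 < k0 ->
  exists s : seq step, [/\
    forall it, List.In it s -> [/\ 0 < slen it, shi it = slo it + (pi - 2 * e),
      (sdir it == slo it) || (sdir it == shi it) & `|svec it - slen it *: dirv (sdir it)| <= k0 * slen it],
    composite s = rotation (lam0 *: dirv 0),
    \sum_(it <- s) slen it <= (sin e * sin (e / 2))^-1 * lam0 &
    covers [set v | exists (i m : nat) (a t : R), [/\ (i < N)%N /\ (m < size s)%N, - b <= a <= b, 0 <= t <= 1,
      exists2 th, slo (nth it0 s m) <= th <= shi (nth it0 s m) & dot3 (normal_at i a) (dirv th) = 0 &
      v = composite (take m s) (rotation (t *: svec (nth it0 s m)) (g i a))]] c].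
Proof.
move=> lam00 e01 c0 k00.
have [KM KM0 hKM] : exists2 KM : R, 0 <= KM & (500 * M) ^+ 2 <= KM.
  by exists ((500 * M) ^+ 2); [exact: sqr_ge0|exact: lexx].
have [L LE] : exists L : R, L = (sin e * sin (e / 2))^-1 * lam0 by eexists.
have L0 : 0 <= L.
  have [e0 e1'] := andP e01; have pi2 := @pi_ge2 R.
  have se : 0 < sin e by apply: sin_gt0_pi; lra.
  have se2 : 0 < sin (e / 2) by apply: sin_gt0_pi; lra.
  by rewrite LE mulr_ge0 ?(ltW lam00)// invr_ge0 mulr_ge0 ?(ltW se) ?(ltW se2).
(* [d * X] will bound the total cost of the strips *)
have [X X0 XE] : exists2 X : R, 0 < X & 8 * KM * (10 * (2 * b)) * N%:R * L <= X.
  have h : 0 <= 8 * KM * (10 * (2 * b)) * N%:R * L.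
    apply: mulr_ge0 => //; apply: mulr_ge0 => //; apply: mulr_ge0; first exact: mulr_ge0.
    by apply: mulr_ge0 => //; apply: mulr_ge0 => //; exact: ltW.
  by exists (8 * KM * (10 * (2 * b)) * N%:R * L + 1); lra.
have [d d01 dX] : exists2 d : R, 0 < d <= 1 / 10 & d * X <= c / 2.
  exists (Num.min (1 / 10) (c / 2 / X)).
    by rewrite lt_min !divr_gt0//= ge_min lexx.
  by rewrite -ler_pdivlMr// ge_min lexx orbT.
have [d0 d10] := andP d01.
have d100 : 0 < 10 * d <= 1 by apply/andP; split; lra.
have [r r0 hr] := uniform_normals d0 tame.
have [q q0 hq] := exists_nat_ge (2 * b / r).
have qR : 0 < q%:R :> R by rewrite ltr0n.
have [h [h0 hE hle]] : exists h : R, [/\ 0 < h, h = 2 * b / q%:R & h <= r].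
  exists (2 * b / q%:R); split => //; first by rewrite divr_gt0 ?mulr_gt0.
  by move: hq; rewrite ler_pdivrMr// => hq; rewrite ler_pdivrMr// [leRHS]mulrC.
have qh : q%:R * h = 2 * b by rewrite hE mulrC divfK// gt_eqF.
pose J := ('I_N * 'I_q)%type.
pose s0 (j : J) := - b + j.2%:R * h.
have s0P (j : J) (s : R) : s0 j <= s <= s0 j + h -> - b <= s <= b.
  rewrite /s0 => /andP[h1 h2].
  have j1 : j.2%:R + 1 <= q%:R :> R by rewrite natr1 ler_nat.
  have j2 := ler_wpM2r (ltW h0) j1; have j0 : 0 <= j.2%:R * h by rewrite mulr_ge0 ?(ltW h0).
  by apply/andP; split; lra.
pose pts (j : J) := [set u | exists2 s : R, s0 j <= s <= s0 j + h & u = g j.1 s].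
pose nu (j : J) := normal_at j.1 (s0 j).
have s00 (j : J) : - b <= s0 j <= b by apply: (s0P j); rewrite lexx lerDl (ltW h0).
have nuM j : `|nu j| <= 2 * M ^+ 2 by apply: norm_normal_at.
have nearE j (s : R) : s0 j <= s <= s0 j + h -> `|normal_at j.1 s - nu j| <= d.
  move=> hs; apply: (hr j.1 (ltn_ord _)) => //; first exact: (s0P j).
  by move: hs => /andP[h1 h2]; rewrite ger0_norm; lra.
(* for this bound on [del], widening a sector costs at most [d] in alignment ([nuc]) *)
have dM0 : 0 < d / (30 * M ^+ 2).
  by rewrite divr_gt0// mulr_gt0// exprn_gt0// (lt_le_trans _ M1).
have [K [del [/andP[del0 deld] Kdel Kpi C0 CE]]] := inv_length_bound e01 dM0.
have ptsD j u : pts j u -> `|u| <= M.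
  by move=> [s /s0P hs ->]; have [_ /(_ s hs)[]] := tame (ltn_ord j.1).
have cst00 : 0 <= 8 * KM * (10 * d * h).
  apply: mulr_ge0; first exact: mulr_ge0.
  by apply: mulr_ge0 (ltW h0); apply: mulr_ge0 => //; exact: ltW.
have cst0 (j : J) : 0 <= 8 * KM * (10 * d * h) := cst00.
have nuc j : 3 * d + 15 * `|nu j| * del <= 4 * d.
  have h1 : 15 * `|nu j| * del <= (30 * M ^+ 2) * (d / (30 * M ^+ 2)).
    apply: ler_pM deld; [exact: mulr_ge0|exact: ltW|].
    have -> : 30 * M ^+ 2 = 15 * (2 * M ^+ 2) by ring.
    exact: ler_wpM2l (nuM j).
  have : (30 * M ^+ 2) * (d / (30 * M ^+ 2)) = d.
    by rewrite mulrC divfK// gt_eqF// mulr_gt0// exprn_gt0// (lt_le_trans _ M1).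
  move=> E; rewrite E in h1; apply: le_trans (lerD (lexx (3 * d)) h1) _.
  by rewrite le_eqVlt; apply/orP; left; apply/eqP; ring.
have strip j x (lam : R) p : rigid p -> 0 < lam -> `|x| <= 2 * lam -> `|dot3 (nu j) x| <= 4 * d * lam ->
    covers [set v | exists u (t : R), [/\ pts j u, 0 <= t <= 1 & v = p (rotation (t *: x) u)]]
      (8 * KM * (10 * d * h) * lam).
  move=> rp l0 xl nx.
  have tj : tame_arc (g j.1) (derive1 (g j.1)) M (s0 j) (s0 j + h).
    have /andP[h2 _] := s00 j.
    have /andP[_ h1] : - b <= s0 j + h <= b by apply: (s0P j); rewrite lexx lerDl (ltW h0).
    exact: tame_arc_sub (tame (ltn_ord _)) h2 h1.
  have nxs (s : R) : s0 j <= s <= s0 j + h ->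
      `|dot3 (normal_functional (g j.1 s) (derive1 (g j.1) s)) x| <= 10 * d * lam.
    by move=> hs; exact: dot3_perturb (nearE j s hs) xl nx.
  apply: covers_sub (covers_strip tj hKM h0 d100 l0 xl nxs rp).
    by move=> v [u [t [[s hs ->] t01 ->]]]; exists s, t.
  rewrite le_eqVlt; apply/orP; left; apply/eqP; ring.
(* the slack [zeta] is shared among the [N * q] pieces *)
pose nJ : R := (N * q)%:R + 1.
have nJ0 : 0 < nJ by rewrite ltr_wpDl.
have zeta0 : 0 < inv_length del K * (c / (2 * nJ)) by rewrite mulr_gt0// divr_gt0// mulr_gt0.
pose kap := Num.min (Num.min 1 del) k0.
have kap01 : 0 < kap <= 1 by rewrite !lt_min ltr01 del0 k00 /= !ge_min lexx.
have kapdel : kap <= del by rewrite !ge_min lexx orbT.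
have M0 : 0 <= M by exact: le_trans M1.
have [s [s1 s2 s3 s4]] := zigzag e11 e22 e12 del0 Kpi M0 ptsD cst0 nuc strip lam00 erefl zeta0 kap01 kapdel.
exists s; split => //.
- move=> it; elim: (s) s1 => //= it' s' ih /andP[/and4P[v1 /eqP v2 v3 v4] hs] [<-|]; last exact: ih.
  split => //; first by rewrite v2 Kdel.
  by apply: le_trans v4 _; rewrite ler_wpM2r ?(ltW v1)// ge_min lexx orbT.
- by rewrite s3 ler_wpM2r ?(ltW lam00).
apply: covers_sub (covers_bigcup_fin s4).
  move=> v [i [m [a [t [[iN mS] ab t01 [th hth nth0] ->]]]]].
  have [k hk] := piece_of q0 ab; rewrite -hE in hk.
  exists (Ordinal iN, k); apply: (@mem_aligned_sweep R e1 e2 J pts nu (3 * d) _ it0 id) => //.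
    apply/asboolP; exists th => //.
    rewrite -[nu _](subrK (normal_at i a)) dot3C dot3Dr [dot3 _ (normal_at _ _)]dot3C nth0 addr0.
    apply: le_trans (norm_dot3 _ _) _; rewrite ler_wpM2l//.
    rewrite -[leRHS]mul1r ler_pM// ?norm_dirv// distrC.
    exact: (nearE (Ordinal iN, k)).
  by exists a.
rewrite sumr_const card_prod !card_ord -[_ *+ _]mulr_natl.
rewrite [inv_length del K * _]mulrC mulfK ?gt_eqF//.
have NqE : (N * q)%:R = nJ - 1 by rewrite addrK.
rewrite NqE.
have C1 := ler_wpM2r (ltW lam00) CE; rewrite -LE in C1.
set Q := _ * lam0 in C1 *; clearbody Q.
have h1 : (N * q)%:R * (8 * KM * (10 * d * h) * Q) <= c / 2.
  apply: le_trans dX; have := ler_wpM2l (ltW d0) XE; apply: le_trans.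
  have -> : d * (8 * KM * (10 * (2 * b)) * N%:R * L) = (N * q)%:R * (8 * KM * (10 * d * h)) * L.
    by rewrite -qh natrM; ring.
  by rewrite [leLHS]mulrA; apply: ler_wpM2l => //; exact: mulr_ge0.
have h2 : (nJ - 1) * (c / (2 * nJ)) <= c / 2.
  have -> : c / 2 = nJ * (c / (2 * nJ)) by field; rewrite gt_eqF.
  by rewrite ler_wpM2r ?gerBl// divr_ge0 ?(ltW c0)// mulr_ge0 ?(ltW nJ0).
rewrite -NqE mulrDr; rewrite -NqE in h2; apply: le_trans (lerD h1 h2) _.
by rewrite le_eqVlt; apply/orP; left; apply/eqP; field.
Qed.

End Sweeps.

(** * The polygonal path *)

Section Frame.
Context {R : realType}.
Implicit Types (n y : R * R * R).

(** An orthonormal frame of the plane of the line with normal vector [n], whose first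
vector points to the centre [y] of the rotation. *)
Lemma line_frame n y : n != 0 -> y != 0 -> dot3 n y = 0 ->
  exists (e1 e2 : R * R * R) (lam : R),
    [/\ dot3 e1 e1 = 1, dot3 e2 e2 = 1, dot3 e1 e2 = 0,
        0 < lam /\ y = lam *: dirv e1 e2 0 & forall a, dot3 n (dirv e1 e2 a) = 0].
Proof.
move=> n0 y0 ny; have y1 := sqrt_dot3_unit y0; have n1 := sqrt_dot3_unit n0.
have nE0 : (Num.sqrt (dot3 n n))^-1 != 0 by rewrite invr_eq0 sqrtr_eq0 -ltNge nonzero_dot3.
have l0 : 0 < Num.sqrt (dot3 y y) by rewrite sqrtr_gt0 nonzero_dot3.
set m := _ *: n in n1; set e := _ *: y in y1.
have me : dot3 m e = 0 by rewrite /m /e dot3Zr dot3C dot3Zr dot3C ny !mulr0.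
have nm x : dot3 m x = 0 -> dot3 n x = 0.
  by rewrite /m dot3C dot3Zr dot3C => /eqP; rewrite mulf_eq0 (negbTE nE0) => /eqP.
have eE : y = Num.sqrt (dot3 y y) *: e by rewrite /e scalerA mulfV ?gt_eqF// scale1r.
clearbody m e; exists e, (cross3 m e), (Num.sqrt (dot3 y y)); split => //.
- by rewrite dot3_cross3 y1 n1 me expr0n subr0 mulr1.
- exact: dot3_cross3r.
- by split => //; rewrite /dirv cos0 sin0 scale1r scale0r addr0 -eE.
- by move=> a; apply: nm; rewrite /dirv dot3Dr !dot3Zr me dot3_cross3l !mulr0 addr0.
Qed.

Lemma in_nth (T : Type) (x0 : T) s i : (i < size s)%N -> List.In (nth x0 s i) s.
Proof. by elim: s i => // x s ih [|i] si; [left|right; exact: ih]. Qed.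

End Frame.

Theorem theorem5p1 (R : realType) (E : set (R * R)) (theta : R * R -> R)
    (eps : R) (rho : R * R -> R * R) (c : P2 R) (l : set (P2 R)) :
  bounded_set E ->
  rectifiable E ->
  (hausdorff1 E < +oo)%E ->
  tangent_field E theta ->
  0 < eps ->
  isom_plus rho ->
  rho <> id ->
  projective_center rho c ->
  projective_line l ->
  l c ->
  exists (n : nat) (x : 'I_n -> nonzero3 R) (u : 'I_n -> P2 R),
    [/\ forall i, pnbhd l eps (pclass (x i)),
        path_end x = rho,
        forall i, l (u i) &
        (lebesgue2 (\bigcup_(i in [set: 'I_n]) \bigcup_(p in path_segment x i)
           (p @` [set y | E y /\
              normal_line y (theta y) `&` l `&` pball (u i) eps = set0]))
         < eps%:E)%E].
Proof.
move=> bE rE fE tE eps0 _ _ [y -> cE] [n lE].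
rewrite {}cE lE => -[v nv /pclass_inj[k _ yk]].
have ny : dot3 (val n) (val y) = 0 by rewrite yk dot3Zr nv mulr0.
have [e1 [e2 [lam0 [e11 e22 e12 [lam00 yE] ne]]]] := line_frame (valP n) (valP y) ny.
have ldir a : l (pclass (dirp e11 e22 e12 a)) by rewrite lE; exists (dirp e11 e22 e12 a) => //=; exact: ne.
rewrite -lE; clear v k nv yk ny ne lE.
have [e [e0 e1' ee]] : exists e : R, [/\ 0 < e, e <= 1 / 2 & e <= eps].
  exists (Num.min eps (1 / 2)); split; last by rewrite ge_min lexx.
    by rewrite lt_min eps0 divr_gt0.
  by rewrite ge_min lexx orbT.
have e01 : 0 < e <= 1 / 2 by rewrite e0.
have e1'' : e <= 1 by lra.
have [D D0 ED] : exists2 D : R, 0 <= D & forall u, E u -> `|u| <= D.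
  have [M [_ hM]] := bE; exists (Num.max (M + 1) 0); first by rewrite le_max lexx orbT.
  by move=> u Eu; apply: hM Eu; rewrite lt_max ltrDl ltr01.
have [K1 K10 K1E] : exists2 K1 : R, 0 <= K1 & (2 * (36 * (D + 1))) ^+ 2 * 2 <= K1.
  by exists ((2 * (36 * (D + 1))) ^+ 2 * 2) => //; apply: mulr_ge0 => //; exact: sqr_ge0.
have [L [L0 LE]] : exists L : R, 0 < L /\ (sin e * sin (e / 2))^-1 * lam0 = L.
  eexists; split; last reflexivity; have pi2 := @pi_ge2 R.
  by rewrite mulr_gt0// invr_gt0 mulr_gt0//; apply: sin_gt0_pi; lra.
have KL0 : 0 <= K1 * L by rewrite mulr_ge0// ltW.
(* the uncontrolled part of [E] sweeps at most [eps / 3] *)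
pose eta := eps / (6 * (K1 * L + 1)).
have eta0 : 0 < eta by rewrite /eta divr_gt0// mulr_gt0// ltr_wpDl.
have etaE : K1 * L * (2 * eta) <= eps / 3.
  have -> : eps / 3 = (K1 * L + 1) * (2 * eta) by rewrite /eta; field; rewrite gt_eqF// ltr_wpDl.
  by apply: ler_wpM2r; [rewrite mulr_ge0 ?(ltW eta0)|rewrite lerDl].
have [g [N [gC hR]]] := rectifiable_arcs rE fE tE eta0.
set Rm := E `\` _ in hR.
pose b : R := N%:R + 1.
have b0 : 0 < b by rewrite ltr_wpDl.
have [M [M1 tame]] := uniform_tame gC N (- b) b.
pose it0 : @step R := Step 0 0 0 0 1.
have cos1 : cos e < 1.
  by rewrite -(@cos0 R) ltr_cos// in_itv/=; have := @pi_ge2 R; lra.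
(* vectors this close to the plane of [l] have their class in the neighbourhood of [l] *)
pose k0 := (1 - cos e) / 32.
have k00 : 0 < k0 by rewrite /k0; lra.
have k01 : k0 <= 1 / 16 by rewrite /k0; have := cos_geN1 e; lra.
have k0e : 16 * k0 < 1 - cos e by rewrite /k0; lra.
clearbody k0 eta.
have eps3 : 0 < eps / 3 by rewrite divr_gt0.
have [s [s1 s2 s3 s4]] := zigzag_arcs e11 e22 e12 M1 b0 tame it0 lam00 e01 eps3 k00.
have s1i (i : 'I_(size s)) := s1 _ (in_nth it0 (ltn_ord i)).
have dirp1 a := dot3_dirp e11 e22 e12 a.
have ix0 it : List.In it s -> svec it != 0.
  move=> /s1[l0 _ _ hx]; apply/eqP => x0.
  move: hx; rewrite x0 sub0r normrN normrZ gtr0_norm// mulrC ler_pM2r// => hx.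
  have := norm_dot3 (dirv e1 e2 (sdir it)) (dirv e1 e2 (sdir it)).
  rewrite dot3_dirv// subrr cos0 normr1.
  have := ler_pM (normr_ge0 _) (normr_ge0 _) (le_trans hx k01) (le_trans hx k01).
  lra.
have ix2 it : List.In it s -> `|svec it| <= 2 * slen it.
  move=> /s1[l0 _ _ hx]; rewrite -(subrK (slen it *: dirv e1 e2 (sdir it)) (svec it)).
  apply: le_trans (ler_normD _ _) _.
  have h1 := norm_scale_dirv e11 e22 e12 (sdir it) (ltW l0).
  have h2 : k0 * slen it <= slen it by rewrite ler_piMl ?(ltW l0)// (le_trans k01)//; lra.
  by rewrite mulr_natl mulr2n lerD// (le_trans hx).
have [x xE] : exists x : 'I_(size s) -> nonzero3 R, forall i, val (x i) = svec (nth it0 s i).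
  by exists (fun i : 'I_(size s) => Sub (svec (nth it0 s i)) (ix0 _ (in_nth it0 (ltn_ord i)))).
exists (size s), x, (fun i => pclass (dirp e11 e22 e12 (slo (nth it0 s i) - e))); split => //.
- move=> i; have [l0 _ _ hx] := s1i i.
  exists (pclass (dirp e11 e22 e12 (sdir (nth it0 s i)))) => //.
  apply: lt_le_trans ee; move: hx; rewrite -xE => hx.
  have e0' : 0 < e <= 1 by rewrite e0.
  exact: pdist_near e0' l0 (dirp1 _) hx (ltW k00) k0e.
- by rewrite (path_endE (it0 := it0) xE) s2 yE.
set Z := [set v | _] in s4.
apply: (@le_lt_trans _ _ (lebesgue2 (sweep id s Rm) + lebesgue2 Z)%E).
  apply: le_trans (lebesgue2_setU _ _); apply: le_lebesgue2.
  move=> _ [i _ [_ [t /= t01 <-] [u [Eu hu] <-]]].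
  rewrite (path_vertexE (it0 := it0) i xE) xE /=.
  have [Ru|nRu] := pselect (Rm u); first by left; exact: (mem_sweep it0 id (ltn_ord i) Ru t01).
  have [j [a [jN ha uE ca]]] : exists j (a : R), [/\ (j < N)%N, - N%:R <= a <= N%:R,
       u = g j a & cross (derive1 (g j) a) (cis (theta u)) = 0].
    by apply: contrapT => h; apply: nRu; split.
  have gT : derive1 (g j) a != 0 by have [_ _] := gC j.
  have [|th hth h0] := normal_zero_in_sector ldir _ ee gT ca hu; first by rewrite e0.
  right; exists j, i, a, t; split => //.
  - by rewrite /b; move: ha; lra.
  - exists th; last by rewrite uE in h0.
    by have [_ -> _ _] := s1i i.
  - by rewrite uE.
have A1 := lebesgue2_sweep rigid_id eta0 (fun it h => conj (let: And4 a _ _ _ := s1 it h in a) (ix2 it h)) K1E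
  (fun u (h : Rm u) => ED u h.1) hR.
have A2 := lebesgue2_covers s4.
apply: le_lt_trans (leeD A1 A2) _; rewrite -EFinD lte_fin.
have : K1 * (\sum_(it <- s) slen it) * (2 * eta) <= K1 * L * (2 * eta).
  by rewrite ler_wpM2r ?mulr_ge0 ?(ltW eta0)// ler_wpM2l// -LE.
lra.
Qed.
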